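(* Let $\lambda>1$, $\mu>1$, $\Delta_1=[-\mu,-1]$, $\Delta_2=[1,\lambda]$, and let $\mathcal R$, $\pi$, $\psi^{(1)}$, $\psi^{(2)}$ be as in the context. Then the algebraic system $$ \begin{cases} 2\,(a+\alpha)(3-a\alpha-a-\alpha)(3-a\alpha+a+\alpha)+(\lambda-\mu)(a-\alpha)^3=0,\\ (\lambda+\mu)^2(a-\alpha)^6=4\,(3+a\alpha)^3(1-a\alpha)(2+a+\alpha)(2-a-\alpha) \end{cases} $$ has a unique solution $(\alpha,a)$ with $-1<\alpha<a<1$. For this solution, the equation $$x^2+(a+\alpha)x+\frac{(a-\alpha)^2}{1-a\alpha}-3=0$$ has two real solutions $\beta<-1$ and $b>1$. Put $$h=\frac14(a+\alpha)\Big(2a\alpha-\frac{(a-\alpha)^2}{1-a\alpha}\Big),\quad A=\frac14(1-\beta)(1-\alpha)(1-a)(1-b),\quad B=\frac14(1+\beta)(1+\alpha)(1+a)(1+b),$$ $$H(z)=h+z+\frac{Az}{1-z}+\frac{Bz}{1+z},\qquad G(z)=\frac{H(z)}{H(a)}.$$ Then $G$ is a rational function of degree $3$ which lifts to a conformal homeomorphism $g:\overline{\mathbb C}\to\mathcal R$ with $\pi\circ g=G$, and, writing $G^{-1}:=g^{-1}:\mathcal R\to\overline{\mathbb C}$, $$\psi^{(1)}=\frac{1}{H(a)}\,(1+G^{-1}),\qquad \psi^{(2)}=\frac{A}{2H(a)}\,\frac{1+G^{-1}}{1-G^{-1}}.$$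
   Context: $\overline{\mathbb C}$ is the extended complex plane. Given $\Delta_1=[-\mu,-1]$ and $\Delta_2=[1,\lambda]$, $\mathcal R$ is the compact three-sheeted Riemann surface formed by the sheets $\mathcal R_0=\overline{\mathbb C}\setminus\Delta_1$, $\mathcal R_1=\overline{\mathbb C}\setminus(\Delta_1\cup\Delta_2)$, $\mathcal R_2=\overline{\mathbb C}\setminus\Delta_2$, where $\mathcal R_0$ and $\mathcal R_1$ are glued crosswise along $\Delta_1$ (upper bank of one identified with lower bank of the other) and $\mathcal R_1$ and $\mathcal R_2$ are glued crosswise along $\Delta_2$. It is a branched cover of $\overline{\mathbb C}$ with projection $\pi$, and has genus $0$. For $w\in\overline{\mathbb C}$, $w^{(k)}$ denotes the point of sheet $\mathcal R_k$ projecting to $w$. For $l\in\{1,2\}$, $\psi^{(l)}$ denotes the conformal map of $\mathcal R$ onto $\overline{\mathbb C}$ such that $\psi^{(l)}(w)=w+O(1)$ as $w\to\infty^{(l)}$ and $\psi^{(l)}(w)=C_1/w+O(1/w^2)$ as $w\to\infty^{(0)}$ for some constant $C_1$. *)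

(* Defs.v *)
From HB Require Import structures.
From mathcomp Require Import all_boot all_order all_algebra.
From mathcomp Require Import all_classical all_reals all_analysis.
From mathcomp Require Import complex.
Set Implicit Arguments. Unset Strict Implicit. Unset Printing Implicit Defensive.
Import Order.TTheory GRing.Theory Num.Theory.
Local Open Scope ring_scope.
Local Open Scope complex_scope.

Definition Cbar (R : realType) := option R[i].

Definition cabs (R : realType) (z : R[i]) : R := Num.sqrt (complex.Re z ^+ 2 + complex.Im z ^+ 2).

Definition chord (R : realType) (z w : Cbar R) : R :=
  match z, w with
  | Some x, Some y =>
      2 * cabs (x - y) / Num.sqrt ((1 + cabs x ^+ 2) * (1 + cabs y ^+ 2))
  | Some x, None => 2 / Num.sqrt (1 + cabs x ^+ 2)
  | None, Some y => 2 / Num.sqrt (1 + cabs y ^+ 2)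
  | None, None => 0
  end.

Definition cbar_inv (R : realType) (w : Cbar R) : Cbar R :=
  match w with
  | None => Some 0
  | Some u => if u == 0 then None else Some u^-1
  end.

Definition cderivable (R : realType) (f : R[i] -> R[i]) (z : R[i]) : Prop :=
  derivable (f : R[i]^o -> R[i]^o) z 1.

Definition holo_fin (R : realType) (h : R[i] -> Cbar R) (z0 : R[i]) : Prop :=
  (\forall u \near (z0 : R[i]^o), h u != None) /\ cderivable (fun u => odflt 0 (h u)) z0.

(* f : Cbar -> Cbar is holomorphic (as a map into the Riemann sphere) at z,
   using the charts u |-> u near finite points, u |-> 1/u near infinity,
   and the chart 1/w in the target near the value infinity. *)
Definition holo_at (R : realType) (f : Cbar R -> Cbar R) (z : Cbar R) : Prop :=
  let h := match z with
           | Some _ => fun u => f (Some u)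
           | None => fun u => f (cbar_inv (Some u))
           end in
  let z0 := odflt 0 z in
  holo_fin h z0 \/ holo_fin (fun u => cbar_inv (h u)) z0.

(* rational function p/q (p, q coprime) as a map of the Riemann sphere *)
Definition ratC (R : realType) (p q : {poly R[i]}) (z : Cbar R) : Cbar R :=
  match z with
  | Some u => if q.[u] == 0 then None else Some (p.[u] / q.[u])
  | None => if (size q < size p)%N then None
            else if size p == size q then Some (lead_coef p / lead_coef q)
            else Some 0
  end.

Inductive sheet := S0 | S1 | S2.

(* Points of the surface:
   - Reg k w   : the point w^(k) of the (open) sheet R_k, w not on a cut of R_k;
   - Cut1 c x  : points over x in Delta1 (where sheets R_0, R_1 are glued):
                 c = None      : the branch point over x in {-mu, -1};
                 c = Some true : for -mu<x<-1, the point obtained by identifying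
                                 the upper bank of R_0 with the lower bank of R_1;
                 c = Some false: the point identifying the lower bank of R_0
                                 with the upper bank of R_1;
   - Cut2 c x  : the same over Delta2 for the sheets R_1 (role of R_0 above)
                 and R_2 (role of R_1 above). *)
Inductive surf (R : realType) :=
| Reg of sheet & Cbar R
| Cut1 of option bool & R
| Cut2 of option bool & R.

Definition inDelta1 (R : realType) (mu : R) (w : Cbar R) : Prop :=
  match w with
  | Some z => complex.Im z = 0 /\ - mu <= complex.Re z <= -1
  | None => False
  end.

Definition inDelta2 (R : realType) (lam : R) (w : Cbar R) : Prop :=
  match w with
  | Some z => complex.Im z = 0 /\ 1 <= complex.Re z <= lam
  | None => False
  end.

Definition on_cut (R : realType) (lam mu : R) (k : sheet) (w : Cbar R) : Prop :=
  match k with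
  | S0 => inDelta1 mu w
  | S1 => inDelta1 mu w \/ inDelta2 lam w
  | S2 => inDelta2 lam w
  end.

Definition valid (R : realType) (lam mu : R) (p : surf R) : Prop :=
  match p with
  | Reg k w => ~ on_cut lam mu k w
  | Cut1 None x => x = - mu \/ x = -1
  | Cut1 (Some _) x => - mu < x < -1
  | Cut2 None x => x = 1 \/ x = lam
  | Cut2 (Some _) x => 1 < x < lam
  end.

Definition surf_proj (R : realType) (p : surf R) : Cbar R :=
  match p with
  | Reg _ w => w
  | Cut1 _ x => Some x%:C
  | Cut2 _ x => Some x%:C
  end.

(* on_side p k up : p lies in the closure of the upper (up = true) or lower
   (up = false) half of the sheet R_k (the banks of the cuts being glued
   crosswise as described above; infinity lies in both halves). *)
Definition on_side (R : realType) (p : surf R) (k : sheet) (up : bool) : Prop :=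
  match p with
  | Reg k' w => k = k' /\ match w with
                          | None => True
                          | Some z => if up then 0 <= complex.Im z else complex.Im z <= 0
                          end
  | Cut1 None _ => k = S0 \/ k = S1
  | Cut1 (Some s) _ => (k = S0 /\ up = s) \/ (k = S1 /\ up = ~~ s)
  | Cut2 None _ => k = S1 \/ k = S2
  | Cut2 (Some s) _ => (k = S1 /\ up = s) \/ (k = S2 /\ up = ~~ s)
  end.

(* basic neighbourhoods of p (a neighbourhood base for small e) *)
Definition surf_nbhd (R : realType) (p : surf R) (e : R) (q : surf R) : Prop :=
  chord (surf_proj q) (surf_proj p) < e /\ exists k up, on_side p k up /\ on_side q k up.

Definition cont_to_surf (R : realType) (g : Cbar R -> surf R) (z : Cbar R) : Prop :=
  forall e : R, 0 < e -> exists2 d : R, 0 < d &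
    forall z', chord z z' < d -> surf_nbhd (g z) e (g z').

Definition cont_from_surf (R : realType) (lam mu : R) (f : surf R -> Cbar R)
    (p : surf R) : Prop :=
  forall e : R, 0 < e -> exists2 d : R, 0 < d &
    forall q, valid lam mu q -> surf_nbhd p d q -> chord (f p) (f q) < e.

Definition surf_homeo (R : realType) (lam mu : R) (g : Cbar R -> surf R)
    (ginv : surf R -> Cbar R) : Prop :=
  [/\ forall z, valid lam mu (g z),
      forall z, ginv (g z) = z,
      forall p, valid lam mu p -> g (ginv p) = p,
      forall z, cont_to_surf g z
    & forall p, valid lam mu p -> cont_from_surf lam mu ginv p].

(* g is a conformal homeomorphism of the Riemann sphere onto the surface.
   The complex structure of the surface is the one for which pi is
   holomorphic (pi is a local coordinate off the branch points), hence
   holomorphy of a continuous g amounts to holomorphy of pi o g. *)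
Definition conformal_param (R : realType) (lam mu : R) (g : Cbar R -> surf R)
    (ginv : surf R -> Cbar R) : Prop :=
  surf_homeo lam mu g ginv /\ forall z, holo_at (fun z => surf_proj (g z)) z.

(* f is a conformal map of the surface onto the Riemann sphere: a
   homeomorphism which is holomorphic on every open sheet R_k (in the
   coordinate pi); by continuity it is then holomorphic across the cuts
   and at the branch points (removable singularities). *)
Definition conformal_surf (R : realType) (lam mu : R) (f : surf R -> Cbar R) : Prop :=
  (exists finv : Cbar R -> surf R, surf_homeo lam mu finv f) /\
  forall (k : sheet) (z : Cbar R), ~ on_cut lam mu k z ->
    holo_at (fun w => f (Reg k w)) z.

Definition is_psi (R : realType) (lam mu : R) (l : sheet) (f : surf R -> Cbar R) : Prop :=
  [/\ conformal_surf lam mu f,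
      exists M r : R, forall w : R[i], r < cabs w ->
        exists2 v, f (Reg l (Some w)) = Some v & cabs (v - w) <= M
    &
      exists (C1 : R[i]) (M r : R), forall w : R[i], r < cabs w ->
        exists2 v, f (Reg S0 (Some w)) = Some v &
                   cabs (v - C1 / w) <= M / cabs w ^+ 2].

Definition alg_system (R : realType) (lam mu alpha a : R) : Prop :=
  2 * (a + alpha) * (3 - a * alpha - a - alpha) * (3 - a * alpha + a + alpha)
    + (lam - mu) * (a - alpha) ^+ 3 = 0 /\
  (lam + mu) ^+ 2 * (a - alpha) ^+ 6 =
    4 * (3 + a * alpha) ^+ 3 * (1 - a * alpha) * (2 + a + alpha) * (2 - a - alpha).

Definition quad_eq (R : realType) (alpha a x : R) : Prop :=
  x ^+ 2 + (a + alpha) * x + (a - alpha) ^+ 2 / (1 - a * alpha) - 3 = 0.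

Definition h_const (R : realType) (alpha a : R) : R :=
  4^-1 * (a + alpha) * (2 * a * alpha - (a - alpha) ^+ 2 / (1 - a * alpha)).

Definition A_const (R : realType) (beta alpha a b : R) : R :=
  4^-1 * (1 - beta) * (1 - alpha) * (1 - a) * (1 - b).

Definition B_const (R : realType) (beta alpha a b : R) : R :=
  4^-1 * (1 + beta) * (1 + alpha) * (1 + a) * (1 + b).

Definition Hfun (R : realType) (h A B : R) (z : R[i]) : R[i] :=
  h%:C + z + A%:C * z / (1 - z) + B%:C * z / (1 + z).

Definition psi1_formula (R : realType) (Ha : R[i]) (ginv : surf R -> Cbar R)
    (p : surf R) : Cbar R :=
  match ginv p with
  | None => None
  | Some u => Some ((1 + u) / Ha)
  end.

Definition psi2_formula (R : realType) (A : R) (Ha : R[i]) (ginv : surf R -> Cbar R)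
    (p : surf R) : Cbar R :=
  match ginv p with
  | None => Some (- (A%:C / (2 * Ha)))
  | Some u => if u == 1 then None
              else Some (A%:C / (2 * Ha) * ((1 + u) / (1 - u)))
  end.

(* Main.v *)
(** Up to a positive factor, G is [k + z - A' / (1 - z) + B' / (1 + z)] with [A', B' > 0], and the
    imaginary part of this is [Im z * Q z] with [Q z = 1 - A' / |1 - z|^2 - B' / |1 + z|^2]. By
    AM-GM the difference quotient of the map is at least [(Q z + Q z') / 2] in modulus, so the
    map is injective on each half of [Q >= 0]: these halves are the two halves of the middle
    sheet. The set [Q <= 0] avoids a vertical line between [alpha] and [a]; it is cut by that
    line into the two outer sheets. Of the three roots of [G z = w] one lies in each piece,
    by continuity along a path issuing from the line.

    Two candidates for psi differ by a function f that is finite off the pole; the products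
    of [f + c] over the three sheets are bounded, continuous on the plane and holomorphic off
    the real line, hence constant by Liouville. So f has finitely many values, and it vanishes
    at infinity on sheet 0.

    The algebraic system is solved by a parametrization and the intermediate value theorem.
    Its solution is unique because [psi^(1)] is: it determines the inverse of g, which sends
    the branch points over -1 and 1 to [alpha] and [a]. *)
Require Import Defs.
From HB Require Import structures.
From mathcomp Require Import all_boot all_order all_algebra.
From mathcomp Require Import all_classical all_reals all_analysis.
From mathcomp Require Import complex ring lra.
Import Order.TTheory GRing.Theory Num.Theory.
Import numFieldNormedType.Exports.
Local Open Scope ring_scope.
Local Open Scope complex_scope.
Set Implicit Arguments.
Unset Strict Implicit.
Unset Printing Implicit Defensive.
Local Notation Re := complex.Re.
Local Notation Im := complex.Im.

(** * The Riemann sphere *)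

(** The surface has no topology or atlas beyond the definitions: a point is known through its
    projection and the closed half-sheets that contain it. The proof therefore uses six closed
    pieces of the z-plane, two for each sheet, and shows that a piece corresponds exactly to a
    closed half-sheet ([gmap_side]). Continuity of the parametrization then expresses that the
    pieces are closed. Continuity of the inverse comes from compactness of the sphere, in the form
    of limits along an ultrafilter.

    For the uniqueness of psi the obstacle is the cuts, where a candidate is only known to be
    continuous. Cauchy's theorem is therefore proved for functions that are merely continuous on
    some horizontal lines. Products over the sheets are used because crossing a cut only permutes
    the factors. When c is minus a value of f, the product vanishes at one point, hence at 0, so
    this value is one of the three values of f over 0. *)

Section Modulus.
Context {R : realType}.
Implicit Types (z w : R[i]) (x : R).

Lemma cReD z w : Re (z + w) = Re z + Re w. Proof. by case: z w => ? ? []. Qed.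

Lemma cImD z w : Im (z + w) = Im z + Im w. Proof. by case: z w => ? ? []. Qed.

Lemma cReN z : Re (- z) = - Re z. Proof. by case: z. Qed.

Lemma cImN z : Im (- z) = - Im z. Proof. by case: z. Qed.

Lemma cReM z w : Re (z * w) = Re z * Re w - Im z * Im w. Proof. by case: z w => ? ? []. Qed.

Lemma cImM z w : Im (z * w) = Re z * Im w + Im z * Re w. Proof. by case: z w => ? ? []. Qed.

Lemma complex_ext z w : Re z = Re w -> Im z = Im w -> z = w.
Proof. by case: z w => ? ? [? ?] /= -> ->. Qed.

Lemma norm_cabs z : `|z| = (cabs z)%:C.
Proof. by rewrite normc_def. Qed.

Lemma cabs_ge0 z : 0 <= cabs z. Proof. exact: sqrtr_ge0. Qed.

Lemma cabsE_sq z : cabs z ^+ 2 = Re z ^+ 2 + Im z ^+ 2.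
Proof. by rewrite sqr_sqrtr ?addr_ge0 ?sqr_ge0. Qed.

Lemma cabsM z w : cabs (z * w) = cabs z * cabs w.
Proof. by apply: (@complexI R); rewrite rmorphM /= -!norm_cabs normrM. Qed.

Lemma cabsD z w : cabs (z + w) <= cabs z + cabs w.
Proof. by rewrite -lecR rmorphD /= -!norm_cabs ler_normD. Qed.

Lemma cabsN z : cabs (- z) = cabs z.
Proof. by apply: (@complexI R); rewrite -!norm_cabs normrN. Qed.

Lemma cabsC z w : cabs (z - w) = cabs (w - z).
Proof. by rewrite -cabsN opprB. Qed.

Lemma cabsV z : cabs z^-1 = (cabs z)^-1.
Proof. by apply: (@complexI R); rewrite -norm_cabs normfV norm_cabs fmorphV. Qed.

Lemma cabsf_div z w : cabs (z / w) = cabs z / cabs w.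
Proof. by rewrite cabsM cabsV. Qed.

Lemma cabsX z n : cabs (z ^+ n) = cabs z ^+ n.
Proof. by apply: (@complexI R); rewrite -norm_cabs normrX norm_cabs rmorphXn. Qed.

Lemma cabs0 : cabs (0 : R[i]) = 0.
Proof. by apply: (@complexI R); rewrite -norm_cabs normr0. Qed.

Lemma cabs1 : cabs (1 : R[i]) = 1.
Proof. by apply: (@complexI R); rewrite -norm_cabs normr1. Qed.

Lemma cabs_eq0 z : (cabs z == 0) = (z == 0).
Proof.
apply/eqP/eqP => [h|->]; last exact: cabs0.
by apply/eqP; rewrite -normr_eq0 norm_cabs h.
Qed.

Lemma cabs_gt0 z : (0 < cabs z) = (z != 0).
Proof. by rewrite lt_def cabs_ge0 andbT cabs_eq0. Qed.

Lemma cabsR x : cabs x%:C = `|x|.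
Proof. by rewrite /cabs /= expr0n addr0 sqrtr_sqr. Qed.

Lemma cabs_nat n : cabs (n%:R : R[i]) = n%:R.
Proof. by rewrite -(rmorph_nat (real_complex R)) cabsR ger0_norm. Qed.

Lemma cabsB_ge z w : cabs z - cabs w <= cabs (z - w).
Proof. by rewrite lerBlDr -{1}(subrK w z) cabsD. Qed.

Lemma cabsB z w : cabs (z - w) <= cabs z + cabs w.
Proof. by rewrite -(cabsN w) cabsD. Qed.

Lemma cabs_distD v z w : cabs (z - w) <= cabs (z - v) + cabs (v - w).
Proof. by rewrite -(subrKA v) cabsD. Qed.

Lemma Re_le_cabs z : `|Re z| <= cabs z.
Proof.
rewrite -(@ler_pXn2r _ 2) ?nnegrE ?cabs_ge0 // cabsE_sq real_normK ?num_real //.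
by rewrite lerDl sqr_ge0.
Qed.

Lemma Im_le_cabs z : `|Im z| <= cabs z.
Proof.
rewrite -(@ler_pXn2r _ 2) ?nnegrE ?cabs_ge0 // cabsE_sq real_normK ?num_real //.
by rewrite lerDr sqr_ge0.
Qed.

Lemma cabs_le_ReIm z : cabs z <= `|Re z| + `|Im z|.
Proof.
rewrite -(@ler_pXn2r _ 2) ?nnegrE ?cabs_ge0 ?addr_ge0 // cabsE_sq.
rewrite sqrrD !real_normK ?num_real //.
have : 0 <= `|Re z| * `|Im z| by rewrite mulr_ge0.
lra.
Qed.

End Modulus.

(** Neighbourhoods for the chordal metric, kept as a bare predicate. [nb_fin] and [nb_inf] translate
    them to the plane, so the chordal formula is rarely unfolded. *)
Definition nb {R : realType} (p : Cbar R) (P : Cbar R -> Prop) : Prop :=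
  exists2 d : R, 0 < d & forall q, chord p q < d -> P q.

Section Sphere.
Context {R : realType}.
Implicit Types (z w : R[i]) (p q : Cbar R) (P Q : Cbar R -> Prop).

Lemma chordC p q : chord p q = chord q p.
Proof. by case: p q => [z|] [w|] //=; rewrite cabsC mulrC [X in Num.sqrt X]mulrC mulrC. Qed.

Lemma chord_refl p : chord p p = 0.
Proof. by case: p => [z|] //=; rewrite subrr cabs0 mulr0 mul0r. Qed.

Lemma sqrt1D_ge1 (x : R) : 1 <= Num.sqrt (1 + x ^+ 2).
Proof. by rewrite -{1}sqrtr1 ler_sqrt ?lerDl ?sqr_ge0 // addr_ge0 // sqr_ge0. Qed.

Lemma sqrt1D_ge (x : R) : 0 <= x -> x <= Num.sqrt (1 + x ^+ 2).
Proof.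
move=> x0; rewrite -{1}(ger0_norm x0) -sqrtr_sqr ler_sqrt ?lerDr //.
by rewrite addr_ge0 // sqr_ge0.
Qed.

Lemma sqrt1D_le (x : R) : 0 <= x -> Num.sqrt (1 + x ^+ 2) <= 1 + x.
Proof.
move=> x0; rewrite -[leRHS]ger0_norm ?addr_ge0 // -sqrtr_sqr ler_sqrt ?sqr_ge0 //.
by rewrite sqrrD expr1n mul1r lerD2r lerDl mulrn_wge0.
Qed.

Lemma chord_le z w : chord (Some z) (Some w) <= 2 * cabs (z - w).
Proof.
rewrite /= sqrtrM ?addr_ge0 ?sqr_ge0 // ler_pdivrMr; last first.
  by rewrite mulr_gt0 // (lt_le_trans ltr01) // sqrt1D_ge1.
by rewrite ler_peMr ?mulr_ge0 ?cabs_ge0 // mulr_ege1 // sqrt1D_ge1.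
Qed.

Lemma nb_fin z P :
  nb (Some z) P <-> exists2 d : R, 0 < d & forall w, cabs (w - z) < d -> P (Some w).
Proof.
split=> -[d d0 h].
  exists (d / 2); first by rewrite divr_gt0.
  move=> w hw; apply: h; apply: le_lt_trans (chord_le _ _) _.
  by rewrite cabsC mulrC -ltr_pdivlMr.
have r0 := cabs_ge0 z.
have h1 : 0 < 1 + cabs z by rewrite ltr_wpDr.
have h2 : 0 < 1 + cabs z + d by rewrite ltr_wpDr ?(ltW d0).
(* A point at Euclidean distance t from z has chordal distance at least 2 t / ((1 + |z|) (1 + |z| +
   t)). This increases with t towards 2 / (1 + |z|), a lower bound for the chordal distance to
   infinity, so infinity is excluded as well. *)
exists (2 * d / ((1 + cabs z) * (1 + cabs z + d))).
  by rewrite divr_gt0 ?mulr_gt0.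
case=> [w|] /=; last first.
  rewrite ltNge => /negP[].
  rewrite ler_pdivrMr ?mulr_gt0 // mulrAC ler_pdivlMr; last first.
    by rewrite (lt_le_trans ltr01) // sqrt1D_ge1.
  rewrite -!mulrA ler_pM2l // mulrC ler_pM ?sqrtr_ge0 ?(ltW d0) ?sqrt1D_le //.
  by rewrite lerDr ltW.
move=> hc; apply: h; rewrite cabsC ltNge; apply/negP => hd.
move: hc; rewrite ltNge => /negP[].
set t := cabs (z - w) in hd *.
have t0 : 0 <= t by exact: cabs_ge0.
have hw : cabs w <= cabs z + t.
  by rewrite -{1}(subKr z w) (le_trans (cabsB _ _)).
have w0 := cabs_ge0 w.
have s1 : 0 < Num.sqrt (1 + cabs z ^+ 2) by rewrite (lt_le_trans ltr01) // sqrt1D_ge1.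
have s2 : 0 < Num.sqrt (1 + cabs w ^+ 2) by rewrite (lt_le_trans ltr01) // sqrt1D_ge1.
have h3 : 0 < 1 + cabs z + t by rewrite ltr_wpDr.
apply: (@le_trans _ _ (2 * t / ((1 + cabs z) * (1 + cabs z + t)))).
  rewrite ler_pdivrMr ?mulr_gt0 // mulrAC ler_pdivlMr ?mulr_gt0 //.
  rewrite -!mulrA ler_pM2l // mulrCA [leRHS]mulrCA ler_pM2l //.
  have : d * (1 + cabs z) <= t * (1 + cabs z) by rewrite ler_pM2r.
  by rewrite !mulrDr [t * d]mulrC; lra.
rewrite sqrtrM ?addr_ge0 ?sqr_ge0 //.
apply: ler_wpM2l; first by rewrite mulr_ge0.
rewrite lef_pV2 ?posrE ?mulr_gt0 //.
apply: ler_pM; rewrite ?(ltW s1) ?(ltW s2) ?sqrt1D_le //.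
by rewrite (le_trans (sqrt1D_le w0)) // -addrA lerD2l.
Qed.

Lemma nb_inf P :
  nb None P <-> P None /\ exists M : R, forall w, M < cabs w -> P (Some w).
Proof.
split=> [[d d0 h]|[hN [M h]]].
  split; first by apply: h; rewrite chord_refl.
  exists (2 / d) => w hw; apply: h => /=.
  have w0 : 0 < cabs w by apply: lt_trans hw; rewrite divr_gt0.
  rewrite ltr_pdivrMr; last by rewrite (lt_le_trans ltr01) // sqrt1D_ge1.
  rewrite mulrC -ltr_pdivrMr //; apply: lt_le_trans hw _; exact/sqrt1D_ge/ltW.
have h1 : 0 < 1 + `|M| by rewrite ltr_wpDr.
exists (2 / (1 + `|M|)); first by rewrite divr_gt0.
case=> [w|] //= hw; apply: h.
move: hw; rewrite ltr_pM2l // ltf_pV2 ?posrE //; last first.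
  by rewrite (lt_le_trans ltr01) // sqrt1D_ge1.
move=> hw; have := lt_le_trans hw (sqrt1D_le (cabs_ge0 w)).
by rewrite ltrD2l; apply: le_lt_trans; exact: ler_norm.
Qed.

Lemma nb_imp p P Q : (forall q, P q -> Q q) -> nb p P -> nb p Q.
Proof. by move=> h [d d0 hd]; exists d => // q /hd /h. Qed.

Lemma nbI p P Q : nb p P -> nb p Q -> nb p (fun q => P q /\ Q q).
Proof.
move=> [d d0 hd] [e e0 he]; exists (Num.min d e); first by rewrite lt_min d0.
by move=> q; rewrite lt_min => /andP[/hd ? /he ?].
Qed.

Lemma nbT p P : (forall q, P q) -> nb p P.
Proof. by move=> h; exists 1. Qed.

Lemma nb_sep p q : p <> q -> exists P, nb p P /\ nb q (fun r => ~ P r).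
Proof.
case: p q => [z|] [w|] // hpq.
- have hzw : 0 < cabs (z - w).
    by rewrite cabs_gt0 subr_eq0; apply/eqP => e; apply: hpq; rewrite e.
  pose d := cabs (z - w) / 2.
  have d0 : 0 < d by rewrite divr_gt0.
  exists (fun r => if r is Some v then is_true (cabs (v - z) < d) else False); split.
    by apply/nb_fin; exists d.
  apply/nb_fin; exists d => // v hv hv'.
  have := cabs_distD v z w; rewrite [cabs (z - v)]cabsC => h3.
  by move: hv hv'; rewrite /d; lra.
- exists (fun r => if r is Some v then is_true (cabs (v - z) < 1) else False); split.
    by apply/nb_fin; exists 1.
  apply/nb_inf; split=> //; exists (cabs z + 1) => v hv hv'.
  have := cabsB_ge v z; lra.
- exists (fun r => ~ if r is Some v then is_true (cabs (v - w) < 1) else False); split.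
    apply/nb_inf; split=> //; exists (cabs w + 1) => v hv hv'.
    have := cabsB_ge v w; lra.
  by apply/nb_fin; exists 1 => // v hv; apply.
Qed.

Definition scont (f : Cbar R -> Cbar R) p := forall P, nb (f p) P -> nb p (fun q => P (f q)).

Lemma cbar_invK : involutive (@cbar_inv R).
Proof.
case=> [z|] /=; last by rewrite eqxx.
by case: eqVneq => [->//|z0] /=; rewrite invr_eq0 (negPf z0) invrK.
Qed.

(** Inversion is a rotation of the sphere. Through [nb_inv] this reduces neighbourhoods of infinity
    to neighbourhoods of 0. *)
Lemma chord_inv p q : chord (cbar_inv p) (cbar_inv q) = chord p q.
Proof.
have key z : z != 0 -> Num.sqrt (1 + cabs z^-1 ^+ 2) = Num.sqrt (1 + cabs z ^+ 2) / cabs z.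
  move=> z0; have c0 : 0 < cabs z by rewrite cabs_gt0.
  rewrite -{2}(ger0_norm (cabs_ge0 z)) -sqrtr_sqr -sqrtrV -?sqrtrM ?addr_ge0 ?sqr_ge0 //.
  by congr Num.sqrt; rewrite cabsV; field; rewrite gt_eqF.
have s0 z : Num.sqrt (1 + cabs z ^+ 2) != 0.
  by rewrite gt_eqF // (lt_le_trans ltr01) // sqrt1D_ge1.
have e0 : Num.sqrt (1 + 0 ^+ 2 : R) = 1 by rewrite expr0n addr0 sqrtr1.
have keyN z : z != 0 -> 2 / Num.sqrt (1 + cabs z^-1 ^+ 2) =
  2 * cabs z / Num.sqrt (1 + cabs z ^+ 2).
  by move=> z0; rewrite key // invf_div mulrA.
case: p q => [z|] [w|] /=; rewrite ?eqxx ?subrr ?cabs0 ?mulr0 ?mul0r //.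
- case: (eqVneq z 0) => [->|z0]; case: (eqVneq w 0) => [->|w0] /=;
    rewrite ?subrr ?cabs0 ?mulr0 ?mul0r ?sub0r ?cabsN ?subr0 //.
  + by rewrite keyN // expr0n addr0 mul1r.
  + by rewrite keyN // expr0n addr0 mulr1.
  + rewrite !sqrtrM ?addr_ge0 ?sqr_ge0 // !key //.
    have -> : z^-1 - w^-1 = (w - z) / (z * w) by field; rewrite z0 w0.
    rewrite cabsM cabsV cabsM [cabs (w - z)]cabsC.
    by field; rewrite !s0 !cabs_eq0 z0 w0.
- case: eqVneq => [->|z0] /=; first by rewrite cabs0 e0 divr1.
  rewrite subr0 cabs0 expr0n addr0 mulr1 key // cabsV.
  by field; rewrite s0 cabs_eq0 z0.
- case: eqVneq => [->|w0] /=; first by rewrite cabs0 e0.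
  rewrite sub0r cabsN expr0n addr0 mul1r key // cabsV.
  by field; rewrite s0 cabs_eq0 w0.
Qed.

Lemma nb_inv p P : nb p P <-> nb (cbar_inv p) (fun q => P (cbar_inv q)).
Proof.
split=> -[d d0 h]; exists d => // q hq; last by rewrite -[q]cbar_invK; apply: h; rewrite chord_inv.
by apply: h; rewrite -chord_inv cbar_invK.
Qed.

End Sphere.

(* A wrapper that keeps unification from unfolding filter convergence. *)
Variant ccont {R : realType} (f : R[i] -> R[i]) (z : R[i]) : Prop :=
  CCont of {for z, continuous (f : R[i]^o -> R[i]^o)}.

(** * Continuity and complex differentiability in the plane *)

Section Continuity.
Context {R : realType}.
Implicit Types (f g : R[i] -> R[i]) (z w : R[i]).

Lemma near_cabs z (P : R[i] -> Prop) :
  (\forall u \near (z : R[i]^o), P u) <->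
  exists2 d : R, 0 < d & forall u, cabs (u - z) < d -> P u.
Proof.
split.
  move=> /nbhs_ballP[e /= e0 h]; have e0r := gtr0_real e0.
  have eE : e = (Re e)%:C by rewrite RRe_real.
  exists (Re e); first by rewrite -ltcR -eE.
  by move=> u hu; apply: h; rewrite /ball /= distrC norm_cabs eE ltcR.
move=> [d d0 h]; apply/nbhs_ballP; exists d%:C; first by rewrite /= ltcR.
by move=> u; rewrite /ball /= distrC norm_cabs ltcR => /h.
Qed.

Lemma ccontP f z : ccont f z <->
  forall e : R, 0 < e -> exists2 d : R, 0 < d &
    forall w, cabs (w - z) < d -> cabs (f w - f z) < e.
Proof.
split=> [[h] e e0|h].
  apply/near_cabs; apply: (h (fun v => cabs (v - f z) < e)).
  by apply/near_cabs; exists e.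
by split=> P /near_cabs[e e0 hP]; have [d d0 hd] := h e e0; apply/near_cabs;
  exists d => // u /hd; exact: hP.
Qed.

Lemma ccont_near f z (P : R[i] -> Prop) : ccont f z ->
  (\forall v \near (f z : R[i]^o), P v) -> \forall u \near (z : R[i]^o), P (f u).
Proof. by case=> h /h. Qed.

Lemma ccont_cst (c : R[i]) z : ccont (fun=> c) z.
Proof. split; exact: (@cvg_cst R[i]^o _ _ (nbhs (z : R[i]^o))). Qed.

Lemma ccont_id z : ccont id z.
Proof. split; exact: (@cvg_id _ (nbhs (z : R[i]^o))). Qed.

Lemma ccontD  f g z : ccont f z -> ccont g z -> ccont (fun u => f u + g u) z.
Proof. by case=> hf [hg]; split; exact: (@cvgD R[i] R[i]^o R[i]^o (nbhs (z:R[i]^o)) _ f g _ _ hf hg). Qed.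

Lemma ccontN f z : ccont f z -> ccont (fun u => - f u) z.
Proof. by case=> hf; split; exact: (@cvgN R[i] R[i]^o R[i]^o (nbhs (z:R[i]^o)) _ f _ hf). Qed.

Lemma ccontB f g z : ccont f z -> ccont g z -> ccont (fun u => f u - g u) z.
Proof. by move=> hf hg; exact: (ccontD hf (ccontN hg)). Qed.

Lemma ccontM f g z : ccont f z -> ccont g z -> ccont (fun u => f u * g u) z.
Proof. by case=> hf [hg]; split; exact: (@cvgM R[i] R[i]^o (nbhs (z:R[i]^o)) _ f g _ _ hf hg). Qed.

Lemma ccontV f z : f z != 0 -> ccont f z -> ccont (fun u => (f u)^-1) z.
Proof. by move=> h0 [h]; split; exact: (@cvgV R[i] R[i]^o (nbhs (z:R[i]^o)) _ f _ h0 h). Qed.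

Lemma ccont_comp f g z : ccont f z -> ccont g (f z) -> ccont (fun u => g (f u)) z.
Proof. by case=> hf [hg]; split=> P /hg /hf. Qed.

Lemma ccont_eqnear f g z : (\forall u \near (z : R[i]^o), f u = g u) ->
  ccont f z -> ccont g z.
Proof.
move=> hfg hf; have := hfg => /near_cabs[d0 d00 hd0].
have e : f z = g z by apply: hd0; rewrite subrr cabs0.
apply/ccontP => e0 /(proj1 (ccontP f z) hf)[d1 d10 hd1].
exists (Num.min d0 d1); first by rewrite lt_min d00.
by move=> w; rewrite lt_min => /andP[/hd0 <- /hd1]; rewrite e.
Qed.

(* Caratheodory's form of differentiability: the difference quotient extends
   continuously to [z]. *)
Definition cdiff f z := exists2 phi, ccont phi z &
  \forall u \near (z : R[i]^o), f u - f z = phi u * (u - z).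

Lemma cdiff_derivable f z : cdiff f z -> cderivable f z.
Proof.
move=> [phi cphi hphi]; apply/cvg_ex; exists (phi z).
case: cphi => cphi P /cphi /= /near_cabs[d d0 hd]; have /near_cabs[e e0 he] := hphi.
apply/near_cabs; exists (Num.min d e); first by rewrite lt_min d0.
move=> h; rewrite lt_min subr0 => /andP[h1 h2] h0 /=.
have hh : h *: (1 : R[i]^o) + z - z = h by rewrite addrK /GRing.scale /= mulr1.
have -> : h^-1 *: (((f : R[i]^o -> R[i]^o) \o shift z) (h *: (1 : R[i]^o)) - (f : R[i]^o -> R[i]^o) z)
   = phi (h *: (1 : R[i]^o) + z).
  by rewrite /= he hh // /GRing.scale /= mulrC mulfK.
by apply: hd; rewrite hh.
Qed.

Lemma derivable_cdiff f z : cderivable f z -> cdiff f z.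
Proof.
move=> /cvg_ex[d hd].
exists (fun u => if u == z then d else (f u - f z) / (u - z)); last first.
  apply/near_cabs; exists 1 => // u _; case: eqVneq => [->|uz]; first by rewrite !subrr mulr0.
  by rewrite divfK // subr_eq0.
apply/ccontP => e e0.
have : \forall v \near (d : R[i]^o), cabs (v - d) < e by apply/near_cabs; exists e.
move=> /hd /= /near_cabs[r r0 hr]; exists r => // w hw.
rewrite eqxx; case: eqVneq => [_|wz]; first by rewrite subrr cabs0.
have /hr : cabs (w - z - 0) < r by rewrite subr0.
rewrite subr_eq0 => /(_ wz) /=; rewrite /GRing.scale /= mulr1 subrK mulrC; exact.
Qed.

Lemma cdiff_cont f z : cdiff f z -> ccont f z.
Proof.
move=> [phi cphi hphi].
apply: (@ccont_eqnear (fun u => f z + phi u * (u - z))).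
  by apply: filterS hphi => u <-; rewrite addrC subrK.
exact: ccontD (ccont_cst (f z) z) (ccontM cphi (ccontB (ccont_id z) (ccont_cst z z))).
Qed.

Lemma cdiff_eqnear f g z : (\forall u \near (z : R[i]^o), f u = g u) ->
  cdiff f z -> cdiff g z.
Proof.
move=> hfg [phi cphi hphi]; exists phi => //.
have e : f z = g z by have /near_cabs[d d0 h] := hfg; apply: h; rewrite subrr cabs0.
by apply: filterS2 hfg hphi => u <-; rewrite e.
Qed.

Lemma cdiff_cst (c : R[i]) z : cdiff (fun=> c) z.
Proof.
by exists (fun=> 0); [exact: ccont_cst | apply: filterE => u; rewrite subrr mul0r].
Qed.

Lemma cdiff_id z : cdiff id z.
Proof. by exists (fun=> 1); [exact: ccont_cst | apply: filterE => u; rewrite mul1r]. Qed.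

Lemma cdiffD f g z : cdiff f z -> cdiff g z -> cdiff (fun u => f u + g u) z.
Proof.
move=> [p cp hp] [q cq hq]; exists (fun u => p u + q u); first exact: ccontD.
by apply: filterS2 hp hq => u h1 h2; rewrite mulrDl -h1 -h2; ring.
Qed.

Lemma cdiffM f g z : cdiff f z -> cdiff g z -> cdiff (fun u => f u * g u) z.
Proof.
move=> df dg; have cg := cdiff_cont dg; move: df dg => [p cp hp] [q cq hq].
exists (fun u => p u * g u + f z * q u).
  by apply: ccontD; apply: ccontM => //; exact: ccont_cst.
apply: filterS2 hp hq => u h1 h2.
have -> : (p u * g u + f z * q u) * (u - z) = (p u * (u - z)) * g u + f z * (q u * (u - z)).
  by ring.
by rewrite -h1 -h2; ring.
Qed.

Lemma cdiffN f z : cdiff f z -> cdiff (fun u => - f u) z.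
Proof.
move=> h; apply: (@cdiff_eqnear (fun u => (-1) * f u)).
  by apply: filterE => u; rewrite mulN1r.
exact: cdiffM (cdiff_cst _ _) h.
Qed.

Lemma cdiffB f g z : cdiff f z -> cdiff g z -> cdiff (fun u => f u - g u) z.
Proof. by move=> hf hg; apply: cdiffD => //; exact: cdiffN. Qed.

Lemma ccont_neq0 f z : ccont f z -> f z != 0 -> \forall u \near (z : R[i]^o), f u != 0.
Proof.
move=> cf fz; apply: (ccont_near (P := fun v => v != 0) cf).
apply/near_cabs; exists (cabs (f z)); first by rewrite cabs_gt0.
by move=> u; apply: contraTneq => ->; rewrite sub0r cabsN ltxx.
Qed.

Lemma cdiffV f z : f z != 0 -> cdiff f z -> cdiff (fun u => (f u)^-1) z.
Proof.
move=> fz df; have cf := cdiff_cont df; move: df => [p cp hp].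
exists (fun u => - p u / (f u * f z)).
  apply: ccontM; first exact: ccontN.
  by apply: ccontV; [rewrite mulf_neq0 | apply: ccontM => //; exact: ccont_cst].
apply: filterS2 hp (ccont_neq0 cf fz) => u h1 fu.
by rewrite mulrAC mulNr -h1; field; rewrite fz fu.
Qed.

Lemma cdiff_comp f g z : cdiff f z -> cdiff g (f z) -> cdiff (fun u => g (f u)) z.
Proof.
move=> df; have cf := cdiff_cont df; move: df => [p cp hp] [q cq hq].
exists (fun u => q (f u) * p u).
  by apply: ccontM => //; exact: (ccont_comp cf cq).
have hq' := ccont_near cf hq.
by apply: filterS2 hp hq' => u h1 ->; rewrite h1 mulrA.
Qed.

Lemma cdiff_poly (p : {poly R[i]}) z : cdiff (fun u => p.[u]) z.
Proof.
elim/poly_ind: p => [|p c ih].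
  by apply: cdiff_eqnear (cdiff_cst 0 z); apply: filterE => u; rewrite horner0.
apply: (@cdiff_eqnear (fun u => p.[u] * u + c)).
  by apply: filterE => u; rewrite hornerMXaddC.
by apply: cdiffD (cdiff_cst _ _); apply: cdiffM ih (cdiff_id _).
Qed.

End Continuity.

(** * Holomorphic self-maps of the sphere and rational functions *)

Section Holomorphy.
Context {R : realType}.
Implicit Types (h : R[i] -> Cbar R) (z w : R[i]).

Lemma holo_finP h z : holo_fin h z <->
  exists2 f, cdiff f z & \forall u \near (z : R[i]^o), h u = Some (f u).
Proof.
split=> [[h1 h2]|[f df hf]].
  exists (fun u => odflt 0 (h u)); first exact: derivable_cdiff.
  by apply: filterS h1 => u; case: (h u).
split; first by apply: filterS hf => u ->.
apply: cdiff_derivable; apply: cdiff_eqnear df.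
by apply: filterS hf => u ->.
Qed.

(** The source chart that [holo_at] builds inside its body, named so that it can be rewritten and
    composed. *)
Definition chart (f : Cbar R -> Cbar R) (p : Cbar R) : R[i] -> Cbar R :=
  match p with
  | Some _ => fun u => f (Some u)
  | None => fun u => f (cbar_inv (Some u))
  end.

Lemma holo_atE (f : Cbar R -> Cbar R) p : holo_at f p <->
  holo_fin (chart f p) (odflt 0 p) \/
  holo_fin (fun u => cbar_inv (chart f p u)) (odflt 0 p).
Proof. by case: p. Qed.

Lemma near_refl z (P : R[i] -> Prop) : (\forall u \near (z : R[i]^o), P u) -> P z.
Proof. by move=> /near_cabs[d d0 h]; apply: h; rewrite subrr cabs0. Qed.

Lemma chart_pt (f : Cbar R -> Cbar R) p : chart f p (odflt 0 p) = f p.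
Proof. by case: p => [z|] //=; rewrite eqxx. Qed.

Lemma nb_chart (p : Cbar R) (P : Cbar R -> Prop) :
  nb p P <-> \forall u \near ((odflt 0 p) : R[i]^o),
    P (if p is Some _ then Some u else cbar_inv (Some u)).
Proof.
case: p => [z|] /=; first by split=> [/nb_fin|] h; [apply/near_cabs | apply/nb_fin; apply/near_cabs].
rewrite nb_inv /=; split=> [/nb_fin|] h; [apply/near_cabs | apply/nb_fin; apply/near_cabs]; exact: h.
Qed.

Lemma holo_fin_nb h z (P : Cbar R -> Prop) : holo_fin h z -> nb (h z) P ->
  \forall u \near (z : R[i]^o), P (h u).
Proof.
move=> /holo_finP[f /cdiff_cont cf hf]; rewrite (near_refl hf) => /nb_fin hP.
have : \forall v \near (f z : R[i]^o), P (Some v) by apply/near_cabs.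
by move=> /(ccont_near cf); apply: filterS2 hf => u ->.
Qed.

Lemma holo_scont (f : Cbar R -> Cbar R) p : holo_at f p -> scont f p.
Proof.
move=> /holo_atE hf P hP; apply/nb_chart.
suff : \forall u \near (odflt 0 p : R[i]^o), P (chart f p u) by case: p {hf hP}.
case: hf => [hf|hf]; first by apply: (holo_fin_nb hf); rewrite chart_pt.
have := @holo_fin_nb _ _ (fun q => P (cbar_inv q)) hf.
rewrite chart_pt -nb_inv => /(_ hP); by apply: filterS => u; rewrite cbar_invK.
Qed.

Lemma holo_fin_inv h z : holo_fin h z -> h z != Some 0 -> holo_fin (fun u => cbar_inv (h u)) z.
Proof.
move=> /holo_finP[f df hf]; rewrite (near_refl hf) => fz.
have {}fz : f z != 0 by apply: contra fz => /eqP->.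
apply/holo_finP; exists (fun u => (f u)^-1); first exact: cdiffV.
by apply: filterS2 hf (ccont_neq0 (cdiff_cont df) fz) => u -> /negPf /= ->.
Qed.

(** [holo_at] grants one of two target charts without telling which. Inversion in the target passes
    from one to the other wherever the value is not the point that the new chart misses. *)
Lemma holo_at_chart (f : Cbar R -> Cbar R) p : holo_at f p ->
  (f p != None -> holo_fin (chart f p) (odflt 0 p)) /\
  (f p != Some 0 -> holo_fin (fun u => cbar_inv (chart f p u)) (odflt 0 p)).
Proof.
move=> hh; have {hh} [hf|hf] := proj1 (holo_atE f p) hh; split=> h0.
- exact: hf.
- by apply: holo_fin_inv hf _; rewrite chart_pt.
- have h2 := holo_fin_inv hf; rewrite chart_pt in h2.
  have {}h2 : holo_fin (fun u => cbar_inv (cbar_inv (chart f p u))) (odflt 0 p).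
    by apply: h2; apply: contra h0 => /eqP h; rewrite -[f p]cbar_invK h /= eqxx.
  have e : (fun u => cbar_inv (cbar_inv (chart f p u))) = chart f p.
    by apply/funext => u; rewrite cbar_invK.
  by rewrite e in h2.
- exact: hf.
Qed.

Lemma holo_at_cdiff (f : Cbar R -> Cbar R) z : holo_at f (Some z) -> f (Some z) <> None ->
  cdiff (fun u => odflt 0 (f (Some u))) z.
Proof.
move=> /holo_at_chart[/= h _] /eqP /h /holo_finP[g dg hg].
by apply: cdiff_eqnear dg; apply: filterS hg => u ->.
Qed.

(* Composition in the charts prescribed by the value [h z]. *)
Lemma holo_fin_comp (f : Cbar R -> Cbar R) h z :
  (if h z is Some _ then holo_fin h z else holo_fin (fun u => cbar_inv (h u)) z) ->
  holo_at f (h z) ->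
  holo_fin (fun u => f (h u)) z \/ holo_fin (fun u => cbar_inv (f (h u))) z.
Proof.
move=> hh /holo_atE hf.
have [k dk hk] : exists2 k, cdiff k z & k z = odflt 0 (h z) /\
    \forall u \near (z : R[i]^o), f (h u) = chart f (h z) (k u).
  case hz : (h z) hh => [w|] /holo_finP[k dk hk].
    exists k => //; split; first by have := near_refl hk; rewrite hz => -[].
    by apply: filterS hk => u ->.
  exists k => //; split; first by have := near_refl hk; rewrite hz => -[].
  by apply: filterS hk => u e; rewrite -[h u]cbar_invK e.
case: hk => kz hk.
rewrite -kz in hf.
have key (F : Cbar R -> Cbar R) : holo_fin (fun u => F (chart f (h z) u)) (k z) ->
    holo_fin (fun u => F (f (h u))) z.
  move=> /holo_finP[g dg hg]; apply/holo_finP; exists (fun u => g (k u)).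
    exact: cdiff_comp dk dg.
  by apply: filterS2 hk (ccont_near (cdiff_cont dk) hg) => u ->.
by case: hf => [/(key id)|/(key (@cbar_inv R))] hf; [left | right].
Qed.

Definition quot (x y : R[i]) : Cbar R := if y == 0 then None else Some (x / y).

Lemma holo_fin_quot (f g : R[i] -> R[i]) z : cdiff f z -> cdiff g z -> (f z != 0) || (g z != 0) ->
  holo_fin (fun u => quot (f u) (g u)) z \/
  holo_fin (fun u => cbar_inv (quot (f u) (g u))) z.
Proof.
move=> df dg; case: (eqVneq (g z) 0) => [gz|gz _]; last first.
  left; apply/holo_finP; exists (fun u => f u / g u).
    by apply: cdiffM => //; exact: cdiffV.
  by apply: filterS (ccont_neq0 (cdiff_cont dg) gz) => u /negPf h; rewrite /quot h.
rewrite orbF => fz; right; apply/holo_finP; exists (fun u => g u / f u).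
  by apply: cdiffM => //; exact: cdiffV.
apply: filterS (ccont_neq0 (cdiff_cont df) fz) => u hu; rewrite /quot.
case: eqVneq => [->|gu] /=; first by rewrite mul0r.
by rewrite mulf_eq0 invr_eq0 (negPf hu) (negPf gu) /= invf_div.
Qed.

(** This is u^n p (1 / u). It serves for numerator and denominator of a rational function in the
    chart at infinity, with the larger degree as the common [n]. *)
Definition revp n (p : {poly R[i]}) : {poly R[i]} := \poly_(i < n.+1) p`_(n - i).

Lemma horner_revp n (p : {poly R[i]}) u : (size p <= n.+1)%N -> u != 0 ->
  (revp n p).[u] = u ^+ n * p.[u^-1].
Proof.
move=> sp u0; rewrite horner_poly (horner_coef_wide _ sp) mulr_sumr.
rewrite (reindex_inj rev_ord_inj) /=; apply: eq_bigr => i _.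
have hi : (i <= n)%N by rewrite -ltnS.
rewrite subSS subKn // mulrCA; congr (_ * _).
by rewrite exprVn -expfB_cond ?(negPf u0).
Qed.

Lemma horner_revp0 n (p : {poly R[i]}) : (revp n p).[0] = p`_n.
Proof. by rewrite horner_coef0 coef_poly subn0. Qed.

Lemma ratC_quot (p q : {poly R[i]}) u : ratC p q (Some u) = quot p.[u] q.[u].
Proof. by []. Qed.

Lemma ratC_inf (p q : {poly R[i]}) n : (maxn (size p) (size q) = n.+1)%N ->
  ratC p q None = quot p`_n q`_n /\ (p`_n != 0) || (q`_n != 0).
Proof.
have lc (r : {poly R[i]}) : size r = n.+1 -> r`_n = lead_coef r.
  by move=> h; rewrite lead_coefE h.
have lc0 (r : {poly R[i]}) : size r = n.+1 -> lead_coef r == 0 = false.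
  by move=> h; apply/negbTE; rewrite lead_coef_eq0 -size_poly_gt0 h.
rewrite /ratC /quot; case: (ltngtP (size q) (size p)) => h hn.
- have hq : q`_n = 0 by rewrite nth_default // -ltnS -hn.
  by rewrite hq eqxx lc // lc0.
- have hp : p`_n = 0 by rewrite nth_default // -ltnS -hn.
  by rewrite hp [q`_n]lc // lc0 // mul0r orbT.
- have hp : size p = n.+1 by rewrite -h.
  by rewrite (lc _ hn) (lc _ hp) (lc0 _ hn) orbT.
Qed.

Lemma ratC_chart_inf (p q : {poly R[i]}) n u : (maxn (size p) (size q) = n.+1)%N ->
  ratC p q (cbar_inv (Some u)) = quot (revp n p).[u] (revp n q).[u].
Proof.
move=> hn; rewrite /=; case: (eqVneq u 0) => [->|u0].
  by rewrite (ratC_inf hn).1 !horner_revp0.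
rewrite ratC_quot /quot !horner_revp -?hn ?leq_maxl ?leq_maxr //.
rewrite mulf_eq0 expf_eq0 (negPf u0) andbF /=; case: eqP => // _.
by rewrite -mulf_div divff ?mul1r // expf_neq0.
Qed.

Lemma coprimep_neq0 (p q : {poly R[i]}) u : coprimep p q ->
  (p.[u] != 0) || (q.[u] != 0).
Proof.
move=> cpq; case: (eqVneq p.[u] 0) => //= pu.
by apply: coprimep_root cpq _; rewrite /root pu.
Qed.

Lemma ratC_holo (p q : {poly R[i]}) (z : Cbar R) : coprimep p q -> holo_at (ratC p q) z.
Proof.
move=> cpq; apply/holo_atE; case: z => [u|] /=.
  apply: (holo_fin_quot (cdiff_poly p u) (cdiff_poly q u)).
  exact: coprimep_neq0.
case hn : (maxn (size p) (size q)) => [|n].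
  have := coprimep_neq0 0 cpq; move/eqP: hn; rewrite -leqn0 geq_max !leqn0 !size_poly_eq0.
  by move=> /andP[/eqP-> /eqP->]; rewrite !horner0 eqxx.
have e u : ratC p q (if u == 0 then None else Some u^-1) = quot (revp n p).[u] (revp n q).[u].
  by rewrite -(ratC_chart_inf _ hn).
have -> := funext e.
have -> : (fun u => cbar_inv (ratC p q (if u == 0 then None else Some u^-1))) =
          (fun u => cbar_inv (quot (revp n p).[u] (revp n q).[u])).
  by apply/funext => u; rewrite e.
apply: (holo_fin_quot (cdiff_poly (revp n p) 0) (cdiff_poly (revp n q) 0)).
by rewrite !horner_revp0 (ratC_inf hn).2.
Qed.

End Holomorphy.

(** * Cauchy's theorem and Liouville's theorem *)

Section Primitives.
Context {R : realType}.
Implicit Types (f F G : R -> R) (a b c x : R).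

Lemma mvt_seg F f a b : a <= b -> (forall x, a <= x <= b -> is_derive x 1 F (f x)) ->
  exists2 c, a <= c <= b & F b - F a = f c * (b - a).
Proof.
move=> ab dF.
have dF' x : x \in `]a, b[ -> is_derive x 1 F (f x).
  by rewrite in_itv /= => /andP[/ltW h1 /ltW h2]; apply: dF; rewrite h1.
have [|c hc ->] := MVT_segment ab dF'; last by exists c => //; move: hc; rewrite in_itv.
apply: derivable_within_continuous => x; rewrite in_itv /= => h.
by have [] := dF x h.
Qed.

Lemma primitive_eq F G f a b : a <= b ->
  (forall x, a <= x <= b -> is_derive x 1 F (f x)) ->
  (forall x, a <= x <= b -> is_derive x 1 G (f x)) -> F b - F a = G b - G a.
Proof.
move=> ab dF dG.
have [|c _] := @mvt_seg (F - G) (fun=> 0) a b ab.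
  by move=> x h; have h1 := dF x h; have h2 := dG x h; apply: is_derive_eq; exact: subrr.
by rewrite mul0r => h; have {}h : (F b - G b) - (F a - G a) = 0 := h; lra.
Qed.

Lemma primitive_exists f : continuous f -> exists F, forall x, is_derive x 1 F (f x).
Proof.
move=> cf.
pose K M x := (\int[@lebesgue_measure R]_(t in `[(- M)%R, x]) f t)%R.
have dK (M x : R) : - M < x < M -> is_derive x 1 (K M) (f x).
  move=> /andP[h1 h2].
  have fi : (@lebesgue_measure R).-integrable `[- M, M] (EFin \o f).
    apply: continuous_compact_integrable; first exact: segment_compact.
    exact: continuous_subspaceT.
  have [d1 d2] := @continuous_FTC1_closed R f (- M) x M h2 fi h1 (cf x).
  by apply: DeriveDef; [exact: d1 | rewrite -derive1E; exact: d2].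
have Kcst (M M' x : R) : `|x| < M -> M <= M' -> K M x - K M 0 = K M' x - K M' 0.
  move=> xM MM'.
  have h y : `|y| <= `|x| -> - M < y < M /\ - M' < y < M'.
    move=> hy; have hy' := le_lt_trans hy xM.
    by rewrite -!ltr_norml hy' (lt_le_trans hy').
  case: (leP 0 x) => x0.
    apply: (@primitive_eq _ _ f 0 x x0) => y /andP[y0 yx]; apply: dK;
      by have [] := h y; rewrite ?ger0_norm.
  apply: oppr_inj; rewrite !opprB; apply: (@primitive_eq _ _ f x 0 (ltW x0)) => y /andP[xy y0];
    apply: dK; by have [] := h y; rewrite // !ler0_norm ?(ltW x0) // lerN2.
(* An integral from [- M] is a primitive only on []- M, M[]. Normalized to vanish at 0 it no longer
   depends on [M], so [M] may vary with the point. *)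
exists (fun x => K (`|x| + 1) x - K (`|x| + 1) 0) => x.
have hx : - (`|x| + 2) < x < `|x| + 2 by rewrite -ltr_norml ltrDl.
have d1 := dK _ _ hx.
have : is_derive x 1 (fun y => K (`|x| + 2) y - K (`|x| + 2) 0) (f x).
  by apply: is_derive_eq; rewrite subr0.
apply: near_eq_is_derive.
apply/nbhs_ballP; exists 1 => [|y]; first exact: ltr01.
rewrite /ball /= => hy.
apply/esym/Kcst; first by rewrite ltrDl.
have := ler_normB x (x - y); rewrite opprB addrC subrK => h; lra.
Qed.

Lemma continuous_eps f :
  (forall x (e : R), 0 < e -> exists2 d : R, 0 < d & forall y, `|y - x| < d -> `|f y - f x| < e) ->
  continuous f.
Proof.
move=> h x; apply/cvgrPdist_lt => e e0; have [d d0 hd] := h x e e0.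
apply/nbhs_ballP; exists d => // y; rewrite /ball /= distrC => /hd.
by rewrite distrC.
Qed.

End Primitives.

(** * Integrals of complex functions of a real variable *)

Section ComplexIntegral.
Context {R : realType}.
Implicit Types (f g F G : R -> R[i]) (h : R[i] -> R[i]) (a b c x : R).

Definition rcont (f : R -> R[i]) := continuous (@complex.Re R \o f) /\ continuous (@complex.Im R \o f).

Definition cprim (F f : R -> R[i]) :=
  (forall x, is_derive x 1 (@complex.Re R \o F) (Re (f x))) /\
  (forall x, is_derive x 1 (@complex.Im R \o F) (Im (f x))).

Lemma cprim_exists (f : R -> R[i]) : rcont f -> exists F, cprim F f.
Proof.
move=> [/primitive_exists[F hF] /primitive_exists[G hG]].
exists (fun x => Complex (F x) (G x)); split=> x.
- have -> : @complex.Re R \o (fun x => Complex (F x) (G x)) = F by apply/funext.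
  exact: hF.
- have -> : @complex.Im R \o (fun x => Complex (F x) (G x)) = G by apply/funext.
  exact: hG.
Qed.

Lemma cprimD (F f G g : R -> R[i]) : cprim F f -> cprim G g ->
  cprim (fun x => F x + G x) (fun x => f x + g x).
Proof.
have eR : @complex.Re R \o (fun x => F x + G x) = (@complex.Re R \o F) + (@complex.Re R \o G).
  by apply/funext => x; rewrite /= cReD.
have eI : @complex.Im R \o (fun x => F x + G x) = (@complex.Im R \o F) + (@complex.Im R \o G).
  by apply/funext => x; rewrite /= cImD.
move=> [hF1 hF2] [hG1 hG2]; split=> x; rewrite ?eR ?eI ?cReD ?cImD.
- exact: (is_deriveD (hF1 x) (hG1 x)).
- exact: (is_deriveD (hF2 x) (hG2 x)).
Qed.

Lemma cprimZ (k : R[i]) F f : cprim F f -> cprim (fun x => k * F x) (fun x => k * f x).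
Proof.
have eR : @complex.Re R \o (fun x => k * F x) =
    Re k \*: (@complex.Re R \o F) - Im k \*: (@complex.Im R \o F).
  by apply/funext => x; rewrite /= cReM.
have eI : @complex.Im R \o (fun x => k * F x) =
    Re k \*: (@complex.Im R \o F) + Im k \*: (@complex.Re R \o F).
  by apply/funext => x; rewrite /= cImM.
move=> [hF1 hF2]; split=> x; rewrite ?eR ?eI ?cReM ?cImM.
- exact: (is_deriveB (is_deriveZ (Re k) (hF1 x)) (is_deriveZ (Im k) (hF2 x))).
- exact: (is_deriveD (is_deriveZ (Re k) (hF2 x)) (is_deriveZ (Im k) (hF1 x))).
Qed.

Lemma cprim_affine (p q : R[i]) :
  cprim (fun x => p * x%:C + q * (x ^+ 2 / 2)%:C) (fun x => p + q * x%:C).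
Proof.
have eR : @complex.Re R \o (fun x => p * x%:C + q * (x ^+ 2 / 2)%:C) =
    (fun x : R => Re p * x + Re q / 2 * (x * x)).
  by apply/funext => x; rewrite /= ?cReD ?cImD ?cReM ?cImM /=; field.
have eI : @complex.Im R \o (fun x => p * x%:C + q * (x ^+ 2 / 2)%:C) =
    (fun x : R => Im p * x + Im q / 2 * (x * x)).
  by apply/funext => x; rewrite /= ?cReD ?cImD ?cReM ?cImM /=; field.
have key (s t x : R) : is_derive x 1 (fun x : R => s * x + t / 2 * (x * x)) (s + t * x).
  have -> : (fun x : R => s * x + t / 2 * (x * x)) =
     (fun x : R => s *: (id : R -> R) x) + (fun x : R => (t / 2) *: (id * id : R -> R) x).
    by apply/funext.
  have d1 := is_derive_id x (1 : R).
  apply: (is_derive_eq (is_deriveD (is_deriveZ s d1) (is_deriveZ (t / 2) (is_deriveM d1 d1)))).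
  by rewrite /GRing.scale /=; field.
split=> x; rewrite ?eR ?eI ?cReD ?cImD ?cReM ?cImM /= ?mulr0 ?subr0 ?add0r; exact: key.
Qed.

(** The integral is the increment of a chosen primitive. Additivity over intervals ([cint_cat]) is
    then formal, for any function and any order of the endpoints. *)
Definition cint (f : R -> R[i]) a b : R[i] :=
  let F := xget (fun=> 0) (fun F => cprim F f) in F b - F a.

Lemma cintE F f a b : cprim F f -> cint f a b = F b - F a.
Proof.
move=> hF; rewrite /cint; set G := xget _ _.
have hG : cprim G f by apply: (@xgetPex _ (fun=> 0) (fun F => cprim F f)); exists F.
have key (A B g : R -> R) : (forall x, is_derive x 1 A (g x)) ->
    (forall x, is_derive x 1 B (g x)) -> A b - A a = B b - B a.
  move=> hA hB; case: (leP a b) => [ab|/ltW ba].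
    exact: (primitive_eq ab (fun x _ => hA x) (fun x _ => hB x)).
  by apply: oppr_inj; rewrite !opprB (primitive_eq ba (fun x _ => hA x) (fun x _ => hB x)).
have e1 := key _ _ _ hG.1 hF.1; have e2 := key _ _ _ hG.2 hF.2.
move: e1 e2 => /=; case: (G b) (G a) (F b) (F a) => ? ? [? ?] [? ?] [? ?] /= e1 e2.
by apply/eqP; rewrite eq_complex /= e1 e2 !eqxx.
Qed.

Lemma cint_cat f a b c : cint f a b + cint f b c = cint f a c.
Proof. by rewrite /cint /=; ring. Qed.

Lemma cintD f g a b : rcont f -> rcont g ->
  cint (fun x => f x + g x) a b = cint f a b + cint g a b.
Proof.
move=> /cprim_exists[F hF] /cprim_exists[G hG].
by rewrite (cintE _ _ hF) (cintE _ _ hG) (cintE _ _ (cprimD hF hG)); ring.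
Qed.

Lemma cintZ k f a b : rcont f -> cint (fun x => k * f x) a b = k * cint f a b.
Proof. by move=> /cprim_exists[F hF]; rewrite (cintE _ _ hF) (cintE _ _ (cprimZ k hF)); ring. Qed.

Lemma cint_affine (p q : R[i]) a b :
  cint (fun x => p + q * x%:C) a b = p * (b - a)%:C + q * ((b ^+ 2 - a ^+ 2) / 2)%:C.
Proof.
rewrite (cintE _ _ (cprim_affine p q)); case: p q => ? ? [? ?]; simpc.
by congr (_ +i* _); field.
Qed.

(** The mean value theorem is applied to the real and imaginary parts separately, at different
    points; this costs the factor 2. *)
Lemma cint_le f a b (M : R) : rcont f -> a <= b ->
  (forall x, a <= x <= b -> cabs (f x) <= M) -> cabs (cint f a b) <= 2 * M * (b - a).
Proof.
move=> /cprim_exists[F hF] ab hM; rewrite (cintE _ _ hF).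
have ba : 0 <= b - a by rewrite subr_ge0.
have [c1 hc1 e1] := mvt_seg ab (fun x _ => hF.1 x).
have [c2 hc2 e2] := mvt_seg ab (fun x _ => hF.2 x).
apply: le_trans (cabs_le_ReIm _) _.
have -> : Re (F b - F a) = Re (f c1) * (b - a) by rewrite -e1 /=; case: (F b) (F a) => ? ? [].
have -> : Im (F b - F a) = Im (f c2) * (b - a) by rewrite -e2 /=; case: (F b) (F a) => ? ? [].
have h1 := le_trans (Re_le_cabs _) (hM _ hc1); have h2 := le_trans (Im_le_cabs _) (hM _ hc2).
by rewrite !normrM (ger0_norm ba) -mulrDl ler_wpM2r //; lra.
Qed.

Lemma cint_Im_ge f a b (m : R) : rcont f -> a <= b ->
  (forall x, a <= x <= b -> m <= Im (f x)) -> m * (b - a) <= Im (cint f a b).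
Proof.
move=> /cprim_exists[F hF] ab hM; rewrite (cintE _ _ hF).
have [c hc e] := mvt_seg ab (fun x _ => hF.2 x).
have -> : Im (F b - F a) = Im (f c) * (b - a) by rewrite -e /=; case: (F b) (F a) => ? ? [].
by rewrite ler_wpM2r ?subr_ge0 // hM.
Qed.

Lemma cint_ext f g a b : f =1 g -> cint f a b = cint g a b.
Proof. by move=> /funext->. Qed.

Lemma rcont_line h (p q : R[i]) : cabs q <= 1 ->
  (forall t : R, ccont h (p + q * t%:C)) -> rcont (fun t => h (p + q * t%:C)).
Proof.
move=> q1 ch; split; apply: continuous_eps => x e e0;
  have [d d0 hd] := proj1 (ccontP _ _) (ch x) e e0; exists d => // y hy;
  (have /hd hc : cabs (p + q * y%:C - (p + q * x%:C)) < d;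
  first by rewrite opprD addrACA subrr add0r -mulrBr -rmorphB cabsM cabsR;
    apply: le_lt_trans hy; rewrite ler_piMl);
  apply: le_lt_trans hc; rewrite /=.
- by rewrite -cReN -cReD; exact: Re_le_cabs.
- by rewrite -cImN -cImD; exact: Im_le_cabs.
Qed.

End ComplexIntegral.

(** * Boundary integrals of rectangles, and bisection *)

Section Rectangles.
Context {R : realType}.
Implicit Types (h k : R[i] -> R[i]) (x y l : R).
Local Notation I := (Complex 0 1 : R[i]).

Definition rint h x1 x2 y1 y2 : R[i] :=
  cint (fun t => h (I * y1%:C + 1 * t%:C)) x1 x2
  - cint (fun t => h (I * y2%:C + 1 * t%:C)) x1 x2
  + I * (cint (fun t => h (x2%:C + I * t%:C)) y1 y2
         - cint (fun t => h (x1%:C + I * t%:C)) y1 y2).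

(** The full lines carrying the four sides: [cint] rests on a primitive on all of [R], so integrands
    are asked to be continuous along the whole line. *)
Definition on_lines x1 x2 y1 y2 (z : R[i]) :=
  [\/ Re z = x1, Re z = x2, Im z = y1 | Im z = y2].

Lemma horE y (t : R) : I * y%:C + 1 * t%:C = Complex t y.
Proof. by apply: complex_ext; rewrite ?(cReD, cImD, cReM, cImM) /=; ring. Qed.

Lemma verE x (t : R) : x%:C + I * t%:C = Complex x t.
Proof. by apply: complex_ext; rewrite ?(cReD, cImD, cReM, cImM) /=; ring. Qed.

Lemma rint_rcont h x1 x2 y1 y2 : (forall z, on_lines x1 x2 y1 y2 z -> ccont h z) ->
  [/\ rcont (fun t => h (I * y1%:C + 1 * t%:C)), rcont (fun t => h (I * y2%:C + 1 * t%:C)),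
      rcont (fun t => h (x2%:C + I * t%:C)) & rcont (fun t => h (x1%:C + I * t%:C))].
Proof.
have I1 : cabs I <= 1 by rewrite /cabs /= expr0n add0r expr1n sqrtr1.
have o1 : cabs (1 : R[i]) <= 1 by rewrite cabs1.
by move=> ch; split; apply: rcont_line => // t; apply: ch; rewrite ?horE ?verE;
  [apply: Or43 | apply: Or44 | apply: Or42 | apply: Or41].
Qed.

Lemma rintD h k x1 x2 y1 y2 : (forall z, on_lines x1 x2 y1 y2 z -> ccont h z) ->
  (forall z, on_lines x1 x2 y1 y2 z -> ccont k z) ->
  rint (fun z => h z + k z) x1 x2 y1 y2 = rint h x1 x2 y1 y2 + rint k x1 x2 y1 y2.
Proof.
move=> /rint_rcont[h1 h2 h3 h4] /rint_rcont[k1 k2 k3 k4].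
by rewrite /rint !cintD //; ring.
Qed.

Lemma rintZ c h x1 x2 y1 y2 : (forall z, on_lines x1 x2 y1 y2 z -> ccont h z) ->
  rint (fun z => c * h z) x1 x2 y1 y2 = c * rint h x1 x2 y1 y2.
Proof.
move=> /rint_rcont[h1 h2 h3 h4].
by rewrite /rint !cintZ //; ring.
Qed.

Lemma rint_ext h k x1 x2 y1 y2 : (forall z, on_lines x1 x2 y1 y2 z -> h z = k z) ->
  rint h x1 x2 y1 y2 = rint k x1 x2 y1 y2.
Proof.
by move=> e; rewrite /rint; congr (_ - _ + I * (_ - _)); apply: cint_ext => t; apply: e;
  rewrite ?horE ?verE; [apply: Or43 | apply: Or44 | apply: Or42 | apply: Or41].
Qed.

Lemma rint_affine (p q : R[i]) x1 x2 y1 y2 : rint (fun z => p + q * z) x1 x2 y1 y2 = 0.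
Proof.
have e1 y : cint (fun t => p + q * (I * y%:C + 1 * t%:C)) x1 x2 =
    cint (fun t => (p + q * (I * y%:C)) + q * t%:C) x1 x2.
  by apply: cint_ext => t; ring.
have e2 x : cint (fun t => p + q * (x%:C + I * t%:C)) y1 y2 =
    cint (fun t => (p + q * x%:C) + (q * I) * t%:C) y1 y2.
  by apply: cint_ext => t; ring.
rewrite /rint !e1 !e2 !cint_affine.
by rewrite !rmorphB /=; ring.
Qed.

Lemma rint_catx h x1 x2 x3 y1 y2 :
  rint h x1 x2 y1 y2 + rint h x2 x3 y1 y2 = rint h x1 x3 y1 y2.
Proof. by rewrite /rint -!(@cint_cat _ _ x1 x2 x3); ring. Qed.

Lemma rint_caty h x1 x2 y1 y2 y3 :
  rint h x1 x2 y1 y2 + rint h x1 x2 y2 y3 = rint h x1 x2 y1 y3.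
Proof. by rewrite /rint -!(@cint_cat _ _ y1 y2 y3); ring. Qed.

Lemma rint_le h x1 x2 y1 y2 (M : R) : x1 <= x2 -> y1 <= y2 ->
  (forall z, on_lines x1 x2 y1 y2 z -> ccont h z) ->
  (forall z, on_lines x1 x2 y1 y2 z -> x1 <= Re z <= x2 -> y1 <= Im z <= y2 ->
     cabs (h z) <= M) ->
  cabs (rint h x1 x2 y1 y2) <= 4 * M * ((x2 - x1) + (y2 - y1)).
Proof.
move=> x12 y12 /rint_rcont[h1 h2 h3 h4] hM.
have I1 : cabs I = 1 by rewrite /cabs /= expr0n add0r expr1n sqrtr1.
have b1 : cabs (cint (fun t => h (I * y1%:C + 1 * t%:C)) x1 x2) <= 2 * M * (x2 - x1).
  by apply: cint_le => // t ht; apply: hM; rewrite horE /= ?lexx //; apply: Or43.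
have b2 : cabs (cint (fun t => h (I * y2%:C + 1 * t%:C)) x1 x2) <= 2 * M * (x2 - x1).
  by apply: cint_le => // t ht; apply: hM; rewrite horE /= ?lexx ?y12 //; apply: Or44.
have b3 : cabs (cint (fun t => h (x2%:C + I * t%:C)) y1 y2) <= 2 * M * (y2 - y1).
  by apply: cint_le => // t ht; apply: hM; rewrite verE /= ?lexx ?x12 //; apply: Or42.
have b4 : cabs (cint (fun t => h (x1%:C + I * t%:C)) y1 y2) <= 2 * M * (y2 - y1).
  by apply: cint_le => // t ht; apply: hM; rewrite verE /= ?lexx ?x12 //; apply: Or41.
rewrite /rint; apply: le_trans (cabsD _ _) _; rewrite cabsM I1 mul1r.
apply: le_trans (lerD (cabsB _ _) (cabsB _ _)) _.
have := lerD (lerD b1 b2) (lerD b3 b4); lra.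
Qed.

(* Bisection: [bad x y l] speaks about the rectangle with lower left corner
   (x, y) and sides l * w, l * ht. *)
Lemma bisection (w ht x0 y0 : R) (bad : R -> R -> R -> Prop) : 0 <= w -> 0 <= ht ->
  bad x0 y0 1 ->
  (forall x y l, 0 < l -> bad x y l -> exists s t : bool,
     bad (x + s%:R * (l / 2 * w)) (y + t%:R * (l / 2 * ht)) (l / 2)) ->
  exists xs ys, [/\ x0 <= xs <= x0 + w, y0 <= ys <= y0 + ht &
    forall e : R, 0 < e -> exists x y l, [/\ 0 < l < e, bad x y l,
      x <= xs <= x + l * w & y <= ys <= y + l * ht]].
Proof.
move=> w0 ht0 b0 step.
pose T := (R * R * R)%type.
have [nxt hn] : {nxt : T -> T & forall p, 0 < p.2 -> bad p.1.1 p.1.2 p.2 ->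
   exists s t : bool, nxt p = (p.1.1 + s%:R * (p.2 / 2 * w), p.1.2 + t%:R * (p.2 / 2 * ht), p.2 / 2)
     /\ bad (nxt p).1.1 (nxt p).1.2 (nxt p).2}.
  apply: (@choice _ _ (fun p q => 0 < p.2 -> bad p.1.1 p.1.2 p.2 -> exists s t : bool,
    q = (p.1.1 + s%:R * (p.2 / 2 * w), p.1.2 + t%:R * (p.2 / 2 * ht), p.2 / 2)
    /\ bad q.1.1 q.1.2 q.2)) => -[[x y] l].
  case: (pselect (0 < l /\ bad x y l)) => [[l0 hb]|hN]; last by exists (x, y, l) => /= h1 h2; case: hN.
  have [s [t h]] := step _ _ _ l0 hb.
  by exists (x + s%:R * (l / 2 * w), y + t%:R * (l / 2 * ht), l / 2) => /= _ _; exists s, t.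
pose p n := iter n nxt (x0, y0, 1).
have pl n : (p n).2 = 2^-1 ^+ n /\ bad (p n).1.1 (p n).1.2 (p n).2.
  elim: n => [|n [ih1 ih2]]; first by rewrite expr0.
  have l0 : 0 < (p n).2 by rewrite ih1 exprn_gt0 // invr_gt0.
  have [s [t [e hb]]] := hn _ l0 ih2.
  by rewrite /p iterS -/(p n); split=> //; rewrite e /= ih1 exprSr.
have l0 n : 0 < (p n).2 by rewrite (pl n).1 exprn_gt0 // invr_gt0.
have stp n : exists s t : bool, p n.+1 = ((p n).1.1 + s%:R * ((p n).2 / 2 * w),
    (p n).1.2 + t%:R * ((p n).2 / 2 * ht), (p n).2 / 2).
  by have [s [t [e _]]] := hn _ (l0 n) (pl n).2; exists s, t.
(* In each coordinate the lower ends increase and the upper ends decrease, so the supremum of the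
   lower ends lies in all the intervals. *)
have nest (u : R) (f : T -> R) : 0 <= u ->
    (forall n, exists s : bool, f (p n.+1) = f (p n) + s%:R * ((p n).2 / 2 * u)) ->
    exists v, forall n, f (p n) <= v <= f (p n) + (p n).2 * u.
  move=> u0 fs.
  have l2 n : (p n.+1).2 = (p n).2 / 2 by have [s [t ->]] := stp n.
  have up n m : (n <= m)%N -> f (p n) <= f (p m).
    move=> /subnKC <-; elim: (m - n)%N => [|d ih]; first by rewrite addn0.
    apply: le_trans ih _; rewrite addnS; have [s ->] := fs (n + d)%N.
    by rewrite lerDl mulr_ge0 // mulr_ge0 // divr_ge0 // ltW.
  have dn n m : (n <= m)%N -> f (p m) + (p m).2 * u <= f (p n) + (p n).2 * u.
    move=> /subnKC <-; elim: (m - n)%N => [|d ih]; first by rewrite addn0.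
    apply: le_trans _ ih; rewrite addnS l2; have [s ->] := fs (n + d)%N.
    have h0 : 0 <= (p (n + d)%N).2 * u by rewrite mulr_ge0 // ltW.
    by case: s => /=; lra.
  have ud n m : f (p n) <= f (p m) + (p m).2 * u.
    case: (leqP n m) => [nm|/ltnW mn].
      by apply: le_trans (up _ _ nm) _; rewrite lerDl mulr_ge0 // ltW.
    by apply: le_trans _ (dn _ _ mn); rewrite lerDl mulr_ge0 // ltW.
  pose S := [set f (p n) | n in [set: nat]]%classic.
  have Sn : (S !=set0)%classic by exists (f (p 0%N)); exists 0%N.
  have Sb m : ubound S (f (p m) + (p m).2 * u) by move=> _ [n _ <-].
  have Sup : has_sup S by split=> //; exists (f (p 0%N) + (p 0%N).2 * u); exact: Sb.
  exists (sup S) => n; apply/andP; split.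
    by apply: sup_upper_bound => //; exists n.
  by apply: sup_le_ub => //; exact: Sb.
have [xs hx] := nest w (fun q => q.1.1) w0 (fun n => let: ex_intro s (ex_intro t e) := stp n in
  ex_intro _ s (f_equal (fun q : T => q.1.1) e)).
have [ys hy] := nest ht (fun q => q.1.2) ht0 (fun n => let: ex_intro s (ex_intro t e) := stp n in
  ex_intro _ t (f_equal (fun q : T => q.1.2) e)).
exists xs, ys; split.
- by have := hx 0%N; rewrite /= mul1r.
- by have := hy 0%N; rewrite /= mul1r.
move=> e e0; have [n hn'] : exists n, (2^-1 : R) ^+ n < e.
  have [n hn'] : exists n : nat, e^-1 < n%:R.
    by exists (Num.truncn e^-1).+1; rewrite truncnS_gt.
  exists n; rewrite exprVn invf_plt ?posrE ?exprn_gt0 //.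
  apply: lt_trans hn' _; rewrite -natrX ltr_nat; exact: ltn_expl.
by exists (p n).1.1, (p n).1.2, (p n).2; split; rewrite ?l0 ?(pl n).1 ?hn' -?(pl n).1 //; exact: (pl n).2.
Qed.

End Rectangles.

(** * Cauchy's theorem for rectangles, with exceptional horizontal lines *)

Section Cauchy.
Context {R : realType}.
Implicit Types (h k : R[i] -> R[i]) (x y l : R).
Local Notation I := (Complex 0 1 : R[i]).

(** Bisection yields shrinking rectangles on which the integral stays at least [m * l ^+ 2]. At
    their common point [h] is affine up to an error o(l), affine functions integrate to 0, and the
    error contributes o(l^2). *)
Lemma goursat h x1 x2 y1 y2 : x1 <= x2 -> y1 <= y2 -> (forall z, ccont h z) ->
  (forall z, x1 <= Re z <= x2 -> y1 <= Im z <= y2 -> cdiff h z) ->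
  rint h x1 x2 y1 y2 = 0.
Proof.
move=> x12 y12 ch dh; apply/eqP; rewrite -cabs_eq0 eq_le cabs_ge0 andbT leNgt; apply/negP => m0.
set m := cabs _ in m0.
pose w := x2 - x1; pose ht := y2 - y1.
have w0 : 0 <= w by rewrite subr_ge0.
have ht0 : 0 <= ht by rewrite subr_ge0.
pose bad x y l := m * l ^+ 2 <= cabs (rint h x (x + l * w) y (y + l * ht)).
have [|x y l l0 hb|xs [ys [hx hy hs]]] := @bisection _ w ht x1 y1 bad w0 ht0.
- by rewrite /bad expr1n mulr1 !mul1r /w /ht !subrKC.
- apply: contrapT => hN.
  have hN' (s t : bool) : cabs (rint h (x + s%:R * (l / 2 * w)) (x + s%:R * (l / 2 * w) + l / 2 * w)
      (y + t%:R * (l / 2 * ht)) (y + t%:R * (l / 2 * ht) + l / 2 * ht)) < m * (l / 2) ^+ 2.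
    by rewrite ltNge; apply/negP => hst; apply: hN; exists s, t.
  have h00 := hN' false false; have h01 := hN' false true.
  have h10 := hN' true false; have h11 := hN' true true.
  have e1 : x + l / 2 * w + l / 2 * w = x + l * w by field.
  have e2 : y + l / 2 * ht + l / 2 * ht = y + l * ht by field.
  rewrite /= ?mul0r ?mul1r ?addr0 ?e1 ?e2 in h00 h01 h10 h11.
  move: hb; rewrite /bad -(rint_catx _ _ (x + l / 2 * w)) 
    -(rint_caty h x (x + l / 2 * w) y (y + l / 2 * ht)) -(rint_caty h (x + l / 2 * w) (x + l * w) y (y + l / 2 * ht)).
  rewrite leNgt => /negP; apply; apply: le_lt_trans (cabsD _ _) _.
  apply: le_lt_trans (lerD (cabsD _ _) (cabsD _ _)) _.
  have -> : m * l ^+ 2 = m * (l / 2) ^+ 2 + m * (l / 2) ^+ 2 + (m * (l / 2) ^+ 2 + m * (l / 2) ^+ 2).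
    by field.
  by rewrite !ltrD.
have hz : cdiff h (Complex xs ys).
  by apply: dh; rewrite /= ?(subrKC, hx, hy) //; move: hx hy; rewrite /w /ht !subrKC.
case: hz; set zs := Complex xs ys => phi cphi hphi.
pose S := w + ht; have S0 : 0 <= S by rewrite addr_ge0.
(* The remainder will be bounded by [4 * e * S ^+ 2 * l ^+ 2]; this [e] makes that smaller than
   [m * l ^+ 2], even when [S] is 0. *)
pose e := m / (8 * S ^+ 2 + 1).
have den0 : 0 < 8 * S ^+ 2 + 1 by rewrite ltr_wpDl ?mulr_ge0 ?sqr_ge0.
have e0 : 0 < e by rewrite divr_gt0.
have [d1 d10 hd1] := proj1 (ccontP _ _) cphi e e0.
have [d2 d20 hd2] := proj1 (near_cabs _ _) hphi.
have d0 : 0 < Num.min d1 d2 / (S + 1) by rewrite divr_gt0 ?lt_min ?d10 ?ltr_wpDl.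
have [x [y [l [/andP[l0 ld] hb hxs hys]]]] := hs _ d0.
have xl : x <= x + l * w by rewrite lerDl mulr_ge0 // ltW.
have yl : y <= y + l * ht by rewrite lerDl mulr_ge0 // ltW.
pose A z := (h zs - phi zs * zs) + phi zs * z.
have cA z : ccont A z.
  exact: ccontD (ccont_cst _ z) (ccontM (ccont_cst _ z) (ccont_id z)).
pose r z := h z - A z.
have cr z : ccont r z by exact: ccontB (ch z) (cA z).
have eh : rint h x (x + l * w) y (y + l * ht) = rint r x (x + l * w) y (y + l * ht).
  rewrite -[RHS]add0r -(rint_affine (h zs - phi zs * zs) (phi zs) x (x + l * w) y (y + l * ht)) -rintD //.
  by apply: rint_ext => z _; rewrite /r /A; ring.
have : cabs (rint r x (x + l * w) y (y + l * ht)) <=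
    4 * (e * (l * S)) * ((x + l * w - x) + (y + l * ht - y)).
  apply: rint_le => // z _ hz1 hz2.
  have hzz : cabs (z - zs) <= l * S.
    apply: le_trans (cabs_le_ReIm _) _; rewrite /S mulrDr !cReD !cImD !cReN !cImN.
    by apply: lerD; rewrite ler_norml /zs /=; lra.
  have hmin : l * S < Num.min d1 d2.
    rewrite ltr_pdivlMr ?ltr_wpDl // in ld; apply: le_lt_trans ld.
    by rewrite ler_pM2l // lerDl.
  have [hm1 hm2] : cabs (z - zs) < d1 /\ cabs (z - zs) < d2.
    by move: (le_lt_trans hzz hmin); rewrite lt_min => /andP[].
  have -> : r z = (phi z - phi zs) * (z - zs).
    by rewrite /r /A mulrBl -hd2 //; ring.
  by rewrite cabsM ler_pM ?cabs_ge0 // ltW // hd1.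
rewrite -eh => /(le_trans hb); apply/negP; rewrite -ltNge.
have -> : 4 * (e * (l * S)) * (x + l * w - x + (y + l * ht - y)) = 4 * e * S ^+ 2 * l ^+ 2.
  by rewrite /S; ring.
rewrite ltr_pM2r ?exprn_gt0 // /e.
have -> : 4 * (m / (8 * S ^+ 2 + 1)) * S ^+ 2 = m * (4 * S ^+ 2) / (8 * S ^+ 2 + 1).
  by field; rewrite gt_eqF.
rewrite ltr_pdivrMr // ltr_pM2l //; have := sqr_ge0 S; lra.
Qed.

(** Uniform continuity across a compact horizontal segment, by bisection with rectangles of height
    0. *)
Lemma vertical_uniform h x1 x2 y (e : R) : x1 <= x2 -> (forall z, ccont h z) -> 0 < e ->
  exists2 d : R, 0 < d & forall x t, x1 <= x <= x2 -> `|t| < d ->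
    cabs (h (Complex x (y + t)) - h (Complex x y)) < e.
Proof.
move=> x12 ch e0; apply: contrapT => hN.
pose w := x2 - x1; have w0 : 0 <= w by rewrite subr_ge0.
pose bad (X Y l : R) := forall d : R, 0 < d -> exists x t,
  [/\ X <= x <= X + l * w, `|t| < d & e <= cabs (h (Complex x (y + t)) - h (Complex x y))].
have [|X Y l l0 hb|xs [ys [hx hy hs]]] := @bisection _ w 0 x1 0 bad w0 (lexx _).
- move=> d d0; apply: contrapT => hN'; apply: hN; exists d => // x t hx ht.
  rewrite ltNge; apply/negP => he; apply: hN'; exists x, t; split=> //.
  by rewrite mul1r /w subrKC.
- apply: contrapT => hN'.
  have hs (s : bool) : exists2 d : R, 0 < d & forall x t,
      X + s%:R * (l / 2 * w) <= x <= X + s%:R * (l / 2 * w) + l / 2 * w -> `|t| < d ->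
      cabs (h (Complex x (y + t)) - h (Complex x y)) < e.
    apply: contrapT => hs; apply: hN'; exists s, false => d d0.
    apply: contrapT => hN'; apply: hs; exists d => // x t hx ht.
    by rewrite ltNge; apply/negP => he; apply: hN'; exists x, t.
  have [d1 d10 hd1] := hs false; have [d2 d20 hd2] := hs true.
  have [|x [t [hx ht]]] := hb (Num.min d1 d2); first by rewrite lt_min d10.
  move: ht; rewrite lt_min leNgt => /andP[t1 t2] /negP[].
  case: (leP x (X + l / 2 * w)) => hxm.
    by apply: hd1 => //; rewrite /= mul0r addr0 hxm andbT; case/andP: hx.
  apply: hd2 => //; rewrite /= mul1r -addrA -mulrDl -splitr (ltW hxm).
  by case/andP: hx.
have e20 : 0 < e / 2 by rewrite divr_gt0.
have [d d0 hd] := proj1 (ccontP _ _) (ch (Complex xs y)) _ e20.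
have d'0 : 0 < d / 2 / (w + 1) by rewrite !divr_gt0 // ltr_wpDl.
have [X [Y [l [/andP[l0 ld] hb hX _]]]] := hs _ d'0.
have d20 : 0 < d / 2 by rewrite divr_gt0.
have [x [t [hxt ht]]] := hb _ d20; rewrite leNgt => /negP; apply.
have hlw : l * w < d / 2.
  rewrite ltr_pdivlMr ?ltr_wpDl // in ld; apply: le_lt_trans ld.
  by rewrite ler_pM2l // lerDl.
have hxx : `|x - xs| < d / 2 by rewrite ltr_norml; lra.
have close (s : R) : `|s| < d / 2 -> cabs (h (Complex x (y + s)) - h (Complex xs y)) < e / 2.
  move=> hs'; apply: hd; apply: le_lt_trans (cabs_le_ReIm _) _.
  by rewrite /= addrAC subrr add0r (splitr d) ltrD.
have c1 := close t ht; have := close 0; rewrite normr0 addr0 => /(_ d20) c2.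
apply: le_lt_trans (cabs_distD (h (Complex xs y)) _ _) _.
by rewrite (splitr e) ltrD // cabsC.
Qed.

(** The integrals over the two long sides nearly cancel and the other two sides are short. This lets
    Cauchy's theorem reach a line on which [h] is only continuous. *)
Lemma thin_rect h x1 x2 y (e : R) : x1 <= x2 -> (forall z, ccont h z) -> 0 < e ->
  exists2 d : R, 0 < d & forall s, 0 <= s < d ->
    cabs (rint h x1 x2 y (y + s)) <= e /\ cabs (rint h x1 x2 (y - s) y) <= e.
Proof.
move=> x12 ch e0; pose W := x2 - x1; have W0 : 0 <= W by rewrite subr_ge0.
(* The bound 1 controls [h] by [M] on the short vertical sides; the other bound makes the horizontal
   sides cancel up to [e / 2]. *)
pose ep := Num.min 1 (e / (4 * W + 1)).
have W1 : 0 < 4 * W + 1 by rewrite ltr_wpDl // mulr_ge0.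
have ep0 : 0 < ep by rewrite lt_min ltr01 divr_gt0.
have [d d0 hd] := vertical_uniform y x12 ch ep0.
pose M := cabs (h (Complex x1 y)) + cabs (h (Complex x2 y)) + 1.
have M0 : 0 < M by rewrite ltr_wpDl // addr_ge0 ?cabs_ge0.
have epW : 2 * ep * W <= e / 2.
  have : ep <= e / (4 * W + 1) by rewrite ge_min lexx orbT.
  rewrite ler_pdivlMr // => h1.
  have : ep * 1 >= 0 by rewrite mulr1 ltW.
  lra.
have ep1 : ep <= 1 by rewrite ge_min lexx.
have bnd x (t : R) : x = x1 \/ x = x2 -> `|t| < d -> cabs (h (Complex x (y + t))) <= M.
  move=> hx ht; have hx' : x1 <= x <= x2 by case: hx => ->; rewrite lexx x12.
  have h1 := hd x t hx' ht; have h2 := cabsB_ge (h (Complex x (y + t))) (h (Complex x y)).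
  have h3 := cabs_ge0 (h (Complex x1 y)); have h4 := cabs_ge0 (h (Complex x2 y)).
  by rewrite /M; case: hx h1 h2 => -> h1 h2; lra.
have I1 : cabs I = 1 by rewrite /cabs /= expr0n add0r expr1n sqrtr1.
have key y1 y2 : y1 <= y2 -> y2 - y1 < e / (8 * M) -> `|y1 - y| < d -> `|y2 - y| < d ->
    (y1 = y \/ y2 = y) -> cabs (rint h x1 x2 y1 y2) <= e.
  move=> y12 yM hy1 hy2 hy.
  have [r1 r2 r3 r4] := @rint_rcont _ h x1 x2 y1 y2 (fun z _ => ch z).
  have hb t : y1 <= t <= y2 -> `|t - y| < d.
    by move=> ht; move: hy1 hy2; rewrite !ltr_norml; lra.
  rewrite /rint; apply: le_trans (cabsD _ _) _; rewrite cabsM I1 mul1r.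
  have r2' : rcont (fun t => (-1) * h (I * y2%:C + 1 * t%:C)).
    have I1' : cabs (1 : R[i]) <= 1 by rewrite cabs1.
    apply: (@rcont_line _ (fun z => (-1) * h z) (I * y2%:C) 1 I1') => t.
    exact: ccontM (ccont_cst _ _) (ch _).
  have -> : cint (fun t => h (I * y1%:C + 1 * t%:C)) x1 x2 - cint (fun t => h (I * y2%:C + 1 * t%:C)) x1 x2
     = cint (fun t => h (I * y1%:C + 1 * t%:C) + (-1) * h (I * y2%:C + 1 * t%:C)) x1 x2.
    by rewrite cintD // cintZ // mulN1r.
  have b1 : cabs (cint (fun t => h (I * y1%:C + 1 * t%:C) + (-1) * h (I * y2%:C + 1 * t%:C)) x1 x2) <= e / 2.
    apply: le_trans epW; apply: cint_le => // [|t ht].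
      split=> t; have [a1 a2] := r1; have [b1 b2] := r2'.
        by under [X in continuous_at _ X]eq_fun do rewrite /= cReD; apply: cvgD; [exact: a1|exact: b1].
      by under [X in continuous_at _ X]eq_fun do rewrite /= cImD; apply: cvgD; [exact: a2|exact: b2].
    rewrite !horE mulN1r; apply: ltW; case: hy => hy.
      by rewrite hy cabsC; have := hd t (y2 - y) ht hy2; rewrite subrKC.
    by rewrite hy; have := hd t (y1 - y) ht hy1; rewrite subrKC.
  have b2 : cabs (cint (fun t => h (x2%:C + I * t%:C)) y1 y2) <= 2 * M * (y2 - y1).
    by apply: cint_le => // t ht; rewrite verE -(subrKC y t); apply: bnd; [right|exact: hb].
  have b3 : cabs (cint (fun t => h (x1%:C + I * t%:C)) y1 y2) <= 2 * M * (y2 - y1).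
    by apply: cint_le => // t ht; rewrite verE -(subrKC y t); apply: bnd; [left|exact: hb].
  apply: le_trans (lerD b1 (cabsB _ _)) _.
  by move: yM; rewrite ltr_pdivlMr ?mulr_gt0 //; lra.
exists (Num.min d (e / (8 * M))); first by rewrite lt_min d0 divr_gt0 ?mulr_gt0.
move=> s /andP[s0]; rewrite lt_min => /andP[sd sM]; split; apply: key.
- by rewrite lerDl.
- by rewrite addrAC subrr add0r.
- by rewrite subrr normr0.
- by rewrite addrAC subrr add0r ger0_norm.
- by left.
- by rewrite gerBl.
- by rewrite subKr.
- by rewrite addrAC subrr add0r normrN ger0_norm.
- by rewrite subrr normr0.
- by right.
Qed.

Lemma cauchy_strip h x1 x2 y1 y2 : x1 <= x2 -> y1 < y2 -> (forall z, ccont h z) ->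
  (forall z, y1 < Im z < y2 -> cdiff h z) -> rint h x1 x2 y1 y2 = 0.
Proof.
move=> x12 y12 ch dh; apply/eqP; rewrite -cabs_eq0 eq_le cabs_ge0 andbT.
apply/ler_addgt0Pr => e e0; rewrite add0r.
have e20 : 0 < e / 2 by rewrite divr_gt0.
have [d1 d10 h1] := thin_rect y1 x12 ch e20; have [d2 d20 h2] := thin_rect y2 x12 ch e20.
pose s := Num.min (Num.min d1 d2) (y2 - y1) / 2.
have m0 : 0 < Num.min (Num.min d1 d2) (y2 - y1) by rewrite !lt_min d10 d20 subr_gt0.
have s0 : 0 < s by rewrite divr_gt0.
have sm : s < Num.min (Num.min d1 d2) (y2 - y1) by rewrite /s; lra.
have [sd1 sd2 sy] : [/\ s < d1, s < d2 & s + s <= y2 - y1].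
  have hs : s + s <= y2 - y1 by rewrite /s -splitr ge_min lexx orbT.
  by move: sm; rewrite !lt_min => /andP[/andP[-> ->] _].
have hm : rint h x1 x2 (y1 + s) (y2 - s) = 0.
  by apply: goursat => // [|z _ hz]; [lra | apply: dh; lra].
rewrite -(rint_caty _ _ _ _ (y1 + s)) -(rint_caty _ _ _ (y1 + s) (y2 - s)) hm add0r.
apply: le_trans (cabsD _ _) _; rewrite (splitr e).
have [|a1 _] := h1 s; first by rewrite (ltW s0).
have [|_ a2] := h2 s; first by rewrite (ltW s0).
exact: lerD.
Qed.

(** The rectangle is cut at every height of [L] that it contains; each strip in between requires
    differentiability in its interior only. *)
Lemma cauchy_lines h (L : seq R) x1 x2 y1 y2 : x1 <= x2 -> y1 <= y2 -> (forall z, ccont h z) ->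
  (forall z, y1 < Im z < y2 -> Im z \notin L -> cdiff h z) -> rint h x1 x2 y1 y2 = 0.
Proof.
move=> x12 y12 ch; elim: L y1 y2 y12 => [|e L ih] y1 y2 y12 dh.
  move: y12; rewrite le_eqVlt => /orP[/eqP->|y12].
    by rewrite /rint !subrr add0r /cint /= !subrr mulr0.
  by apply: cauchy_strip => // z hz; apply: dh.
case: (pselect (y1 < e < y2)) => [/andP[h1 h2]|hN]; last first.
  apply: ih => // z hz hL; apply: dh => //; rewrite inE negb_or hL andbT.
  by apply/eqP => he; apply: hN; rewrite -he.
rewrite -(rint_caty _ _ _ _ e) !ih ?addr0 ?(ltW h1) ?(ltW h2) // => z hz hL; apply: dh; rewrite ?inE ?negb_or ?hL ?andbT.
- by lra.
- by apply/eqP; lra.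
- by lra.
- by apply/eqP; lra.
Qed.

End Cauchy.

(** * Cauchy's formula and Liouville's theorem *)

Section Liouville.
Context {R : realType}.
Implicit Types (f h k : R[i] -> R[i]) (x y l : R).
Local Notation I := (Complex 0 1 : R[i]).

Lemma ccont_subinv (c z : R[i]) : z != c -> ccont (fun u => (u - c)^-1) z.
Proof.
move=> zc; apply: (@ccontV _ (fun u => u - c)); first by rewrite subr_eq0.
exact: ccontB (ccont_id z) (ccont_cst c z).
Qed.

(* The square of half-side [L] centred at [c] has winding number bounded below. *)
Lemma winding_ge (c : R[i]) (L : R) : 0 < L ->
  4 <= Im (rint (fun z => (z - c)^-1) (Re c - L) (Re c + L) (Im c - L) (Im c + L)).
Proof.
move=> L0; set x1 := Re c - L; set x2 := Re c + L; set y1 := Im c - L; set y2 := Im c + L.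
have x12 : x1 <= x2 by rewrite /x1 /x2; lra.
have y12 : y1 <= y2 by rewrite /y1 /y2; lra.
have off z : on_lines x1 x2 y1 y2 z -> ccont (fun z => (z - c)^-1) z.
  move=> hz; apply: ccont_subinv; apply/eqP => e.
  by case: hz; rewrite e /x1 /x2 /y1 /y2; lra.
have off' (q : R[i]) z : on_lines x1 x2 y1 y2 z -> ccont (fun z => q * (z - c)^-1) z.
  by move=> /off h; exact: ccontM (ccont_cst q z) h.
have [r1 r2 r3 r4] := rint_rcont off.
have [_ s2 _ _] := rint_rcont (off' (-1)).
have [_ _ s3 _] := rint_rcont (off' I).
have [_ _ _ s4] := rint_rcont (off' (- I)).
have imE (A B C D : R[i]) :
    Im (A - B + I * (C - D)) = Im A + Im ((-1) * B) + (Im (I * C) + Im ((- I) * D)).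
  by rewrite ?(cReD, cImD, cReN, cImN, cReM, cImM) /=; ring.
rewrite /rint imE -!cintZ //.
(* With the factors [-1], [I], [- I] absorbed, every side has an integrand of imaginary part at
   least 1 / (2 L) over a length 2 L. The resulting total 4 stands in for 2 pi. *)
have key u v (F : R -> R[i]) : u <= v -> v - u = 2 * L -> rcont F ->
    (forall t, u <= t <= v -> (2 * L)^-1 <= Im (F t)) -> 1 <= Im (cint F u v).
  move=> uv uvL rF hF; apply: le_trans (cint_Im_ge rF uv hF).
  by rewrite uvL mulVf // mulf_neq0 ?gt_eqF.
have x21 : x2 - x1 = 2 * L by rewrite /x1 /x2; ring.
have y21 : y2 - y1 = 2 * L by rewrite /y1 /y2; ring.
have bnd (s : R) : - L <= s <= L -> (2 * L)^-1 <= L / (s ^+ 2 + L ^+ 2).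
  move=> hs; have s2L : s ^+ 2 <= L ^+ 2.
    by rewrite -ler_sqrt ?sqr_ge0 // !sqrtr_sqr (gtr0_norm L0) ler_norml.
  have L2 : 0 < L ^+ 2 by rewrite exprn_gt0.
  have s20 := sqr_ge0 s.
  rewrite ler_pdivlMr ?ltr_wpDl // ler_pdivrMl ?mulr_gt0 //.
  by move: s2L; rewrite expr2 [L ^+ 2]expr2; lra.
have V z : Im (z^-1) = - Im z / (Re z ^+ 2 + Im z ^+ 2) by case: z => ? ? /=; rewrite mulNr.
have V' z : Re (z^-1) = Re z / (Re z ^+ 2 + Im z ^+ 2) by case: z.
have b1 := key _ _ _ x12 x21 r1; have b2 := key _ _ _ x12 x21 s2.
have b3 := key _ _ _ y12 y21 s3; have b4 := key _ _ _ y12 y21 s4.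
have -> : (4 : R) = 1 + 1 + (1 + 1) by ring.
apply: lerD; apply: lerD.
- apply: b1 => t ht; rewrite horE V ?(cReD, cImD, cReN, cImN) /=.
  have := bnd (t - Re c); rewrite /y1; have -> : Im c - L - Im c = - L by ring.
  by rewrite opprK sqrrN; apply; move: ht; rewrite /x1 /x2; lra.
- apply: b2 => t ht; rewrite mulN1r cImN horE V ?(cReD, cImD, cReN, cImN) /=.
  have := bnd (t - Re c); rewrite /y2; have -> : Im c + L - Im c = L by ring.
  by rewrite mulNr opprK; apply; move: ht; rewrite /x1 /x2; lra.
- apply: b3 => t ht; rewrite cImM verE V V' ?(cReD, cImD, cReN, cImN) /=.
  have := bnd (t - Im c); rewrite /x2; have -> : Re c + L - Re c = L by ring.
  by rewrite mul0r add0r mul1r [X in _ <= _ / X]addrC; apply; move: ht; rewrite /y1 /y2; lra.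
- apply: b4 => t ht; rewrite cImM verE V V' ?(cReD, cImD, cReN, cImN) /=.
  have := bnd (t - Im c); rewrite /x1; have -> : Re c - L - Re c = - L by ring.
  rewrite oppr0 mul0r add0r mulNr mul1r mulNr opprK sqrrN [X in _ <= _ / X]addrC.
  by apply; move: ht; rewrite /y1 /y2; lra.
Qed.

(* [f] may fail to be differentiable on the real line, so the Cauchy integral of the
   difference quotient at [c] avoids the two horizontal lines through 0 and [c]. *)
Lemma cauchy_formula f (c : R[i]) x1 x2 y1 y2 : x1 <= x2 -> y1 <= y2 ->
  (forall z, ccont f z) -> (forall z, Im z != 0 -> cdiff f z) -> Im c != 0 ->
  ~ on_lines x1 x2 y1 y2 c ->
  rint (fun z => f z * (z - c)^-1) x1 x2 y1 y2 =
  f c * rint (fun z => (z - c)^-1) x1 x2 y1 y2.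
Proof.
move=> x12 y12 cf df c0 hc; have [phi cphi hphi] := df c c0.
pose g z := if z == c then phi c else (f z - f c) * (z - c)^-1.
have offc z : z != c -> \forall u \near (z : R[i]^o), u != c.
  move=> zc; apply/near_cabs; exists (cabs (z - c)); first by rewrite cabs_gt0 subr_eq0.
  by move=> u; apply: contraTneq => ->; rewrite cabsC ltxx.
have gq z : z != c -> \forall u \near (z : R[i]^o), (f u - f c) * (u - c)^-1 = g u.
  by move=> /offc; apply: filterS => u /negPf hu; rewrite /g hu.
have cg z : ccont g z.
  case: (eqVneq z c) => [->|zc].
    apply: ccont_eqnear cphi; apply: filterS hphi => u hu; rewrite /g.
    by case: eqVneq => [->//|uc]; rewrite hu mulfK // subr_eq0.
  apply: ccont_eqnear (gq z zc) _.
  exact: ccontM (ccontB (cf z) (ccont_cst (f c) z)) (ccont_subinv zc).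
have dg z : Im z \notin [:: 0; Im c] -> cdiff g z.
  rewrite !inE negb_or => /andP[z0 zc'].
  have zc : z != c by apply: contra zc' => /eqP->.
  apply: cdiff_eqnear (gq z zc) _; apply: cdiffM.
    exact: cdiffB (df z z0) (cdiff_cst (f c) z).
  apply: (@cdiffV _ (fun u => u - c)); first by rewrite subr_eq0.
  exact: cdiffB (cdiff_id z) (cdiff_cst c z).
have := @cauchy_lines _ g [:: 0; Im c] x1 x2 y1 y2 x12 y12 cg (fun z _ => dg z).
have neq z : on_lines x1 x2 y1 y2 z -> z != c by move=> hz; apply/eqP => e; apply: hc; rewrite -e.
have cinv z : on_lines x1 x2 y1 y2 z -> ccont (fun z => (z - c)^-1) z.
  by move=> /neq; exact: ccont_subinv.
have -> : rint g x1 x2 y1 y2 =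
    rint (fun z => f z * (z - c)^-1 + (- f c) * (z - c)^-1) x1 x2 y1 y2.
  by apply: rint_ext => z /neq /negPf hz; rewrite /g hz; ring.
rewrite rintD; first last.
- by move=> z /cinv h; exact: ccontM (ccont_cst (- f c) z) h.
- by move=> z /cinv h; exact: ccontM (cf z) h.
by rewrite rintZ // mulNr => /eqP; rewrite subr_eq0 => /eqP.
Qed.

(** Cauchy's formula at [c] and at [c'] is compared over a large square centred at [c']: the kernels
    differ by O(1 / L^2) on a boundary of length O(L). Points of the real line are reached by
    continuity at the end. *)
Lemma liouville f (M : R) : (forall z, ccont f z) -> (forall z, Im z != 0 -> cdiff f z) ->
  (forall z, cabs (f z) <= M) -> forall z w, f z = f w.
Proof.
move=> cf df fM.
have M0 : 0 <= M by apply: le_trans (cabs_ge0 _) (fM 0).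
have key c c' : Im c != 0 -> Im c' != 0 -> f c = f c'.
  move=> c0 c'0; apply/eqP; rewrite -subr_eq0 -cabs_eq0 eq_le cabs_ge0 andbT.
  apply/ler_addgt0Pr => e e0; rewrite add0r.
  pose dl := cabs (c - c').
  have dl0 : 0 <= dl := cabs_ge0 _.
  (* The first terms keep [c] at distance at least [L / 2] from the boundary; the last one makes
     [32 * (M + M) * dl / L] at most [e]. *)
  pose L := 2 * dl + 1 + 32 * (M + M) * dl / e.
  have hq : 0 <= 32 * (M + M) * dl / e by rewrite divr_ge0 ?mulr_ge0 ?addr_ge0 // ltW.
  have L0 : 0 < L by rewrite /L; lra.
  have Ldl : 2 * dl < L by rewrite /L; lra.
  have Le : 32 * (M + M) * dl <= L * e.
    by rewrite -ler_pdivrMr // /L; lra.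
  set x1 := Re c' - L; set x2 := Re c' + L; set y1 := Im c' - L; set y2 := Im c' + L.
  have x12 : x1 <= x2 by rewrite /x1 /x2; lra.
  have y12 : y1 <= y2 by rewrite /y1 /y2; lra.
  have far z : on_lines x1 x2 y1 y2 z -> L <= cabs (z - c').
    have h1 := Re_le_cabs (z - c'); have h2 := Im_le_cabs (z - c').
    rewrite cReD cReN in h1; rewrite cImD cImN in h2.
    case=> hz; rewrite ?hz /x1 /x2 /y1 /y2 in h1 h2.
    - have e' : Re c' - L - Re c' = - L by ring.
      by rewrite e' normrN gtr0_norm in h1.
    - have e' : Re c' + L - Re c' = L by ring.
      by rewrite e' gtr0_norm in h1.
    - have e' : Im c' - L - Im c' = - L by ring.
      by rewrite e' normrN gtr0_norm in h2.
    - have e' : Im c' + L - Im c' = L by ring.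
      by rewrite e' gtr0_norm in h2.
  have far' z : on_lines x1 x2 y1 y2 z -> L / 2 <= cabs (z - c).
    move=> /far h; have := cabs_distD c z c'; rewrite -/dl; lra.
  have nc' : ~ on_lines x1 x2 y1 y2 c' by move=> /far; rewrite subrr cabs0; lra.
  have nc : ~ on_lines x1 x2 y1 y2 c by move=> /far'; rewrite subrr cabs0; lra.
  have cinv' z : on_lines x1 x2 y1 y2 z -> ccont (fun z => (z - c')^-1) z.
    by move=> hz; apply: ccont_subinv; apply/eqP => e'; apply: nc'; rewrite -e'.
  have cinv z : on_lines x1 x2 y1 y2 z -> ccont (fun z => (z - c)^-1) z.
    by move=> hz; apply: ccont_subinv; apply/eqP => e'; apply: nc; rewrite -e'.
  have small (k : R[i] -> R[i]) (N : R) : (forall z, ccont k z) -> (forall z, cabs (k z) <= N) ->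
    cabs (rint (fun z => k z * (z - c)^-1) x1 x2 y1 y2 -
          rint (fun z => k z * (z - c')^-1) x1 x2 y1 y2) <= 32 * N * dl / L.
    move=> ck kN.
    have N0 : 0 <= N by apply: le_trans (cabs_ge0 _) (kN 0).
    have ck1 z : on_lines x1 x2 y1 y2 z -> ccont (fun z => k z * (z - c)^-1) z.
      by move=> /cinv h; exact: ccontM (ck z) h.
    have ck2 z : on_lines x1 x2 y1 y2 z -> ccont (fun z => k z * (z - c')^-1) z.
      by move=> /cinv' h; exact: ccontM (ck z) h.
    have ck3 z : on_lines x1 x2 y1 y2 z -> ccont (fun z => (-1) * (k z * (z - c')^-1)) z.
      by move=> /ck2 h; exact: ccontM (ccont_cst (-1) z) h.
    rewrite -[X in _ - X]mul1r -mulNr -rintZ // -rintD //.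
    have -> : 32 * N * dl / L = 4 * (N * (2 * dl / L ^+ 2)) * ((x2 - x1) + (y2 - y1)).
      by rewrite /x1 /x2 /y1 /y2; field; rewrite gt_eqF.
    apply: rint_le => // z; first by move=> hz; exact: ccontD (ck1 z hz) (ck3 z hz).
    move=> hz _ _.
    have z1 : z - c != 0 by rewrite -cabs_gt0; apply: lt_le_trans (far' z hz); rewrite divr_gt0.
    have z2 : z - c' != 0 by rewrite -cabs_gt0; apply: lt_le_trans (far z hz).
    have -> : k z / (z - c) + -1 * (k z / (z - c')) = k z * ((c - c') * ((z - c) * (z - c'))^-1).
      by field; rewrite z1 z2.
    rewrite cabsM ler_pM ?cabs_ge0 // cabsM cabsV cabsM -/dl mulrAC mulrC ler_pM //.
      by rewrite invr_ge0 mulr_ge0 ?cabs_ge0.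
    have -> : 2 / L ^+ 2 = (L / 2 * L)^-1 by field; rewrite gt_eqF.
    rewrite lef_pV2 ?posrE ?mulr_gt0 ?divr_gt0 ?cabs_gt0 //.
    by rewrite ler_pM ?far ?far' ?divr_ge0 // ltW.
  (* The estimate for the constant function [f c] allows [J], the integral around [c], to be traded
     for [J'], whose modulus is bounded below. *)
  have e1 := small f M cf fM.
  have e2 := small (fun=> f c) M (ccont_cst _) (fun _ => fM c).
  rewrite !rintZ // in e2.
  rewrite (cauchy_formula x12 y12 cf df c0 nc) (cauchy_formula x12 y12 cf df c'0 nc') in e1.
  have W := winding_ge c' L0; rewrite -/x1 -/x2 -/y1 -/y2 in W.
  move: e1 e2 W; set J := rint _ _ _ _ _; set J' := rint _ _ _ _ _ => e1 e2 W.
  have J1 : 1 <= cabs J' by apply: le_trans (Im_le_cabs _); apply: le_trans (ler_norm _); lra.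
  have e3 : cabs ((f c - f c') * J') <= 32 * M * dl / L + 32 * M * dl / L.
    have -> : (f c - f c') * J' = (f c * J - f c' * J') - (f c * J - f c * J') by ring.
    by apply: le_trans (cabsB _ _) _; apply: lerD.
  have : cabs (f c - f c') * 1 <= e; last by rewrite mulr1.
  apply: le_trans (_ : cabs ((f c - f c') * J') <= _); first by rewrite cabsM ler_wpM2l ?cabs_ge0.
  apply: le_trans e3 _; rewrite -mulrDl ler_pdivrMr //.
  by move: Le; rewrite [e * L]mulrC; lra.
have cI w : f w = f I.
  apply/eqP; rewrite -subr_eq0 -cabs_eq0 eq_le cabs_ge0 andbT.
  apply/ler_addgt0Pr => e e0; rewrite add0r.
  have [d d0 hd] := proj1 (ccontP _ _) (cf w) e e0.
  have [v hv v0] : exists2 v : R[i], cabs (v - w) < d & Im v != 0.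
    case: (eqVneq (Im w) 0) => [w0|w0]; last by exists w; rewrite ?subrr ?cabs0.
    exists (w + I * (d / 2)%:C); last first.
      by rewrite cImD cImM /= w0 add0r mul0r mul1r add0r gt_eqF // divr_gt0.
    by rewrite addrAC subrr add0r cabsM cabsR /cabs /= expr0n add0r expr1n sqrtr1 mul1r gtr0_norm; lra.
  rewrite -(key v I v0) ?oner_neq0 // cabsC; exact/ltW/hd.
by move=> z w; rewrite !cI.
Qed.

End Liouville.

(** * Compactness of the sphere through ultrafilters *)

Section UltraLimits.
Context {R : realType} {T : Type}.

Lemma ultra_real (U : set_system T) (g : T -> R) (M : R) : UltraFilter U ->
  U [set t | `|g t| <= M]%classic ->
  exists l, forall e : R, 0 < e -> U [set t | `|g t - l| < e]%classic.
Proof.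
move=> UU UM.
pose S := [set x : R | U [set t | x <= g t]%classic]%classic.
have SM : S (- M) by apply: filterS UM => t /=; rewrite ler_norml => /andP[].
have Sub x : S x -> x <= M.
  move=> Sx; have [t [/= h1 h2]] := filter_ex (filterI Sx UM).
  by apply: le_trans h1 (le_trans (ler_norm _) h2).
have hS : has_sup S by split; [exists (- M) | exists M => x /Sub].
exists (sup S) => e e0.
have [x Sx hx] := sup_adherent e0 hS.
have nS : ~ S (sup S + e / 2).
  move=> /(sup_upper_bound hS); have : 0 < e / 2 by rewrite divr_gt0.
  lra.
have [//|UC] := in_ultra_setVsetC [set t | sup S + e / 2 <= g t]%classic UU.
apply: filterS2 Sx UC => t /= h1 /negP; rewrite -ltNge => h2.
by rewrite ltr_norml; lra.
Qed.

(** A family that is bounded on no set of [U] tends to infinity; otherwise real and imaginary parts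
    converge. This replaces the extraction of subsequences, also for several sequences at once. *)
Lemma ultra_lim (U : set_system T) (f : T -> Cbar R) : UltraFilter U ->
  exists p, forall P, nb p P -> U [set t | P (f t)]%classic.
Proof.
move=> UU.
pose bd (M : R) := [set t | exists2 z, f t = Some z & cabs z <= M]%classic.
case: (pselect (exists M, U (bd M))) => [[M UM]|hN].
  have UR : U [set t | `|Re (odflt 0 (f t))| <= M]%classic.
    by apply: filterS UM => t [z /= -> hz]; exact: le_trans (Re_le_cabs _) hz.
  have UI : U [set t | `|Im (odflt 0 (f t))| <= M]%classic.
    by apply: filterS UM => t [z /= -> hz]; exact: le_trans (Im_le_cabs _) hz.
  have [x hx] := ultra_real UU UR; have [y hy] := ultra_real UU UI.
  exists (Some (Complex x y)) => P /nb_fin[d d0 hd].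
  have d20 : 0 < d / 2 by rewrite divr_gt0.
  apply: filterS (filterI UM (filterI (hx _ d20) (hy _ d20))) => t [[z /= -> _] [h1 h2]].
  apply: hd; apply: le_lt_trans (cabs_le_ReIm _) _.
  by move: h1 h2; rewrite /= cReD cImD cReN cImN /=; lra.
exists None => P /nb_inf[PN [M hM]].
have [h|h] := in_ultra_setVsetC (bd M) UU; first by case: hN; exists M.
apply: filterS h => t /= ht; case e : (f t) => [z|//]; apply: hM.
by rewrite ltNge; apply/negP => hz; apply: ht; exists z.
Qed.

Lemma ultra_closed (U : set_system T) (f : T -> Cbar R) p (K : Cbar R -> Prop) : UltraFilter U ->
  (forall P, nb p P -> U [set t | P (f t)]%classic) ->
  (forall q, ~ K q -> nb q (fun r => ~ K r)) -> U [set t | K (f t)]%classic -> K p.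
Proof.
move=> UU hp hK UK; apply: contrapT => /hK /hp h.
by have [t [/= h1 h2]] := filter_ex (filterI h UK).
Qed.

Lemma ultra_unique (U : set_system T) (f : T -> Cbar R) p q : UltraFilter U ->
  (forall P, nb p P -> U [set t | P (f t)]%classic) ->
  (forall P, nb q P -> U [set t | P (f t)]%classic) -> p = q.
Proof.
move=> UU hp hq; apply: contrapT => /nb_sep[P [/hp h1 /hq h2]].
by have [t [/= h3 h4]] := filter_ex (filterI h1 h2).
Qed.

End UltraLimits.

Lemma nat_ultra {R : realType} : exists2 U : set_system nat, UltraFilter U &
  forall e : R, 0 < e -> U [set n | n.+1%:R^-1 < e]%classic.
Proof.
have [U [UU hU]] := @ultraFilterLemma _ (\oo : set_system nat)%classic _.
exists U => // e e0; apply: hU; exists (Num.truncn e^-1) => // n /= hn.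
rewrite invf_plt ?posrE ?ltr0Sn //; apply: lt_le_trans (truncnS_gt _) _.
by rewrite ler_nat ltnS.
Qed.

(** * The uniformizing map *)

(* The normalized map is [c G (z) = k + z - A / (1 - z) + B / (1 + z)], with the signs of
   the paper's (negative) A and B reversed; its numerator over [z ^ 2 - 1] is [cnum]. *)
Record config (R : realType) := Config {
  g_k : R; g_A : R; g_B : R; g_c : R;
  g_be : R; g_al : R; g_a : R; g_b : R; g_lam : R; g_mu : R;
  g_A0 : 0 < g_A; g_B0 : 0 < g_B; g_c0 : 0 < g_c;
  g_be1 : g_be < -1; g_al1 : -1 < g_al; g_al_a : g_al < g_a; g_a1 : g_a < 1; g_b1 : 1 < g_b;
  g_lam1 : 1 < g_lam; g_mu1 : 1 < g_mu;
  g_quart : forall x, (1 - x ^+ 2) ^+ 2 - g_A * (1 + x) ^+ 2 - g_B * (1 - x) ^+ 2 =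
                      (x - g_be) * (x - g_al) * (x - g_a) * (x - g_b);
  g_crit : forall v x, (v, x) \in [:: (- (g_mu * g_c), g_be); (- g_c, g_al);
                                      (g_c, g_a); (g_lam * g_c, g_b)] ->
    (g_k + x) * (x ^+ 2 - 1) + g_A * (1 + x) - g_B * (1 - x) = v * (x ^+ 2 - 1) }.

(** * The three roots of the cubic equation for a given value of [c G] *)

Section Cubic.
Context {R : realType} (K : config R).
Local Notation k := (g_k K). Local Notation A := (g_A K). Local Notation B := (g_B K).
Local Notation al := (g_al K). Local Notation a := (g_a K).
Local Notation be := (g_be K). Local Notation b := (g_b K).
Implicit Types (z u v W : R[i]).

Definition cnum z : R[i] := (k%:C + z) * (z ^+ 2 - 1) + A%:C * (1 + z) - B%:C * (1 - z).

Definition msq z : R := (1 - Re z) ^+ 2 + Im z ^+ 2.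
Definition nsq z : R := (1 + Re z) ^+ 2 + Im z ^+ 2.
(* Im (c G) has the sign of [Im z * NN z]. *)
Definition NN z : R := msq z * nsq z - A * nsq z - B * msq z.
Definition QQ z : R := 1 - A / msq z - B / nsq z.

(** The roots of [cnum x = W * (x ^+ 2 - 1)] with multiplicity. Comparing the values at 1 and -1 and
    the coefficient of degree 2 makes [A], [B] and [W] explicit in the roots, so identities close by
    [field]. *)
Definition triple W z u v := [/\ (2 * A)%:C = (1 - z) * (1 - u) * (1 - v),
  (2 * B)%:C = (1 + z) * (1 + u) * (1 + v) & W = k%:C + z + u + v].

(** The difference quotient of [c G] between [z] and [u], multiplied by
    [(1 - z ^+ 2) * (1 - u ^+ 2)]; on the diagonal it is the numerator of the derivative. *)
Definition Psi z u : R[i] :=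
  (1 - z ^+ 2) * (1 - u ^+ 2) - A%:C * ((1 + z) * (1 + u)) - B%:C * ((1 - z) * (1 - u)).

Lemma triple_swap W z u v : triple W z u v -> triple W z v u.
Proof. by case=> hA hB ->; split; rewrite ?hA ?hB; ring. Qed.

Lemma triple_rot W z u v : triple W z u v -> triple W u v z.
Proof. by case=> hA hB ->; split; rewrite ?hA ?hB; ring. Qed.

Lemma triple_AB W z u v : triple W z u v ->
  A%:C = (1 - z) * (1 - u) * (1 - v) / 2 /\ B%:C = (1 + z) * (1 + u) * (1 + v) / 2.
Proof. by move=> [hA hB _]; rewrite -hA -hB !rmorphM /= !rmorph_nat; split; field. Qed.

Lemma triple_num W z u v x : triple W z u v ->
  cnum x - W * (x ^+ 2 - 1) = (x - z) * (x - u) * (x - v).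
Proof. by move=> t; have [hA hB] := triple_AB t; case: t => _ _ ->; rewrite /cnum hA hB; field. Qed.

Lemma triple_root W z u v : triple W z u v -> cnum z = W * (z ^+ 2 - 1).
Proof. by move=> t; apply/eqP; rewrite -subr_eq0 (triple_num _ t) subrr !mul0r. Qed.

Lemma root_triple W z u v x : triple W z u v -> cnum x = W * (x ^+ 2 - 1) ->
  [\/ x = z, x = u | x = v].
Proof.
move=> t e; have /eqP := triple_num x t; rewrite e subrr eq_sym !mulf_eq0 !subr_eq0.
by move=> /orP[/orP[]|] /eqP; [constructor 1|constructor 2|constructor 3].
Qed.

Lemma triple_Psi W z u v : triple W z u v -> Psi z z = (z ^+ 2 - 1) * ((z - u) * (z - v)).
Proof. by move=> t; have [hA hB] := triple_AB t; rewrite /Psi hA hB; field. Qed.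

Lemma triple_exists W : exists z u v, triple W z u v.
Proof.
pose p : {poly R[i]} := 'X^3 + (k%:C - W) *: 'X^2 + (A%:C + B%:C - 1) *: 'X
  + (W + A%:C - B%:C - k%:C)%:P.
have pE x : p.[x] = cnum x - W * (x ^+ 2 - 1) by rewrite /cnum !hornerE /=; ring.
have sp : size p = 4%N.
  rewrite /p -!addrA size_addl ?size_polyXn //; apply: leq_ltn_trans (size_polyD _ _) _.
  rewrite gtn_max (leq_ltn_trans (size_scale_leq _ _)) ?size_polyXn //=.
  apply: leq_ltn_trans (size_polyD _ _) _.
  rewrite gtn_max (leq_ltn_trans (size_scale_leq _ _)) ?size_polyX //=.
  exact: leq_ltn_trans (size_polyC_leq1 _) _.
have lp : lead_coef p = 1.
  by rewrite lead_coefE sp /p !coefE /= !mulr0 !addr0.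
have [r er] := closed_field_poly_normal p.
have sr : size r = 3%N by move: sp; rewrite er lp scale1r size_prod_XsubC => -[].
case: r sr er => [|z [|u [|v []]]] // _ er.
have ev x : cnum x - W * (x ^+ 2 - 1) = (x - z) * (x - u) * (x - v).
  by rewrite -pE er lp scale1r !big_cons big_nil mulr1 !hornerM !hornerXsubC mulrA.
have e1 := ev 1; have e2 := ev (-1); have e0 := ev 0.
exists z, u, v; rewrite /triple !rmorphM /= !rmorph_nat.
have h1 : 2 * A%:C = (1 - z) * (1 - u) * (1 - v) by rewrite -e1 /cnum; ring.
have h2 : 2 * B%:C = (1 + z) * (1 + u) * (1 + v).
  have -> : (1 + z) * (1 + u) * (1 + v) = - ((-1 - z) * (-1 - u) * (-1 - v)) by ring.
  by rewrite -e2 /cnum; ring.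
split=> //.
have : cnum 0 - W * (0 ^+ 2 - 1) - (0 - z) * (0 - u) * (0 - v) = 0 by rewrite e0 subrr.
have hA : A%:C = (1 - z) * (1 - u) * (1 - v) / 2 by rewrite -h1; field.
have hB : B%:C = (1 + z) * (1 + u) * (1 + v) / 2 by rewrite -h2; field.
rewrite /cnum hA hB => h; apply/eqP; rewrite -subr_eq0 -h; apply/eqP; by field.
Qed.

Lemma num_Im z : Im (cnum z * (conjc (z ^+ 2 - 1))) = Im z * NN z.
Proof.
case: z => x y; rewrite /cnum /NN /msq /nsq expr2 /=.
by rewrite ?(cReD, cImD, cReN, cImN, cReM, cImM) /=; ring.
Qed.

Lemma cabs_zz1 z : cabs (z ^+ 2 - 1) ^+ 2 = msq z * nsq z.
Proof.
by rewrite cabsE_sq; case: z => x y; rewrite /msq /nsq expr2 /=; ring.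
Qed.

Lemma msq_cabs z : msq z = cabs (1 - z) ^+ 2.
Proof. by rewrite cabsE_sq; case: z => x y; rewrite /msq /= sub0r sqrrN. Qed.

Lemma nsq_cabs z : nsq z = cabs (1 + z) ^+ 2.
Proof. by rewrite cabsE_sq; case: z => x y; rewrite /nsq /= add0r. Qed.

Lemma zz1_neq0 W z : cnum z = W * (z ^+ 2 - 1) -> z ^+ 2 - 1 != 0.
Proof.
move=> h; apply/eqP => e; move: h; rewrite e mulr0.
have : (z - 1) * (z + 1) = 0 by rewrite -e; ring.
move/eqP; rewrite mulf_eq0 => /orP[].
  rewrite subr_eq0 => /eqP->; rewrite /cnum => h.
  have : (A + A)%:C = 0 by rewrite rmorphD /= -h; ring.
  by move/(@complexI R)/eqP; rewrite gt_eqF // addr_gt0 // g_A0.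
rewrite addr_eq0 => /eqP->; rewrite /cnum => h.
have : (- (B + B))%:C = 0 by rewrite rmorphN rmorphD /= -h; ring.
by move/(@complexI R)/eqP; rewrite oppr_eq0 gt_eqF // addr_gt0 // g_B0.
Qed.

Lemma msq_gt0 z : z ^+ 2 - 1 != 0 -> 0 < msq z.
Proof.
move=> h; rewrite msq_cabs exprn_gt0 // cabs_gt0; apply: contra h => /eqP h.
by have -> : z ^+ 2 - 1 = - ((1 - z) * (1 + z)) by [ring]; rewrite h mul0r oppr0.
Qed.

Lemma nsq_gt0 z : z ^+ 2 - 1 != 0 -> 0 < nsq z.
Proof.
move=> h; rewrite nsq_cabs exprn_gt0 // cabs_gt0; apply: contra h => /eqP h.
by have -> : z ^+ 2 - 1 = - ((1 - z) * (1 + z)) by [ring]; rewrite h mulr0 oppr0.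
Qed.

Lemma Im_root W z : cnum z = W * (z ^+ 2 - 1) -> Im W * (msq z * nsq z) = Im z * NN z.
Proof.
move=> h; rewrite -num_Im h -mulrA -cabs_zz1 cabsE_sq.
by case: W (z ^+ 2 - 1) {h} => ? ? [? ?] /=; ring.
Qed.

Lemma NN_QQ z : z ^+ 2 - 1 != 0 -> NN z = QQ z * (msq z * nsq z).
Proof.
move=> h; rewrite /NN /QQ; field.
by rewrite !gt_eqF ?msq_gt0 ?nsq_gt0.
Qed.

Lemma QQ_gt0 z : z ^+ 2 - 1 != 0 -> (0 < QQ z) = (0 < NN z).
Proof. by move=> h; rewrite NN_QQ // pmulr_lgt0 // mulr_gt0 ?msq_gt0 ?nsq_gt0. Qed.

Lemma QQ_ge0 z : z ^+ 2 - 1 != 0 -> (0 <= QQ z) = (0 <= NN z).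
Proof. by move=> h; rewrite NN_QQ // pmulr_lge0 // mulr_gt0 ?msq_gt0 ?nsq_gt0. Qed.

(* By AM-GM the difference quotient of [c G] is bounded below by the mean of [QQ]. *)
Lemma root_sep W W' z z' : cnum z = W * (z ^+ 2 - 1) -> cnum z' = W' * (z' ^+ 2 - 1) ->
  cabs (z - z') * ((QQ z + QQ z') / 2) <= cabs (W - W').
Proof.
move=> h h'; have n0 := zz1_neq0 h; have n0' := zz1_neq0 h'.
have fac (x : R[i]) : x ^+ 2 - 1 != 0 -> 1 - x != 0 /\ 1 + x != 0.
  have -> : x ^+ 2 - 1 = - ((1 - x) * (1 + x)) by ring.
  by rewrite oppr_eq0 mulf_eq0 negb_or => /andP[].
have [m1 m2] := fac z n0; have [m1' m2'] := fac z' n0'.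
pose Phi := 1 - (A%:C / ((1 - z) * (1 - z')) + B%:C / ((1 + z) * (1 + z'))).
have zz (x : R[i]) : x ^+ 2 - 1 = - ((1 - x) * (1 + x)) by ring.
have WE : W - W' = (z - z') * Phi.
  have -> : W = cnum z / (z ^+ 2 - 1) by rewrite h mulfK.
  have -> : W' = cnum z' / (z' ^+ 2 - 1) by rewrite h' mulfK.
  by rewrite /cnum /Phi !zz; field; rewrite m1 m2 m1' m2'.
have amgm (x y : R[i]) : x != 0 -> y != 0 ->
    cabs (x * y)^-1 <= ((cabs x ^+ 2)^-1 + (cabs y ^+ 2)^-1) / 2.
  move=> x0 y0; rewrite cabsV cabsM invfM -!exprVn.
  have := sqr_ge0 ((cabs x)^-1 - (cabs y)^-1); rewrite sqrrB; lra.
have hP : (QQ z + QQ z') / 2 <= cabs Phi.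
  apply: le_trans (cabsB_ge _ _); rewrite cabs1.
  have h1 := ler_wpM2l (ltW (g_A0 K)) (amgm _ _ m1 m1').
  have h2 := ler_wpM2l (ltW (g_B0 K)) (amgm _ _ m2 m2').
  have h3 := cabsD (A%:C / ((1 - z) * (1 - z'))) (B%:C / ((1 + z) * (1 + z'))).
  rewrite !(@cabsM _ _%:C) !cabsR !gtr0_norm ?g_A0 ?g_B0 // in h3.
  by rewrite /QQ !msq_cabs !nsq_cabs; lra.
by rewrite WE cabsM ler_wpM2l ?cabs_ge0.
Qed.

(** The reverse triangle inequality; it makes every root with [0 < NN z] simple. *)
Lemma Psi_ge z : NN z <= cabs (Psi z z).
Proof.
have -> : NN z = cabs ((1 - z) * (1 + z)) ^+ 2 - (A * cabs (1 + z) ^+ 2 + B * cabs (1 - z) ^+ 2).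
  by rewrite /NN msq_cabs nsq_cabs cabsM; ring.
have -> : Psi z z = ((1 - z) * (1 + z)) ^+ 2 - (A%:C * (1 + z) ^+ 2 + B%:C * (1 - z) ^+ 2).
  by rewrite /Psi; ring.
apply: le_trans (cabsB_ge _ _); rewrite cabsX lerD2l lerN2.
apply: le_trans (cabsD _ _) _.
by rewrite !(@cabsM _ _%:C) !cabsR !gtr0_norm ?g_A0 ?g_B0 // !cabsX.
Qed.

Lemma Psi_real (x : R) : Psi x%:C x%:C = (NN x%:C)%:C.
Proof.
apply: complex_ext; rewrite /Psi /NN /msq /nsq !expr2 ?(cReD, cImD, cReN, cImN, cReM, cImM) /=; ring.
Qed.

(** For equal values [root_sep] forces two roots with positive [NN] to coincide, and [Psi_ge]
    excludes a double root there. *)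
Lemma triple_NN W z u v : triple W z u v -> 0 < NN z -> NN u <= 0.
Proof.
move=> t Nz; rewrite leNgt; apply/negP => Nu.
have rz := triple_root t; have ru := triple_root (triple_rot t).
have nz := zz1_neq0 rz; have nu := zz1_neq0 ru.
have := root_sep rz ru; rewrite subrr cabs0.
have q0 : 0 < (QQ z + QQ u) / 2 by rewrite divr_gt0 // addr_gt0 ?QQ_gt0.
rewrite pmulr_lle0 // => h; have /eqP : cabs (z - u) = 0 by apply/eqP; rewrite eq_le h cabs_ge0.
rewrite cabs_eq0 => /eqP zu; have := Psi_ge z.
by rewrite (triple_Psi t) zu mul0r mulr0 cabs0 leNgt Nz.
Qed.

(** On the real axis [NN] is the numerator of the derivative of [c G], so its zeros there are the
    critical points. *)
Lemma NN_real (x : R) : NN x%:C = (x - be) * (x - al) * (x - a) * (x - b).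
Proof. by rewrite -g_quart /NN /msq /nsq /=; ring. Qed.

Definition x0 : R := (al + a) / 2.

Lemma x0_bounds : al < x0 < a.
Proof. by have := g_al_a K; rewrite /x0; lra. Qed.

(** Between [al] and [a] the quartic is positive, and on the vertical line [NN] only grows with the
    square of the imaginary part. *)
Lemma NN_x0 z : Re z = x0 -> 0 < NN z.
Proof.
move=> zx; have hx := x0_bounds.
have h0 : 0 < NN x0%:C.
  rewrite NN_real -mulrA; have := g_be1 K; have := g_al1 K; have := g_a1 K; have := g_b1 K.
  move=> h1 h2 h3 h4; apply: mulr_gt0; first by apply: mulr_gt0; lra.
  by rewrite nmulr_rgt0; lra.
have hm : 0 < (1 - x0) ^+ 2.
  by rewrite exprn_gt0 // subr_gt0; have := g_a1 K; lra.
have hn : 0 < (1 + x0) ^+ 2.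
  by rewrite exprn_gt0 //; have := g_al1 K; lra.
move: h0; rewrite /NN /msq /nsq /= zx expr0n !addr0.
set m := (1 - x0) ^+ 2 in hm *; set n := (1 + x0) ^+ 2 in hn *; set t := Im z ^+ 2.
have t0 : 0 <= t by exact: sqr_ge0.
move=> h0.
have mA : A < m.
  rewrite -(ltr_pM2r hn); have : 0 < B * m by rewrite mulr_gt0 ?g_B0. lra.
have nB : B < n.
  rewrite -(ltr_pM2r hm); have : 0 < A * n by rewrite mulr_gt0 ?g_A0. lra.
have -> : (m + t) * (n + t) - A * (n + t) - B * (m + t) =
  (m * n - A * n - B * m) + t * ((m - A) + (n - B) + t) by ring.
by rewrite ltr_pwDl // mulr_ge0 // addr_ge0 // addr_ge0 // subr_ge0 ltW.
Qed.

End Cubic.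

(** * Position of the roots over the upper half-plane *)

Section Pieces.
Context {R : realType} (K : config R).
Local Notation k := (g_k K). Local Notation A := (g_A K). Local Notation B := (g_B K).
Local Notation al := (g_al K). Local Notation a := (g_a K). Local Notation c := (g_c K).
Local Notation be := (g_be K). Local Notation b := (g_b K).
Implicit Types (z u v W : R[i]).
Local Notation x0 := (x0 K).
Local Notation cnum := (cnum K).
Local Notation NN := (NN K).
Local Notation triple := (triple K).

(** The imaginary parts of the roots add up to [Im W], so some root lies above the axis and has
    positive [NN]. By [triple_NN] the others have [NN] negative, and since [Im x * NN x] has the
    sign of [Im W] they lie below. *)
Lemma upper_triple W : 0 < Im W -> exists z u v, triple W z u v /\
  [/\ 0 < Im z /\ 0 < NN z, Im u < 0 /\ NN u < 0 & Im v < 0 /\ NN v < 0].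
Proof.
move=> W0.
have main z u v : triple W z u v -> 0 < Im z -> exists z u v, triple W z u v /\
  [/\ 0 < Im z /\ 0 < NN z, Im u < 0 /\ NN u < 0 & Im v < 0 /\ NN v < 0].
  move=> t z0; exists z, u, v; split=> //.
  have pos x : cnum x = W * (x ^+ 2 - 1) -> 0 < Im x * NN x.
    move=> h; rewrite -(Im_root h) mulr_gt0 // mulr_gt0 //.
      exact: msq_gt0 (zz1_neq0 h).
    exact: nsq_gt0 (zz1_neq0 h).
  have hz := pos _ (triple_root t); rewrite pmulr_rgt0 // in hz.
  have low x : cnum x = W * (x ^+ 2 - 1) -> NN x <= 0 -> Im x < 0 /\ NN x < 0.
    move=> /pos h1 h2; have N0 : NN x < 0.
      by rewrite lt_neqAle h2 andbT; apply: contraTneq h1 => ->; rewrite mulr0 ltxx.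
    by split=> //; rewrite nmulr_lgt0 in h1.
  have tu := triple_rot t; have tv := triple_rot tu.
  split=> //; first exact: low (triple_root tu) (triple_NN t hz).
  exact: low (triple_root tv) (triple_NN (triple_swap t) hz).
have [z [u [v t]]] := triple_exists K W.
have e : Im W = Im z + Im u + Im v.
  by case: t => _ _ ->; rewrite !cImD /= add0r.
have tu := triple_rot t; have tv := triple_rot tu.
case: (ltP 0 (Im z)) => hz; first exact: main t hz.
case: (ltP 0 (Im u)) => hu; first exact: main tu hu.
case: (ltP 0 (Im v)) => hv; first exact: main tv hv.
lra.
Qed.

(** An expression in [U + V] and [U * V] alone tells whether [U] and [V] lie on the same side of the
    imaginary axis. Its continuity along a path needs no labelling of the two roots. *)
Lemma Re_mul_sym (U V : R[i]) :
  2 * Re (U * V) + (cabs (U + V) ^+ 2 - cabs ((U + V) ^+ 2 - 4 * (U * V))) / 2 = 4 * (Re U * Re V).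
Proof.
have -> : (U + V) ^+ 2 - 4 * (U * V) = (U - V) ^+ 2 by ring.
by rewrite cabsX !cabsE_sq !(cReD, cImD, cReN, cImN, cReM, cImM); field.
Qed.

Lemma ccont_real (f : R -> R) (g : R[i] -> R[i]) z :
  (forall w, g w = (f (Re w))%:C) -> {for Re z, continuous f} -> ccont g z.
Proof.
move=> gf cf; apply/ccontP => e e0.
have /cvgrPdist_lt /(_ e e0) /nbhs_ballP[d /= d0 hd] := cf.
exists d => // w hw; rewrite !gf -rmorphB cabsR distrC; apply: hd; rewrite /ball /=.
by apply: le_lt_trans hw; rewrite cabsC -cReN -cReD Re_le_cabs.
Qed.

Lemma ccont_cabs (g : R[i] -> R[i]) z : ccont g z -> ccont (fun w => (cabs (g w))%:C) z.
Proof.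
move=> /ccontP h; apply/ccontP => e /h[d d0 hd]; exists d => // w /hd hw.
apply: le_lt_trans hw; rewrite -rmorphB cabsR ler_norml.
have h1 := cabsB_ge (g w) (g z); have h2 := cabsB_ge (g z) (g w); rewrite cabsC in h2.
lra.
Qed.

Lemma ccont_ReC (g : R[i] -> R[i]) z : ccont g z -> ccont (fun w => (Re (g w))%:C) z.
Proof.
move=> /ccontP h; apply/ccontP => e /h[d d0 hd]; exists d => // w /hd hw.
by apply: le_lt_trans hw; rewrite -rmorphB cabsR -cReN -cReD Re_le_cabs.
Qed.

(* Along a path from [F x0] into the upper half-plane the two roots in [NN <= 0] stay off
   the line [Re = x0], so they remain on opposite sides of it. *)
Lemma upper_sides W z u v : 0 < Im W -> triple W z u v -> 0 < NN z ->
  (Re u - x0) * (Re v - x0) < 0.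
Proof.
move=> W1 t Nz.
have [ax xa] : al < x0 /\ x0 < a by apply/andP; exact: x0_bounds.
have hx1 : x0 ^+ 2 - 1 < 0.
  have -> : x0 ^+ 2 - 1 = (x0 - 1) * (x0 + 1) by ring.
  by rewrite nmulr_rlt0; have := g_al1 K; have := g_a1 K; lra.
pose W0r := ((k + x0) * (x0 ^+ 2 - 1) + A * (1 + x0) - B * (1 - x0)) / (x0 ^+ 2 - 1).
have r0 : cnum x0%:C = W0r%:C * (x0%:C ^+ 2 - 1).
  have -> : cnum x0%:C = ((k + x0) * (x0 ^+ 2 - 1) + A * (1 + x0) - B * (1 - x0))%:C.
    by rewrite /cnum; apply: complex_ext; rewrite ?(cReD, cImD, cReN, cImN, cReM, cImM) /=; ring.
  rewrite -(rmorphXn (real_complex R)) -(rmorph1 (real_complex R)) -rmorphB -rmorphM /=.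
  by rewrite /W0r divfK // lt_eqF.
have Nx : 0 < NN x0%:C by apply: NN_x0.
have [u0 [v0 t0]] : exists u0 v0, triple W0r%:C x0%:C u0 v0.
  have [z1 [u1 [v1 t1]]] := triple_exists K W0r%:C.
  have tu := triple_rot t1; have tv := triple_rot tu.
  by case: (root_triple t1 r0) => e; rewrite e; [exists u1, v1|exists v1, z1|exists z1, u1].
(* The path leads from the real value of [c G] at [x0] to [W]. The square keeps it in the upper
   half-plane for all nonzero [t], negative ones included, so continuity can be stated on all of
   [R]. *)
pose Wt (t : R) := W0r%:C + (t ^+ 2)%:C * (W - W0r%:C).
have ex (s : R) : exists z, exists u v, triple (Wt s) z u v /\ 0 < NN z /\ (s = 0 -> z = x0%:C).
  case: (eqVneq s 0) => [->|s0].
    by exists x0%:C, u0, v0; rewrite /Wt expr0n mul0r addr0.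
  have [|z1 [u1 [v1 [t1 [[_ N1] _ _]]]]] := @upper_triple (Wt s); last first.
    by exists z1, u1, v1; split=> //; split=> // e; rewrite e eqxx in s0.
  rewrite /Wt cImD cImM /= cImD cImN /= oppr0 addr0 mul0r addr0 add0r.
  by rewrite mulr_gt0 // exprn_even_gt0.
have [Z hZ] := choice ex.
have rZ s : cnum (Z s) = Wt s * (Z s ^+ 2 - 1) by have [u1 [v1 [t1 _]]] := hZ s; exact: triple_root t1.
(* [Z] was picked by choice at each parameter; [root_sep], with [QQ] positive at the base point,
   makes it continuous all the same. *)
have cZ z1 : ccont (fun w => Z (Re w)) z1.
  apply/ccontP => e e0; set s := Re z1.
  have [_ [_ [_ [Ns _]]]] := hZ s.
  have q0 : 0 < QQ K (Z s) by rewrite QQ_gt0 // (zz1_neq0 (rZ s)).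
  have cW : ccont (fun w => Wt (Re w)) z1.
    apply: ccontD (ccont_cst _ _) _; apply: ccontM _ (ccont_cst _ _).
    by apply: (@ccont_real (fun t => t ^+ 2)) => // x; exact: exprn_continuous.
  have [d d0 hd] := proj1 (ccontP _ _) cW (e * (QQ K (Z s) / 2)) (mulr_gt0 e0 (divr_gt0 q0 (ltr0Sn R 1))).
  exists d => // w /hd hw; have hh := le_lt_trans (root_sep (rZ (Re w)) (rZ s)) hw.
  have qw : 0 <= QQ K (Z (Re w)).
    by have [_ [_ [_ [Nw _]]]] := hZ (Re w); rewrite QQ_ge0 ?ltW // (zz1_neq0 (rZ (Re w))).
  rewrite -(@ltr_pM2r _ (QQ K (Z s) / 2)) ?divr_gt0 //; apply: le_lt_trans hh.
  by rewrite ler_wpM2l ?cabs_ge0 // ler_pM2r ?invr_gt0 // lerDr.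
pose sm (t : R) := Wt t - k%:C - Z t - 2 * x0%:C.
pose pr (t : R) := (A + B - 1)%:C - Z t * (Wt t - k%:C - Z t) - x0%:C * (Wt t - k%:C - Z t) + x0%:C ^+ 2.
pose f (t : R) := 2 * Re (pr t) + (cabs (sm t) ^+ 2 - cabs (sm t ^+ 2 - 4 * pr t)) / 2.
have fE s u1 v1 : triple (Wt s) (Z s) u1 v1 -> f s = 4 * ((Re u1 - x0) * (Re v1 - x0)).
  move=> t1; have [hA hB] := triple_AB t1; case: (t1) => _ _ eW.
  have -> : (Re u1 - x0) * (Re v1 - x0) = Re (u1 - x0%:C) * Re (v1 - x0%:C) by rewrite !cReD !cReN.
  rewrite -Re_mul_sym /f.
  have -> : sm s = (u1 - x0%:C) + (v1 - x0%:C) by rewrite /sm eW; ring.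
  have -> : pr s = (u1 - x0%:C) * (v1 - x0%:C).
    by rewrite /pr eW rmorphB rmorphD /= hA hB; field.
  by [].
have Ncut x : NN x <= 0 -> Re x - x0 != 0.
  by rewrite subr_eq0; apply: contraTneq => /NN_x0; rewrite ltNge.
have fn0 s : f s != 0.
  have [u1 [v1 [t1 [N1 _]]]] := hZ s; rewrite (fE _ _ _ t1) !mulf_neq0 ?pnatr_eq0 // Ncut //.
    exact: triple_NN t1 N1.
  exact: triple_NN (triple_swap t1) N1.
(* At the start the product of the two shifted roots is [NN x0 / (x0 ^+ 2 - 1)], a negative real
   number, and [f 0] is four times it. *)
have f0 : f 0 < 0.
  have [u1 [v1 [t1 [_ e1]]]] := hZ 0; rewrite e1 // in t1.
  have : Z 0 = x0%:C by apply: e1.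
  move=> eZ; have := triple_Psi t1; rewrite Psi_real => ePsi.
  have ep : pr 0 = (NN x0%:C / (x0 ^+ 2 - 1))%:C.
    have [hA hB] := triple_AB t1; case: (t1) => _ _ eW.
    have -> : pr 0 = (x0%:C - u1) * (x0%:C - v1).
      by rewrite /pr eW eZ rmorphB rmorphD /= hA hB; field.
    have e2 : x0%:C ^+ 2 - 1 = (x0 ^+ 2 - 1)%:C by rewrite rmorphB rmorphXn /= rmorph1.
    have n2 : (x0 ^+ 2 - 1)%:C != 0 by rewrite fmorph_eq0 lt_eqF.
    rewrite e2 in ePsi; apply: (mulfI n2); rewrite -ePsi -rmorphM /=.
    by rewrite mulrC divfK // lt_eqF.
  have p0 : NN x0%:C / (x0 ^+ 2 - 1) < 0 by rewrite nmulr_llt0 // invr_lt0.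
  have es : sm 0 = (W0r - k - x0 - 2 * x0)%:C.
    by rewrite /sm eZ /Wt expr0n mul0r addr0 !rmorphB !rmorphM /= !rmorph_nat.
  rewrite /f ep es; set p := _ / _ in p0 *; set s := W0r - _ - _ - _.
  have -> : s%:C ^+ 2 - 4 * p%:C = (s ^+ 2 - 4 * p)%:C.
    by apply: complex_ext; rewrite !expr2 ?(cReD, cImD, cReN, cImN, cReM, cImM) /=; ring.
  rewrite !cabsR real_normK ?num_real // ger0_norm /=; last by have := sqr_ge0 s; lra.
  lra.
have cf : continuous f.
  pose g w := 2 * (Re (pr (Re w)))%:C + ((cabs (sm (Re w)))%:C ^+ 2
      - (cabs (sm (Re w) ^+ 2 - 4 * pr (Re w)))%:C) / 2.
  have cWt z1 : ccont (fun w => Wt (Re w)) z1.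
    apply: ccontD (ccont_cst _ _) _; apply: ccontM _ (ccont_cst _ _).
    by apply: (@ccont_real (fun t => t ^+ 2)) => // x; exact: exprn_continuous.
  have cd z1 : ccont (fun w => Wt (Re w) - k%:C - Z (Re w)) z1.
    exact: ccontB (ccontB (cWt z1) (ccont_cst _ _)) (cZ z1).
  have cs z1 : ccont (fun w => sm (Re w)) z1 by exact: ccontB (cd z1) (ccont_cst _ _).
  have cp z1 : ccont (fun w => pr (Re w)) z1.
    exact: ccontD (ccontB (ccontB (ccont_cst _ _) (ccontM (cZ z1) (cd z1)))
      (ccontM (ccont_cst _ _) (cd z1))) (ccont_cst _ _).
  have cg z1 : ccont g z1.
    apply: ccontD; first exact: ccontM (ccont_cst _ _) (ccont_ReC (cp z1)).
    apply: ccontM _ (ccont_cst _ _); apply: ccontB.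
      exact: ccontM (ccont_cabs (cs z1)) (ccont_cabs (cs z1)).
    apply: ccont_cabs; apply: ccontB; first exact: ccontM (cs z1) (cs z1).
    exact: ccontM (ccont_cst _ _) (cp z1).
  have c1 : cabs (1 : R[i]) <= 1 by rewrite cabs1.
  have [h _] := @rcont_line _ g 0 1 c1 (fun t => cg _).
  have -> : f = @complex.Re R \o (fun t => g (0 + 1 * t%:C)); last exact: h.
  have eg s : g s%:C = (f s)%:C.
    rewrite /g /f /=; move: (Re _) (cabs _) (cabs _) => p1 p2 p3.
    have h2 : (2 : R[i])^-1 = (2^-1 : R)%:C by rewrite fmorphV /= rmorph_nat.
    by rewrite h2; apply: complex_ext; rewrite expr2 ?(cReD, cImD, cReN, cImN, cReM, cImM) /=; field.
  by apply/funext => s; change (f s = Re (g (0 + 1 * s%:C))); rewrite add0r mul1r eg.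
have f1 : f 1 < 0.
  rewrite ltNge; apply/negP => f10.
  have [||s _ /eqP] := @IVT R f 0 1 0 ler01; first exact: continuous_subspaceT.
    by rewrite ge_min le_max (ltW f0) f10 orbT.
  by rewrite (negPf (fn0 s)).
have Wt1 : Wt 1 = W by rewrite /Wt expr1n mul1r addrC subrK.
have [u1 [v1 [t1 [N1 _]]]] := hZ 1.
have t1' := t1; rewrite Wt1 in t1'.
have eZ : Z 1 = z.
  by case: (root_triple t (triple_root t1')) => e //; exfalso; move: N1; rewrite e ltNge => /negP;
    apply; [exact: triple_NN t Nz | exact: triple_NN (triple_swap t) Nz].
have t' : triple (Wt 1) (Z 1) u v by rewrite Wt1 eZ.
by move: f1; rewrite (fE _ _ _ t') pmulr_rlt0.
Qed.

End Pieces.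

(** * The six closed pieces and the root in each of them *)

Section Sides.
Context {R : realType} (K : config R).
Local Notation k := (g_k K). Local Notation A := (g_A K). Local Notation B := (g_B K).
Local Notation al := (g_al K). Local Notation a := (g_a K). Local Notation c := (g_c K).
Local Notation be := (g_be K). Local Notation b := (g_b K).
Implicit Types (z u v W : R[i]) (s : sheet) (up : bool).
Local Notation x0 := (x0 K).
Local Notation cnum := (cnum K).
Local Notation NN := (NN K).
Local Notation triple := (triple K).

Definition hplane up z : Prop := if up then 0 <= Im z else Im z <= 0.

(* Closed piece of the z-plane mapped onto the closed half-plane [hplane up] of sheet [s]. *)
Definition Kset s up z : Prop :=
  match s with
  | S1 => 0 <= NN z /\ hplane up z
  | S0 => [/\ NN z <= 0, hplane (~~ up) z & Re z <= x0]
  | S2 => [/\ NN z <= 0, hplane (~~ up) z & x0 <= Re z]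
  end.

Definition Kbar s up (p : Cbar R) : Prop :=
  match p with Some z => Kset s up z | None => s = S1 end.

Definition nump : {poly R[i]} :=
  ('X + k%:C%:P) * ('X^2 - 1) + A%:C *: (1 + 'X) - B%:C *: (1 - 'X).
Definition denp : {poly R[i]} := c%:C *: ('X^2 - 1).

Lemma nump_eval z : nump.[z] = cnum z.
Proof. by rewrite /nump /cnum !hornerE /=; ring. Qed.

Lemma denp_eval z : denp.[z] = c%:C * (z ^+ 2 - 1).
Proof. by rewrite /denp !hornerE. Qed.

Lemma cC_neq0 : c%:C != 0 :> R[i].
Proof. by rewrite fmorph_eq0 gt_eqF // g_c0. Qed.

Lemma size_denp : size denp = 3%N.
Proof.
rewrite size_scale ?cC_neq0 // size_addl ?size_polyXn // size_opp.
exact: leq_ltn_trans (size_polyC_leq1 _) _.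
Qed.

Lemma size_nump : size nump = 4%N.
Proof.
have s1 : size (('X + k%:C%:P) * ('X^2 - 1) : {poly R[i]}) = 4%N.
  rewrite size_monicM ?monicXaddC //.
    rewrite size_XaddC size_addl ?size_polyXn //= size_opp.
    exact: leq_ltn_trans (size_polyC_leq1 _) _.
  by rewrite -size_poly_gt0 size_addl ?size_polyXn // size_opp; exact: leq_ltn_trans (size_polyC_leq1 _) _.
have s2 (d : R[i]) (p : {poly R[i]}) : (size p <= 2)%N -> (size (d *: p)%R < 4)%N.
  by move=> h; apply: leq_ltn_trans (size_scale_leq _ _) _; exact: leq_ltn_trans h _.
have sX1 : (size (1 + 'X : {poly R[i]})%R <= 2)%N by rewrite addrC size_XaddC.
have sX2 : (size (1 - 'X : {poly R[i]})%R <= 2)%N.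
  by rewrite -size_opp opprB size_XsubC.
rewrite /nump -addrA size_addl ?s1 //; apply: leq_ltn_trans (size_polyD _ _) _.
by rewrite gtn_max size_opp !s2.
Qed.

Lemma coprime_nd : coprimep nump denp.
Proof.
rewrite /coprimep; apply/negPn/negP => /closed_rootP[z].
rewrite root_gcd /root nump_eval denp_eval mulf_eq0 (negPf cC_neq0) /= => /andP[/eqP h1 h2].
have := @zz1_neq0 _ K 0 z; rewrite h1 mul0r => /(_ erefl); by rewrite h2.
Qed.

Definition GG : Cbar R -> Cbar R := ratC nump denp.

Lemma GG_holo p : holo_at GG p. Proof. exact: ratC_holo coprime_nd. Qed.

Lemma GG_scont p : scont GG p. Proof. exact: holo_scont (GG_holo p). Qed.

Lemma GG_inf : GG None = None.
Proof. by rewrite /GG /ratC size_nump size_denp. Qed.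

Lemma GG_fin z W : GG (Some z) = Some W <-> cnum z = (c%:C * W) * (z ^+ 2 - 1).
Proof.
rewrite /GG ratC_quot /quot nump_eval denp_eval mulf_eq0 (negPf cC_neq0) /=.
split=> [|h].
  case: eqP => // /eqP h [<-]; field; by rewrite h cC_neq0.
rewrite (negPf (zz1_neq0 h)) h; congr Some; field.
by rewrite (zz1_neq0 h) cC_neq0.
Qed.

Lemma GG_pole z : GG (Some z) = None <-> z = 1 \/ z = -1.
Proof.
rewrite /GG ratC_quot /quot denp_eval mulf_eq0 (negPf cC_neq0) /=.
have -> : z ^+ 2 - 1 = (z - 1) * (z + 1) by ring.
rewrite mulf_eq0 subr_eq0 addr_eq0; case: (eqVneq z 1) => [->|h1] /=; first by split=> // _; left.
by case: (eqVneq z (-1)) => [->|h2] /=; split=> //; [right | case=> /eqP; rewrite ?(negPf h1) ?(negPf h2)].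
Qed.

Lemma ccont_NN z : ccont (fun w => (NN w)%:C) z.
Proof.
have cR (w : R[i]) : ccont (fun w => (Re w)%:C) w by exact: ccont_ReC (ccont_id w).
pose m (w : R[i]) := (1 - w) * (conjc (1 - w)).
have mE w : (msq w)%:C = (cabs (1 - w))%:C ^+ 2 by rewrite msq_cabs rmorphXn.
have nE w : (nsq w)%:C = (cabs (1 + w))%:C ^+ 2 by rewrite nsq_cabs rmorphXn.
have cm : ccont (fun w => (cabs (1 - w))%:C ^+ 2) z.
  have h := ccont_cabs (ccontB (ccont_cst 1 z) (ccont_id z)); exact: (ccontM h h).
have cn : ccont (fun w => (cabs (1 + w))%:C ^+ 2) z.
  have h := ccont_cabs (ccontD (ccont_cst 1 z) (ccont_id z)); exact: (ccontM h h).
apply: (@ccont_eqnear _ (fun w => (cabs (1 - w))%:C ^+ 2 * (cabs (1 + w))%:C ^+ 2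
   - A%:C * (cabs (1 + w))%:C ^+ 2 - B%:C * (cabs (1 - w))%:C ^+ 2)).
  by apply: filterE => w; rewrite /NN !rmorphB !rmorphM /= mE nE.
exact: ccontB (ccontB (ccontM cm cn) (ccontM (ccont_cst _ z) cn)) (ccontM (ccont_cst _ z) cm).
Qed.

Lemma near_pos (g : R[i] -> R) z : ccont (fun w => (g w)%:C) z -> 0 < g z ->
  exists2 d : R, 0 < d & forall w, cabs (w - z) < d -> 0 < g w.
Proof.
move=> /ccontP cg g0; have [d d0 hd] := cg _ g0; exists d => // w /hd.
by rewrite -rmorphB cabsR ltr_norml; lra.
Qed.

Lemma NN_large z : 2 * (A + B + 2) < cabs z -> 0 < NN z.
Proof.
move=> hz; have A0 := g_A0 K; have B0 := g_B0 K.
have h1 : A + B + 2 < cabs (1 - z) by have := cabsB_ge z 1; rewrite cabs1 cabsC; lra.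
have h2 : A + B + 2 < cabs (1 + z).
  by have := cabsB_ge z (-1); rewrite cabsN cabs1 opprK [z + 1]addrC; lra.
rewrite /NN msq_cabs nsq_cabs; set m := cabs (1 - z) in h1 *; set n := cabs (1 + z) in h2 *.
have hsq (x : R) : A + B + 2 < x -> A + B + 1 < x ^+ 2.
  by move=> hx; rewrite expr2; have : x * 1 <= x * x; [rewrite ler_pM2l; lra | lra].
have hm := hsq _ h1; have hn := hsq _ h2.
have -> : m ^+ 2 * n ^+ 2 - A * n ^+ 2 - B * m ^+ 2 = (m ^+ 2 - A) * (n ^+ 2 - B) - A * B by ring.
rewrite subr_gt0; apply: lt_le_trans (_ : (B + 1) * (A + 1) <= _); first lra.
by apply: ler_pM; lra.
Qed.

(** Closedness makes limits of roots stay in their piece, and leaves near a point only the pieces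
    that contain it. *)
Lemma Kbar_closed s up p : ~ Kbar s up p -> nb p (fun q => ~ Kbar s up q).
Proof.
have cI z : ccont (fun w => (Im w)%:C) z.
  apply: (@ccont_eqnear _ (fun w => (Re (- Complex 0 1 * w))%:C)).
    by apply: filterE => w; rewrite cReM /=; congr (_%:C); ring.
  exact: ccont_ReC (ccontM (ccont_cst _ z) (ccont_id z)).
have cR z : ccont (fun w => (Re w)%:C) z by exact: ccont_ReC (ccont_id z).
have neg (g : R[i] -> R) z : ccont (fun w => (g w)%:C) z -> ccont (fun w => (- g w)%:C) z.
  by move=> h; apply: ccont_eqnear (ccontN h); apply: filterE => w; rewrite rmorphN.
have hlf up' z : ~ hplane up' z -> exists2 d : R, 0 < d & forall w, cabs (w - z) < d -> ~ hplane up' w.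
  case: up' => /= /negP; rewrite -ltNge => h.
    have [|d d0 hd] := near_pos (neg _ _ (cI z)) (z := z); first by lra.
    by exists d => // w /hd h1; apply/negP; rewrite -ltNge; lra.
  have [d d0 hd] := near_pos (cI z) h.
  by exists d => // w /hd h1; apply/negP; rewrite -ltNge.
have Kh s' w : Kset s' up w -> hplane (if s' is S1 then up else ~~ up) w.
  by case: s' => [[_ h _]|[_ h]|[_ h _]].
case: p => [z|] hp; last first.
  apply/nb_inf; split=> //; exists (2 * (A + B + 2)) => w /NN_large hN.
  by case: s hp => //= _ [h _ _]; move: hN; rewrite ltNge h.
apply/nb_fin.
have pos (g : R[i] -> R) : ccont (fun w => (g w)%:C) z -> 0 < g z ->
    (forall w, 0 < g w -> ~ Kset s up w) ->
    exists2 d : R, 0 < d & forall w, cabs (w - z) < d -> ~ Kbar s up (Some w).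
  by move=> cg g0 hg; have [d d0 hd] := near_pos cg g0; exists d => // w /hd /hg.
case: (pselect (hplane (if s is S1 then up else ~~ up) z)) => [hh|/hlf[d d0 hd]]; last first.
  by exists d => // w /hd hN /Kh.
case: s hp hh pos => /= hp hh pos.
- case: (ltP 0 (NN z)) => hN.
    by apply: (pos NN (ccont_NN z) hN) => w h [h1 _ _]; move: h; rewrite ltNge h1.
  apply: (pos (fun w => Re w - x0)).
  - apply: (@ccont_eqnear _ (fun w => (Re w)%:C - x0%:C)); first by apply: filterE => w; rewrite rmorphB.
    exact: ccontB (cR z) (ccont_cst _ z).
  - by rewrite ltNge; apply/negP => h; apply: hp; split=> //; lra.
  - by move=> w h [_ _ h1]; lra.
- apply: (pos (fun w => - NN w) (neg _ _ (ccont_NN z))).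
    by rewrite ltNge; apply/negP => h; apply: hp; split=> //; lra.
  by move=> w h [h1 _]; lra.
- case: (ltP 0 (NN z)) => hN.
    by apply: (pos NN (ccont_NN z) hN) => w h [h1 _ _]; move: h; rewrite ltNge h1.
  apply: (pos (fun w => x0 - Re w)).
  - apply: (@ccont_eqnear _ (fun w => x0%:C - (Re w)%:C)); first by apply: filterE => w; rewrite rmorphB.
    exact: ccontB (ccont_cst _ z) (cR z).
  - by rewrite ltNge; apply/negP => h; apply: hp; split=> //; lra.
  - by move=> w h [_ _ h1]; lra.
Qed.

Lemma upper_side W : 0 < Im W -> exists z u v, triple W z u v /\
  [/\ Kset S1 true z, Kset S0 true u & Kset S2 true v].
Proof.
move=> W0; have [z [u [v [t [[h1 h2] [h3 h4] [h5 h6]]]]]] := upper_triple K W0.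
have := upper_sides W0 t h2.
case: (ltP (Re u) x0) => hu hs.
  have hv : x0 < Re v by move: hs; rewrite nmulr_rlt0 ?subr_lt0 // subr_gt0.
  exists z, u, v; split=> //.
  by split; [split; exact: ltW | split; exact: ltW | split; exact: ltW].
exists z, v, u; split; first exact: triple_swap.
have hv : Re v < x0.
  rewrite ltNge; apply/negP => hv; move: hs; rewrite ltNge => /negP; apply.
  by rewrite mulr_ge0 // subr_ge0.
by split; [split; exact: ltW | split; exact: ltW | split=> //; exact: ltW].
Qed.

(** A real [W] is approached from above: the roots for [Wn n] converge along an ultrafilter. They
    cannot tend to infinity, since [GG] is continuous with value infinity there while [Wn n] has a
    finite limit. *)
Lemma triple_side_up W : 0 <= Im W -> exists z u v, triple W z u v /\
  [/\ Kset S1 true z, Kset S0 true u & Kset S2 true v].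
Proof.
rewrite le_eqVlt => /orP[/eqP W0|]; last exact: upper_side.
pose Wn (n : nat) := W + Complex 0 n.+1%:R^-1.
have ex n : exists T : R[i] * R[i] * R[i], triple (Wn n) T.1.1 T.1.2 T.2 /\
    [/\ Kset S1 true T.1.1, Kset S0 true T.1.2 & Kset S2 true T.2].
  have [|z [u [v h]]] := @upper_side (Wn n); last by exists (z, u, v).
  by rewrite cImD /= -W0 add0r invr_gt0 ltr0Sn.
have [T hT] := choice ex.
have [U UU hU] := @nat_ultra R.
have hW P : nb (Some (W / c%:C)) P -> U [set n | P (Some (Wn n / c%:C))]%classic.
  move=> /nb_fin[d d0 hd].
  apply: filterS (hU (d * c) (mulr_gt0 d0 (g_c0 K))) => n /= hn; apply: hd.
  rewrite -mulrBl /Wn addrAC subrr add0r cabsf_div cabsR gtr0_norm ?g_c0 //.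
  rewrite ltr_pdivrMr ?g_c0 // /cabs /= expr0n add0r sqrtr_sqr ger0_norm //.
have lim (Z : nat -> R[i]) s : (forall n, cnum (Z n) = Wn n * (Z n ^+ 2 - 1)) ->
    (forall n, Kset s true (Z n)) -> exists2 z, Kset s true z &
      ((fun n => (Z n : R[i]^o)) @ U --> (z : R[i]^o))%classic.
  move=> rZ kZ; have [p hp] := ultra_lim (fun n => Some (Z n)) UU.
  have Gp : GG p = Some (W / c%:C).
    apply: (@ultra_unique _ _ U (fun n => Some (Wn n / c%:C))) => // P hP.
    apply: filterS (hp _ (GG_scont hP)) => n h; change (P (Some (Wn n / c%:C))).
    rewrite (_ : Some _ = GG (Some (Z n))); first exact: h.
    by apply/esym/GG_fin; rewrite rZ; congr (_ * _); rewrite mulrCA divff ?mulr1 // cC_neq0.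
  have kp : Kbar s true p.
    apply: (ultra_closed UU hp (@Kbar_closed s true)); apply: filterE => n; exact: kZ.
  case: p hp Gp kp => [z|] hp Gp kp; last by rewrite GG_inf in Gp.
  exists z => //; move=> P /near_cabs[d d0 hd].
  apply: (hp (fun q => if q is Some w then P w else False)).
  by apply/nb_fin; exists d.
have tT n := (hT n).1.
have r1 n := triple_root (tT n).
have r2 n := triple_root (triple_rot (tT n)).
have r3 n := triple_root (triple_rot (triple_rot (tT n))).
have [z kz cz] := lim _ S1 r1 (fun n => let: conj _ (And3 h _ _) := hT n in h).
have [u ku cu] := lim _ S0 r2 (fun n => let: conj _ (And3 _ h _) := hT n in h).
have [v kv cv] := lim _ S2 r3 (fun n => let: conj _ (And3 _ _ h) := hT n in h).
exists z, u, v; split; last by split.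
have hsd : hausdorff_space (R[i]^o) by exact: norm_hausdorff.
have c1 (x : R[i]) : ((fun n : nat => (x : R[i]^o)) @ U --> (x : R[i]^o))%classic by exact: cvg_cst.
have cW : ((fun n => (Wn n : R[i]^o)) @ U --> (W : R[i]^o))%classic.
  move=> P /near_cabs[d d0 hd]; change (U [set n | P (Wn n)]%classic).
  apply: filterS (hU d d0) => n hn; apply: hd.
  have e : cabs (Wn n - W) = n.+1%:R^-1.
    by rewrite /Wn addrAC subrr add0r /cabs /= expr0n add0r sqrtr_sqr ger0_norm.
  by rewrite e; exact: hn.
have lim0 (F H : nat -> R[i]) (x y : R[i]) : (forall n, F n = H n) ->
    ((fun n => (F n : R[i]^o)) @ U --> (x : R[i]^o))%classic ->
    ((fun n => (H n : R[i]^o)) @ U --> (y : R[i]^o))%classic -> x = y.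
  by move=> /funext -> h1 h2; exact: (cvg_unique hsd h1 h2).
split.
- apply: (lim0 _ (fun n => (1 - (T n).1.1) * (1 - (T n).1.2) * (1 - (T n).2)) _ _ _ (c1 _)).
    by move=> n; have [-> _ _] := tT n.
  exact: (cvgM (cvgM (cvgB (c1 1) cz) (cvgB (c1 1) cu)) (cvgB (c1 1) cv)).
- apply: (lim0 _ (fun n => (1 + (T n).1.1) * (1 + (T n).1.2) * (1 + (T n).2)) _ _ _ (c1 _)).
    by move=> n; have [_ -> _] := tT n.
  exact: (cvgM (cvgM (cvgD (c1 1) cz) (cvgD (c1 1) cu)) (cvgD (c1 1) cv)).
- apply: (lim0 _ (fun n => k%:C + (T n).1.1 + (T n).1.2 + (T n).2) _ _ _ cW).
    by move=> n; have [_ _ ->] := tT n.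
  exact: (cvgD (cvgD (cvgD (c1 k%:C) cz) cu) cv).
Qed.

Lemma NN_conj z : NN (conjc z) = NN z.
Proof. by case: z => x y; rewrite /NN /msq /nsq /= !sqrrN. Qed.

Lemma hplane_conj up z : hplane up (conjc z) <-> hplane (~~ up) z.
Proof. by case: z => x y; case: up; rewrite /hplane /= ?oppr_ge0 ?oppr_le0. Qed.

Lemma Kset_conj s up z : Kset s up (conjc z) <-> Kset s (~~ up) z.
Proof.
have Rz : Re (conjc z) = Re z by case: z.
case: s; rewrite /= NN_conj ?Rz.
- by split=> -[h1 /hplane_conj h2 h3].
- by split=> -[h1 /hplane_conj h2].
- by split=> -[h1 /hplane_conj h2 h3].
Qed.

Lemma triple_conj W z u v : triple W z u v -> triple (conjc W) (conjc z) (conjc u) (conjc v).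
Proof.
have cM (x y : R[i]) : (conjc (x * y)) = (conjc x) * (conjc y) by rewrite rmorphM.
have cD (x y : R[i]) : (conjc (x + y)) = (conjc x) + (conjc y) by rewrite rmorphD.
have cB (x y : R[i]) : (conjc (x - y)) = (conjc x) - (conjc y) by rewrite rmorphB.
case=> h1 h2 ->; split; last by rewrite !cD conjc_real.
- by have := congr1 conjc h1; rewrite conjc_real => ->; rewrite !cM !cB conjc1.
- by have := congr1 conjc h2; rewrite conjc_real => ->; rewrite !cM !cD conjc1.
Qed.

Lemma triple_side up W : hplane up W -> exists z u v, triple W z u v /\
  [/\ Kset S1 up z, Kset S0 up u & Kset S2 up v].
Proof.
case: up => /= hW; first exact: triple_side_up.
have [|z [u [v [t [h1 h2 h3]]]]] := @triple_side_up (conjc W); first by case: W hW => x y /=; rewrite oppr_ge0.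
exists (conjc z), (conjc u), (conjc v); split; first by rewrite -[W]conjcK; exact: triple_conj.
split; [exact: (proj2 (Kset_conj S1 false z) h1) | exact: (proj2 (Kset_conj S0 false u) h2) |
  exact: (proj2 (Kset_conj S2 false v) h3)].
Qed.

(** The two pieces lie in opposite half-planes and on opposite sides of [NN = 0], so a common point
    is a real critical point. *)
Lemma Kset01 up z : Kset S0 up z -> Kset S1 up z -> Psi K z z = 0.
Proof.
case=> h1 h2 _ [h3 h4]; have N0 : NN z = 0 by apply/eqP; rewrite eq_le h1 h3.
have z0 : z = (Re z)%:C.
  by apply: complex_ext => //=; case: up h2 h4; rewrite /hplane /= => h2 h4; lra.
by rewrite z0 Psi_real -z0 N0.
Qed.

Lemma Kset21 up z : Kset S2 up z -> Kset S1 up z -> Psi K z z = 0.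
Proof.
case=> h1 h2 _ [h3 h4]; have N0 : NN z = 0 by apply/eqP; rewrite eq_le h1 h3.
have z0 : z = (Re z)%:C.
  by apply: complex_ext => //=; case: up h2 h4; rewrite /hplane /= => h2 h4; lra.
by rewrite z0 Psi_real -z0 N0.
Qed.

Lemma Kset02 up up' z : Kset S0 up z -> Kset S2 up' z -> False.
Proof.
case=> h1 _ h2 [_ _ h3]; have : 0 < NN z by apply: NN_x0; apply/eqP; rewrite eq_le h2 h3.
by rewrite ltNge h1.
Qed.

(** A root in two of the pieces is a critical point, hence a double root, by [Kset01] and [Kset21],
    while [Kset02] keeps the outer pieces disjoint. So a root is identified by its piece, on the
    boundary as well. *)
Lemma triple_Kset up W z u v x : triple W z u v ->
  Kset S1 up z -> Kset S0 up u -> Kset S2 up v -> cnum x = W * (x ^+ 2 - 1) ->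
  [/\ Kset S1 up x -> x = z, Kset S0 up x -> x = u & Kset S2 up x -> x = v].
Proof.
move=> t kz ku kv rx.
have dbl z1 u1 v1 : triple W z1 u1 v1 -> Psi K z1 z1 = 0 -> z1 = u1 \/ z1 = v1.
  move=> t1; rewrite (triple_Psi t1) => /eqP.
  rewrite mulf_eq0 (negPf (zz1_neq0 (triple_root t1))) /= mulf_eq0 !subr_eq0.
  by move=> /orP[] /eqP; [left|right].
have tu := triple_rot t; have tv := triple_rot tu.
case: (root_triple t rx) => ->; split=> // kx.
- by have [//|e] := dbl _ _ _ t (Kset01 kx kz); rewrite e in kx; case: (Kset02 kx kv).
- by have [e|//] := dbl _ _ _ t (Kset21 kx kz); rewrite e in kx; case: (Kset02 ku kx).
- by have [e|//] := dbl _ _ _ tu (Kset01 ku kx); rewrite -e in kv; case: (Kset02 ku kv).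
- by case: (Kset02 ku kx).
- by have [//|e] := dbl _ _ _ tv (Kset21 kv kx); rewrite e in kv; case: (Kset02 ku kv).
- by case: (Kset02 kx kv).
Qed.

End Sides.
Arguments GG {R} K p : simpl never.

(** * Roots over the real line and over the left cut *)

Section LeftCut.
Context {R : realType} (K : config R).
Local Notation k := (g_k K). Local Notation A := (g_A K). Local Notation B := (g_B K).
Local Notation al := (g_al K). Local Notation a := (g_a K). Local Notation c := (g_c K).
Local Notation be := (g_be K). Local Notation b := (g_b K).
Local Notation lam := (g_lam K). Local Notation mu := (g_mu K).
Implicit Types (z u v W : R[i]) (s : sheet) (up : bool).
Local Notation x0 := (x0 K).
Local Notation cnum := (cnum K).
Local Notation NN := (NN K).
Local Notation triple := (triple K).
Local Notation Kset := (Kset K).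

Lemma real_of_Im z : Im z = 0 -> z = (Re z)%:C.
Proof. by move=> h; apply: complex_ext. Qed.

Lemma NN_Re z : Im z = 0 -> NN z = (Re z - be) * (Re z - al) * (Re z - a) * (Re z - b).
Proof. by move=> /real_of_Im {1}->; exact: NN_real. Qed.

Lemma Kset0_real up z : Kset S0 up z -> Im z = 0 -> be <= Re z <= al.
Proof.
case=> h1 _ h2 z0; rewrite NN_Re // in h1; have := x0_bounds K.
have := g_be1 K; have := g_al1 K; have := g_a1 K; have := g_b1 K.
move: (Re z) h1 h2 => x h1 h2 *.
have h3 : 0 < (x - a) * (x - b) by rewrite nmulr_lgt0; lra.
rewrite -mulrA pmulr_lle0 // in h1.
apply/andP; split; rewrite leNgt; apply/negP => h4.
  rewrite nmulr_rle0 in h1; lra.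
rewrite pmulr_lle0 in h1; lra.
Qed.

Lemma Kset2_real up z : Kset S2 up z -> Im z = 0 -> a <= Re z <= b.
Proof.
case=> h1 _ h2 z0; rewrite NN_Re // in h1; have := x0_bounds K.
have := g_be1 K; have := g_al1 K; have := g_a1 K; have := g_b1 K.
move: (Re z) h1 h2 => x h1 h2 *.
have h3 : 0 < (x - be) * (x - al) by rewrite mulr_gt0; lra.
rewrite -mulrA pmulr_rle0 // in h1.
apply/andP; split; rewrite leNgt; apply/negP => h4.
  rewrite nmulr_rle0 in h1; lra.
rewrite pmulr_lle0 in h1; lra.
Qed.

Lemma real_root W z : Im W = 0 -> cnum z = W * (z ^+ 2 - 1) -> Im z != 0 -> NN z = 0.
Proof.
move=> W0 /Im_root; rewrite W0 mul0r => /esym/eqP.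
by rewrite mulf_eq0 => /orP[->//|/eqP].
Qed.

Lemma conj_root W z : Im W = 0 -> cnum z = W * (z ^+ 2 - 1) ->
  cnum (conjc z) = W * ((conjc z) ^+ 2 - 1).
Proof.
move=> /real_of_Im -> h; have := congr1 conjc h.
by rewrite /cnum !expr2; case: z {h} => x y [e1 e2]; apply: complex_ext;
  rewrite ?(cReD, cImD, cReN, cImN, cReM, cImM) /=; lra.
Qed.

Lemma crit_val (f t : R) : (f, t) \in [:: (- (mu * c), be); (- c, al); (c, a); (lam * c, b)] ->
  cnum t%:C = f%:C * (t%:C ^+ 2 - 1) /\
  forall W z u v, triple W z u v -> ((f%:C - W) * (t%:C ^+ 2 - 1) = (t%:C - z) * (t%:C - u) * (t%:C - v)).
Proof.
move=> /(@g_crit _ K) h.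
have e : cnum t%:C = f%:C * (t%:C ^+ 2 - 1).
  have := congr1 (real_complex R) h; rewrite /cnum /= => e.
  apply: complex_ext; rewrite !expr2 ?(cReD, cImD, cReN, cImN, cReM, cImM) /=; last ring.
  by move: h; rewrite !expr2; lra.
by split=> // W z u v tr; rewrite -(triple_num _ tr) e; ring.
Qed.

Lemma mulJ (t : R) z : (t%:C - z) * (t%:C - conjc z) = ((t - Re z) ^+ 2 + Im z ^+ 2)%:C.
Proof. by case: z => x y; apply: complex_ext; rewrite !expr2 ?(cReD, cImD, cReN, cImN, cReM, cImM) /=; ring. Qed.

Lemma real_prod (x y : R) (e1 e2 : R) : x%:C * y%:C = e1%:C * e2%:C -> x * y = e1 * e2.
Proof. by rewrite -!rmorphM; exact: complexI. Qed.

Lemma sqC1 (t : R) : t%:C ^+ 2 - 1 = (t ^+ 2 - 1)%:C :> R[i].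
Proof. by rewrite rmorphB rmorphXn /= rmorph1. Qed.

Lemma al_be_sq : al ^+ 2 - 1 < 0 /\ 0 < be ^+ 2 - 1.
Proof.
have h1 := g_be1 K; have h2 := g_al1 K; have h3 := g_al_a K; have h4 := g_a1 K; split.
  have -> : al ^+ 2 - 1 = (al - 1) * (al + 1) by ring.
  by rewrite nmulr_rlt0; lra.
have -> : be ^+ 2 - 1 = (be - 1) * (be + 1) by ring.
by rewrite nmulr_rgt0; lra.
Qed.

Lemma triple_Im W z u v : triple W z u v -> Im W = Im z + Im u + Im v.
Proof. by case=> _ _ ->; rewrite !cImD /= add0r. Qed.

(** Here [W] is real, so [conjc z] is a root too and the third root [v] is real and at least [a]. At
    [x = be] and [x = al] the factorization |x - z|^2 (x - v) is negative, which gives the two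
    bounds. *)
Lemma left_curve W z : NN z = 0 -> Re z < x0 -> Im z != 0 -> cnum z = W * (z ^+ 2 - 1) ->
  Im W = 0 /\ - (mu * c) < Re W < - c.
Proof.
move=> N0 zx z0 rz.
have W0 : Im W = 0.
  have := Im_root rz; rewrite N0 mulr0 => /eqP; rewrite mulf_eq0 => /orP[/eqP//|].
  by rewrite mulf_eq0 !gt_eqF ?msq_gt0 ?nsq_gt0 ?(zz1_neq0 rz).
split=> //; have WR := real_of_Im W0.
pose up := 0 < Im z.
have hz : hplane up z.
  by rewrite /up /hplane; case: ltP => // h; exact: ltW.
have kz : Kset S1 up z by split; rewrite ?N0.
have kzc : Kset S0 up (conjc z).
  by apply/Kset_conj; split; rewrite ?N0 ?negbK // ltW.
have [|z1 [u [v [t [k1 k2 k3]]]]] := @triple_side _ K up W.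
  by rewrite /hplane W0; case: ifP.
have [/(_ kz) e1 _ _] := triple_Kset t k1 k2 k3 rz.
have [_ /(_ kzc) e2 _] := triple_Kset t k1 k2 k3 (conj_root W0 rz).
rewrite -{}e1 -{}e2 in t.
have v0 : Im v = 0.
  by have := triple_Im t; rewrite W0; case: (z) => x y /=; rewrite subrr add0r.
have /andP[va vb] := Kset2_real k3 v0.
have key (f x : R) : (f, x) \in [:: (- (mu * c), be); (- c, al); (c, a); (lam * c, b)] ->
    (f - Re W) * (x ^+ 2 - 1) = ((x - Re z) ^+ 2 + Im z ^+ 2) * (x - Re v).
  move=> /crit_val[_ /(_ _ _ _ _ t)]; rewrite mulJ sqC1 {1}WR (real_of_Im v0) -!rmorphB /=.
  exact: real_prod.
have pos (x : R) : 0 < (x - Re z) ^+ 2 + Im z ^+ 2.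
  by rewrite ltr_wpDl ?sqr_ge0 // exprn_even_gt0.
have [sal sbe] := al_be_sq; have b1 := g_be1 K; have b2 := g_al1 K; have b3 := g_al_a K.
apply/andP; split.
  have := key (- (mu * c)) be; rewrite !inE eqxx => /(_ isT) e.
  have : (- (mu * c) - Re W) * (be ^+ 2 - 1) < 0 by rewrite e pmulr_rlt0 //; lra.
  by rewrite pmulr_llt0 //; lra.
have := key (- c) al; rewrite !inE eqxx orbT => /(_ isT) e.
have : (- c - Re W) * (al ^+ 2 - 1) < 0 by rewrite e pmulr_rlt0 //; lra.
by rewrite nmulr_llt0 //; lra.
Qed.

(** If [u] is not real, its conjugate lies in the S1 piece and is therefore [z]. If [u] is real, the
    signs of the factorization at [be] and [al] either place it at one of these points or place [z]
    in the S0 piece, where it equals [u]. *)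
Lemma left_cut up W z u v : triple W z u v -> Kset S1 up z -> Kset S0 up u -> Kset S2 up v ->
  Im W = 0 -> - (mu * c) <= Re W <= - c -> z = conjc u /\ NN u = 0.
Proof.
move=> t kz ku kv W0 /andP[Wm Wc].
have WR := real_of_Im W0.
have tu := triple_rot t; have tv := triple_rot tu.
have TK x (h : cnum x = W * (x ^+ 2 - 1)) := triple_Kset t kz ku kv h.
have [sal sbe] := al_be_sq; have b1 := g_be1 K; have b2 := g_al1 K; have b3 := g_al_a K.
have conj1 x : cnum x = W * (x ^+ 2 - 1) -> hplane (~~ up) x -> Im x != 0 -> conjc x = z.
  move=> rx hx x0'; have N0 := real_root W0 rx x0'.
  have [h _ _] := TK _ (conj_root W0 rx); apply: h; apply/Kset_conj.
  by split; rewrite ?N0.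
have critP (f x : R) : (f, x) \in [:: (- (mu * c), be); (- c, al); (c, a); (lam * c, b)] ->
    (f - Re W)%:C * (x ^+ 2 - 1)%:C = (x%:C - z) * (x%:C - u) * (x%:C - v).
  by move=> /crit_val[_ /(_ _ _ _ _ t)]; rewrite sqC1 {1}WR -rmorphB.
have m1 : (- (mu * c), be) \in [:: (- (mu * c), be); (- c, al); (c, a); (lam * c, b)].
  by rewrite !inE eqxx.
have m2 : (- c, al) \in [:: (- (mu * c), be); (- c, al); (c, a); (lam * c, b)].
  by rewrite !inE eqxx orbT.
have hhu : hplane (~~ up) u by case: ku.
have hhv : hplane (~~ up) v by case: kv.
have edge x : u = x%:C -> (x = be \/ x = al) -> z = conjc u /\ NN u = 0.
  move=> eu ex; have N0 : NN u = 0.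
    by rewrite eu NN_real; case: ex => ->; rewrite subrr ?mul0r ?mulr0 ?mul0r.
  split=> //; have cu : conjc u = u by rewrite eu conjc_real.
  have [h _ _] := TK _ (triple_root tu); rewrite cu; apply/esym/h; split; first by rewrite N0.
  by rewrite eu /hplane /=; case: ifP.
case: (eqVneq (Im u) 0) => [u0|u0]; last first.
  by split; [rewrite (conj1 u) // (triple_root tu) | exact: (real_root W0 (triple_root tu))].
have /andP[ub ua] := Kset0_real ku u0; have uR := real_of_Im u0.
case: (eqVneq (Im v) 0) => [v0|v0]; last first.
  have ez := conj1 v (triple_root tv) hhv v0; have e2 := critP _ _ m2.
  have : (- c - Re W) * (al ^+ 2 - 1) = ((al - Re v) ^+ 2 + Im v ^+ 2) * (al - Re u).
    apply: real_prod; rewrite e2 -ez -mulJ uR -rmorphB /=; ring.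
  have h1 : (- c - Re W) * (al ^+ 2 - 1) <= 0 by rewrite nmulr_lle0 // subr_ge0.
  have h2 : 0 < (al - Re v) ^+ 2 + Im v ^+ 2 by rewrite ltr_wpDl ?sqr_ge0 // exprn_even_gt0.
  move=> h3; move: h1; rewrite h3 pmulr_rle0 // => h4.
  by apply: (edge _ uR); right; lra.
have /andP[va vb] := Kset2_real kv v0; have vR := real_of_Im v0.
have z0 : Im z = 0 by have := triple_Im t; rewrite W0 u0 v0 !addr0.
have zR := real_of_Im z0.
case: (eqVneq (Re u) be) => [ube|ube]; first by apply: (edge _ uR); left.
case: (eqVneq (Re u) al) => [ual|ual]; first by apply: (edge _ uR); right.
have ub' : be < Re u by rewrite lt_neqAle eq_sym ube.
have ua' : Re u < al by rewrite lt_neqAle ual.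
have e1 : (- (mu * c) - Re W) * (be ^+ 2 - 1) = (be - Re z) * ((be - Re u) * (be - Re v)).
  apply: (@complexI R); have := critP _ _ m1; rewrite zR uR vR -!rmorphB -!rmorphM /= => ->.
  by congr (_%:C); ring.
have e2 : (- c - Re W) * (al ^+ 2 - 1) = (al - Re z) * ((al - Re u) * (al - Re v)).
  apply: (@complexI R); have := critP _ _ m2; rewrite zR uR vR -!rmorphB -!rmorphM /= => ->.
  by congr (_%:C); ring.
have h1 : (be - Re z) * ((be - Re u) * (be - Re v)) <= 0.
  by rewrite -e1 pmulr_lle0 //; lra.
have h2 : (al - Re z) * ((al - Re u) * (al - Re v)) <= 0.
  by rewrite -e2 nmulr_lle0 //; lra.
rewrite pmulr_lle0 in h1; last by rewrite nmulr_rgt0; lra.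
rewrite nmulr_lle0 in h2; last by rewrite pmulr_rlt0; lra.
have kz0 : Kset S0 up z.
  split; last by have := x0_bounds K; lra.
    rewrite NN_Re // -mulrA mulr_le0_ge0 //; first by rewrite mulr_ge0_le0; lra.
    by have := g_a1 K; have := g_b1 K => *; rewrite mulr_le0; lra.
  by rewrite /hplane z0; case: ifP.
have [_ h _] := TK _ (triple_root t).
have euz := h kz0; split; first by rewrite euz uR conjc_real.
by have [h3 _] := kz; have [h4 _ _] := kz0; rewrite -euz; apply/eqP; rewrite eq_le h4 h3.
Qed.

End LeftCut.

Section Mirror.
Context {R : realType}.

(* The symmetry [z |-> - z], [W |-> - W] exchanges the two cuts and the sheets S0, S2. *)
Definition mirror (K : config R) : config R.
refine (@Config R (- g_k K) (g_B K) (g_A K) (g_c K) (- g_b K) (- g_a K) (- g_al K) (- g_be K)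
  (g_mu K) (g_lam K) (g_B0 K) (g_A0 K) (g_c0 K) _ _ _ _ _ (g_mu1 K) (g_lam1 K) _ _).
- by rewrite ltrN2 g_b1.
- by rewrite ltrN2 g_a1.
- by rewrite ltrN2 g_al_a.
- by rewrite ltrNl g_al1.
- by rewrite ltrNr g_be1.
- by move=> x; have := g_quart K (- x); rewrite !sqrrN => h; lra.
- move=> v x h; have := @g_crit _ K (- v) (- x); rewrite !sqrrN => h'.
  have {}h' : (- v, - x) \in [:: (- (g_mu K * g_c K), g_be K); (- g_c K, g_al K);
       (g_c K, g_a K); (g_lam K * g_c K, g_b K)] -> (- g_k K + x) * (x ^+ 2 - 1) +
       g_B K * (1 + x) - g_A K * (1 - x) = v * (x ^+ 2 - 1) by move=> /h'; lra.
  apply: h'; move: h; rewrite !inE !xpair_eqE.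
  by rewrite [- v == - _]eqr_opp ![- x == _]eqr_oppLR ![- v == _]eqr_oppLR opprK;
    case/or4P => /andP[-> ->]; rewrite ?orbT.
Defined.

Context (K : config R).
Implicit Types (z u v W : R[i]) (s : sheet) (up : bool).

Definition flip s := match s with S0 => S2 | S1 => S1 | S2 => S0 end.

Lemma NN_mirror z : NN (mirror K) (- z) = NN K z.
Proof. by case: z => x y; rewrite /NN /msq /nsq /=; ring. Qed.

Lemma x0_mirror : x0 (mirror K) = - x0 K.
Proof. by rewrite /x0 /=; ring. Qed.

Lemma cnum_mirror z : cnum (mirror K) (- z) = - cnum K z.
Proof. by rewrite /cnum /= rmorphN; ring. Qed.

Lemma triple_mirror W z u v : triple K W z u v -> triple (mirror K) (- W) (- z) (- u) (- v).
Proof. by case=> h1 h2 ->; split; rewrite /= ?h1 ?h2 ?rmorphN; ring. Qed.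

Lemma hplane_opp up z : hplane (~~ up) (- z) <-> hplane up z.
Proof. by case: up; rewrite /hplane cImN ?oppr_le0 ?oppr_ge0. Qed.

Lemma Kset_mirror s up z : Kset K s up z -> Kset (mirror K) (flip s) (~~ up) (- z).
Proof.
case: s => /=; rewrite NN_mirror ?x0_mirror ?cReN ?lerN2.
- by case=> h1 h2 h3; split=> //; apply/hplane_opp.
- by case=> h1 h2; split=> //; apply/hplane_opp.
- by case=> h1 h2 h3; split=> //; apply/hplane_opp.
Qed.

Lemma right_curve W z : NN K z = 0 -> x0 K < Re z -> Im z != 0 ->
  cnum K z = W * (z ^+ 2 - 1) -> Im W = 0 /\ g_c K < Re W < g_lam K * g_c K.
Proof.
move=> N0 zx z0 rz.
have [|||| h1 h2] := @left_curve _ (mirror K) (- W) (- z).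
- by rewrite NN_mirror.
- by rewrite cReN x0_mirror ltrN2.
- by rewrite cImN oppr_eq0.
- by rewrite cnum_mirror rz sqrrN mulNr.
move: h1 h2; rewrite cImN cReN /= => /eqP; rewrite oppr_eq0 => /eqP -> /andP[h1 h2].
by split=> //; apply/andP; split; lra.
Qed.

Lemma right_cut up W z u v : triple K W z u v -> Kset K S1 up z -> Kset K S0 up u ->
  Kset K S2 up v -> Im W = 0 -> g_c K <= Re W <= g_lam K * g_c K -> z = conjc v /\ NN K v = 0.
Proof.
move=> t /Kset_mirror kz /Kset_mirror ku /Kset_mirror kv W0 hW.
have [||e1 e2] := left_cut (triple_swap (triple_mirror t)) kz kv ku.
- by rewrite cImN W0 oppr0.
- by rewrite cReN /=; lra.
rewrite NN_mirror in e2; split=> //; apply: oppr_inj; rewrite e1.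
by case: (v) => x y.
Qed.

End Mirror.

(** * The parametrization and its dictionary with the half-sheets *)

Section Parametrization.
Context {R : realType} (K : config R).
Local Notation k := (g_k K). Local Notation A := (g_A K). Local Notation B := (g_B K).
Local Notation al := (g_al K). Local Notation a := (g_a K). Local Notation c := (g_c K).
Local Notation be := (g_be K). Local Notation b := (g_b K).
Local Notation lam := (g_lam K). Local Notation mu := (g_mu K).
Implicit Types (z u v W : R[i]) (s : sheet) (up : bool) (p q : Cbar R).
Local Notation x0 := (x0 K).
Local Notation cnum := (cnum K).
Local Notation NN := (NN K).
Local Notation triple := (triple K).
Local Notation Kset := (Kset K).
Local Notation Kbar := (Kbar K).
Local Notation GG := (GG K).

Lemma NN_pole z : z = 1 \/ z = -1 -> NN z < 0 /\ Im z = 0.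
Proof.
have A0 := g_A0 K; have B0 := g_B0 K.
by case=> ->; rewrite /NN /msq /nsq /= ?oppr0 ?expr2; split=> //; lra.
Qed.

Lemma pm1_x0 : -1 < x0 < 1.
Proof. by have := x0_bounds K; have := g_al1 K; have := g_a1 K; lra. Qed.

Lemma Kset_hplane s up W z : Kset s up z -> cnum z = W * (z ^+ 2 - 1) -> hplane up W.
Proof.
move=> kz rz; have e := Im_root rz.
have P : 0 < msq z * nsq z by rewrite mulr_gt0 ?msq_gt0 ?nsq_gt0 ?(zz1_neq0 rz).
rewrite /hplane; case: up kz => kz.
  rewrite -(pmulr_lge0 _ P) e; case: s kz => /=; rewrite /hplane /=.
  - by case=> h1 h2 _; rewrite mulr_le0.
  - by case=> h1 h2; rewrite mulr_ge0.
  - by case=> h1 h2 _; rewrite mulr_le0.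
rewrite -(pmulr_lle0 _ P) e; case: s kz => /=; rewrite /hplane /=.
- by case=> h1 h2 _; rewrite mulr_ge0_le0.
- by case=> h1 h2; rewrite mulr_le0_ge0.
- by case=> h1 h2 _; rewrite mulr_ge0_le0.
Qed.

Lemma hplane_scale up (t : R) W : 0 < t -> hplane up (t%:C * W) <-> hplane up W.
Proof.
by move=> t0; rewrite /hplane cImM /= mul0r addr0; case: up; rewrite ?pmulr_rge0 ?pmulr_rle0.
Qed.

Definition inhalf up p : Prop := if p is Some W then hplane up W else True.

Lemma Kbar_exists s up p : inhalf up p -> exists2 q, Kbar s up q & GG q = p.
Proof.
case: p => [W|_] /=; last first.
  have [h1 h2] := NN_pole (or_introl erefl); have [h3 h4] := NN_pole (or_intror erefl).
  have hx := pm1_x0; case: s.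
  - exists (Some (-1)); last by apply/GG_pole; right.
    by split; [exact: ltW | rewrite /hplane h4 lexx if_same | rewrite /=; lra].
  - by exists None => //; exact: GG_inf.
  - exists (Some 1); last by apply/GG_pole; left.
    by split; [exact: ltW | rewrite /hplane h2 lexx if_same | rewrite /=; lra].
move=> hW; have [|z [u [v [t [k1 k2 k3]]]]] := @triple_side _ K up (c%:C * W).
  by apply/(hplane_scale _ _ (g_c0 K)).
have tu := triple_rot t; have tv := triple_rot tu.
case: s; [exists (Some u) | exists (Some z) | exists (Some v)] => //; apply/GG_fin.
- exact: triple_root tu.
- exact: triple_root t.
- exact: triple_root tv.
Qed.

Lemma Kbar_inj s up p q : Kbar s up p -> Kbar s up q -> GG p = GG q -> p = q.
Proof.
case e : (GG p) => [W|] kp kq /esym e'.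
  case: p kp e => [z|]; last by rewrite GG_inf.
  case: q kq e' => [z'|]; last by rewrite GG_inf.
  move=> /= kz' /GG_fin rz' kz /GG_fin rz.
  have [z1 [u [v [t [k1 k2 k3]]]]] := triple_side K (Kset_hplane kz rz).
  have [h1 h2 h3] := triple_Kset t k1 k2 k3 rz.
  have [h1' h2' h3'] := triple_Kset t k1 k2 k3 rz'.
  by case: s kz kz' => kz kz'; [rewrite (h2 kz) (h2' kz') | rewrite (h1 kz) (h1' kz')
    | rewrite (h3 kz) (h3' kz')].
(* The common value is infinity: each piece contains exactly one of the points -1, 1 and
   infinity. *)
have hx := pm1_x0.
have key r : GG r = None -> Kbar s up r ->
    r = match s with S0 => Some (-1) | S1 => None | S2 => Some 1 end.
  case: r => [z|] /=; last by move=> _ ->.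
  move=> /GG_pole hz; have [h1 h2] := NN_pole hz.
  case: s {kp kq} => /=.
  - by case=> _ _ h3; case: hz h3 => -> //= h3; exfalso; clear e e'; lra.
  - by case=> h3; move: h3; rewrite leNgt h1.
  - by case=> _ _ h3; case: hz h3 => -> //= h3; exfalso; clear e e'; lra.
by rewrite (key p) // (key q).
Qed.

Definition bank z (b1 : bool) : option bool := if Im z == 0 then None else Some b1.

(** A point of the left curve with [Im z < 0] is on the lower bank of S1, that is the upper bank of
    S0; on the right curve [0 < Im z] is the upper bank of S1. Real points of the curves become
    branch points. [GG p] is real on both curves, so its real part loses nothing. *)
Definition gmap p : surf R :=
  match p with
  | None => Reg S1 None
  | Some z =>
      if NN z == 0 then
        if Re z < x0 then Cut1 (bank z (Im z < 0)) (Re (odflt 0 (GG p)))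
        else Cut2 (bank z (0 < Im z)) (Re (odflt 0 (GG p)))
      else Reg (if 0 < NN z then S1 else if Re z < x0 then S0 else S2) (GG p)
  end.

Lemma NN_le_x0 z : NN z <= 0 -> Re z != x0.
Proof. by apply: contraTneq => /NN_x0; rewrite ltNge. Qed.

Lemma GG_finite z : 0 <= NN z -> exists2 W, GG (Some z) = Some W & cnum z = c%:C * W * (z ^+ 2 - 1).
Proof.
move=> hN; case e : (GG (Some z)) => [W|]; first by exists W => //; apply/GG_fin.
by move/GG_pole: e => /NN_pole[]; lra.
Qed.

Lemma Im_GG z W : cnum z = c%:C * W * (z ^+ 2 - 1) ->
  exists2 P : R, 0 < P & Im W * P = Im z * NN z.
Proof.
move=> h; exists (c * (msq z * nsq z)).
  by rewrite mulr_gt0 ?g_c0 // mulr_gt0 ?msq_gt0 ?nsq_gt0 ?(zz1_neq0 h).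
by rewrite -(Im_root h) cImM /= mul0r addr0; ring.
Qed.

Lemma gmap_proj p : surf_proj (gmap p) = GG p.
Proof.
case: p => [z|] /=; last by rewrite GG_inf.
case: eqVneq => [N0|N0] //.
have [|W -> rW] := @GG_finite z; first by rewrite N0.
have [P P0] := Im_GG rW; rewrite N0 mulr0 => /eqP.
rewrite mulf_eq0 (gt_eqF P0) orbF => /eqP W0.
by case: ifP => _ /=; rewrite -(real_of_Im W0).
Qed.

Lemma KsetE s up z : Kset s up z <->
  match s with
  | S0 => NN z <= 0 /\ hplane (~~ up) z /\ Re z <= x0
  | S1 => 0 <= NN z /\ hplane up z
  | S2 => NN z <= 0 /\ hplane (~~ up) z /\ x0 <= Re z
  end.
Proof. by case: s => //=; split=> [[]|[? []]]. Qed.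

(** Through this dictionary, injectivity, surjectivity and continuity of [gmap] are all read off
    from the pieces. *)
Lemma gmap_side p s up : on_side (gmap p) s up <-> Kbar s up p.
Proof.
case: p => [z|]; last by split=> [[]|].
rewrite /gmap; apply: iff_trans (iff_sym (KsetE s up z)).
case: (eqVneq (NN z) 0) => [N0|N0].
  have hx := @NN_le_x0 z; rewrite N0 lexx in hx; have {}hx := hx isT.
  have tri (P : Prop) : (Im z < 0 -> P) -> (0 < Im z -> P) -> (Im z = 0 -> P) -> P.
    by case: (ltgtP (Im z) 0); auto.
  case: ltgtP hx => // hx _; apply: tri => hI; rewrite /= /bank ?hI ?ltxx ?(lt_eqF hI) ?(gt_eqF hI)
    ?(lt_gtF hI) ?eqxx /=; case: s; case: up; rewrite /= /hplane /= ?N0;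
    first [by split=> _; [repeat split; lra | first [by left | by right | by []]]
        | by split=> [H|[h1 h2]]; [case: H => -[] | exfalso; lra]
        | by split=> [H|[h1 [h2 h3]]]; [case: H => -[] | exfalso; lra]].
have hG : match GG (Some z) with None => Im z = 0 /\ NN z < 0
    | Some W => exists2 P : R, 0 < P & Im W * P = Im z * NN z end.
  case e : (GG (Some z)) => [W|]; first by apply: Im_GG; apply/GG_fin.
  by move/GG_pole: e => /NN_pole[].
move: hG; case: (GG (Some z)) => [W|].
  move=> [P P0 e]; case: (ltP 0 (NN z)) => hN.
    have e1 : (0 <= Im W) = (0 <= Im z) by rewrite -(pmulr_lge0 _ P0) e pmulr_lge0.
    have e2 : (Im W <= 0) = (Im z <= 0) by rewrite -(pmulr_lle0 _ P0) e pmulr_lle0.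
    by case: s; case: up; rewrite /= ?e1 ?e2 /hplane /=; 
    first [by split=> _; [repeat split; lra | first [by left | by right | by []]]
        | by split=> [[_ h]|[h1 h2]]; repeat split; lra
        | by split=> [[_ h]|[h1 [h2 h3]]]; repeat split; lra
        | by split=> [H|[h1 h2]]; [case: H => -[] | exfalso; lra]
        | by split=> [H|[h1 [h2 h3]]]; [case: H => -[] | exfalso; lra]].
  have {}hN : NN z < 0 by rewrite lt_neqAle N0.
  have e1 : (0 <= Im W) = (Im z <= 0) by rewrite -(pmulr_lge0 _ P0) e nmulr_lge0.
  have e2 : (Im W <= 0) = (0 <= Im z) by rewrite -(pmulr_lle0 _ P0) e nmulr_lle0.
  case: ltP (NN_le_x0 (ltW hN)) => hx hx';
    by case: s; case: up; rewrite /= ?e1 ?e2 /hplane /=; 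
    first [by split=> _; [repeat split; lra | first [by left | by right | by []]]
        | by split=> [[_ h]|[h1 h2]]; repeat split; lra
        | by split=> [[_ h]|[h1 [h2 h3]]]; repeat split; lra
        | by split=> [H|[h1 h2]]; [case: H => -[] | exfalso; lra]
        | by split=> [H|[h1 [h2 h3]]]; [case: H => -[] | exfalso; lra]].
move=> [I0 hN]; rewrite ltNge (ltW hN) /=.
have hx' := NN_le_x0 (ltW hN); case: (ltgtP (Re z) x0) hx' => // hx _;
  by case: s; case: up; rewrite /= /hplane I0 /=; 
    first [by split=> _; [repeat split; lra | first [by left | by right | by []]]
        | by split=> [[_ h]|[h1 h2]]; repeat split; lra
        | by split=> [[_ h]|[h1 [h2 h3]]]; repeat split; lra
        | by split=> [H|[h1 h2]]; [case: H => -[] | exfalso; lra]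
        | by split=> [H|[h1 [h2 h3]]]; [case: H => -[] | exfalso; lra]].
Qed.

End Parametrization.

(** * Values of the parametrization are valid points *)

Section Homeomorphism.
Context {R : realType} (K : config R).
Local Notation c := (g_c K).
Local Notation lam := (g_lam K). Local Notation mu := (g_mu K).
Implicit Types (z u v W : R[i]) (s : sheet) (up : bool) (p q : Cbar R) (x y : surf R).
Local Notation x0 := (x0 K).
Local Notation cnum := (cnum K).
Local Notation NN := (NN K).
Local Notation Kset := (Kset K).
Local Notation Kbar := (Kbar K).
Local Notation GG := (GG K).
Local Notation gmap := (gmap K).

Lemma branch_val (f t : R) z W :
  (f, t) \in [:: (- (mu * c), g_be K); (- c, g_al K); (c, g_a K); (lam * c, g_b K)] ->
  Im z = 0 -> Re z = t -> cnum z = c%:C * W * (z ^+ 2 - 1) -> Re W = f / c.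
Proof.
move=> /crit_val[e _] /real_of_Im zR zt rz; have n0 := zz1_neq0 rz.
rewrite zt in zR; rewrite -zR rz in e; move/(mulIf n0): e => e.
have := congr1 (@complex.Re R) e; rewrite cReM /= mul0r subr0 => <-.
by rewrite mulrC mulKf // gt_eqF // g_c0.
Qed.

(** On the curves, [left_curve], [right_curve] and the critical values put the image on the cuts.
    Off the curves an image on a cut of its sheet is impossible: by [left_cut] and [right_cut] the
    root in that piece lies on a curve, and it is the only one in the piece. *)
Lemma gmap_valid p : valid lam mu (gmap p).
Proof.
have c0 := g_c0 K; have cn0 : c != 0 by rewrite gt_eqF.
case: p => [z|]; last by case.
rewrite /gmap; case: (eqVneq (NN z) 0) => [N0|N0].
  have hx := @NN_le_x0 _ K z; rewrite N0 lexx in hx; have {}hx := hx isT.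
  have [|W eW rW] := @GG_finite _ K z; first by rewrite N0.
  have hRe : Re (c%:C * W) = c * Re W by rewrite cReM /= mul0r subr0.
  rewrite eW /=; case: (ltgtP (Re z) x0) hx => // hx _; rewrite /bank; case: eqVneq => [I0|I0] /=.
  - have := NN_Re K I0; rewrite N0 => /esym/eqP; rewrite !mulf_eq0 !subr_eq0.
    have hb := x0_bounds K; have hb' := g_b1 K; have hb2 := g_a1 K.
    case/orP => [/orP[/orP[]|]|] /eqP e.
    + left; rewrite (@branch_val (- (mu * c)) (g_be K) z W) ?inE ?eqxx //.
      by rewrite mulNr mulfK.
    + right; rewrite (@branch_val (- c) (g_al K) z W) ?inE ?eqxx ?orbT //.
      by rewrite mulNr divff.
    + by exfalso; lra.
    + by exfalso; lra.
  - have [_] := left_curve N0 hx I0 rW; rewrite hRe => /andP[h1 h2].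
    apply/andP; split; rewrite -(ltr_pM2l c0); lra.
  - have := NN_Re K I0; rewrite N0 => /esym/eqP; rewrite !mulf_eq0 !subr_eq0.
    have hb := x0_bounds K; have hb' := g_be1 K; have hb2 := g_al1 K.
    case/orP => [/orP[/orP[]|]|] /eqP e.
    + by exfalso; lra.
    + by exfalso; lra.
    + left; rewrite (@branch_val c (g_a K) z W) ?inE ?eqxx ?orbT //.
      by rewrite divff.
    + right; rewrite (@branch_val (lam * c) (g_b K) z W) ?inE ?eqxx ?orbT //.
      by rewrite mulfK.
  - have [_] := right_curve N0 hx I0 rW; rewrite hRe => /andP[h1 h2].
    apply/andP; split; rewrite -(ltr_pM2l c0); lra.
have hx := @NN_le_x0 _ K z.
case eW : (GG (Some z)) => [W|]; last by case: ifP => _ /=; [case|case: ifP => _ /=].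
have rW : cnum z = c%:C * W * (z ^+ 2 - 1) by apply/GG_fin.
have [P P0 eP] := Im_GG rW.
have Iz : Im W = 0 -> Im z = 0.
  by move=> W0; move/eqP: eP; rewrite W0 mul0r eq_sym mulf_eq0 (negPf N0) orbF => /eqP.
have hRe : Re (c%:C * W) = c * Re W by rewrite cReM /= mul0r subr0.
have hIm : Im W = 0 -> Im (c%:C * W) = 0 by move=> W0; rewrite cImM /= mul0r W0 mulr0 addr0.
have hz up : Im W = 0 -> hplane up z by move=> /Iz h; rewrite /hplane h lexx if_same.
have main (l : bool) : Im W = 0 -> (if l then -mu <= Re W <= -1 else 1 <= Re W <= lam) ->
    exists z1 u v, triple K (c%:C * W) z1 u v /\ [/\ Kset S1 true z1, Kset S0 true u,
      Kset S2 true v & NN z1 = 0 /\ if l then NN u = 0 else NN v = 0].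
  move=> W0 hW.
  have [|z1 [u [v [t [k1 k2 k3]]]]] := @triple_side _ K true (c%:C * W).
    by rewrite /hplane hIm.
  exists z1, u, v; split=> //; split=> //; case: l hW => /andP[w1 w2].
    have [|ez nu] := left_cut t k1 k2 k3 (hIm W0); last by rewrite ez NN_conj nu.
    move: w1 w2; rewrite hRe -(ler_pM2l c0) -[Re W <= _](ler_pM2l c0) => w1 w2.
    by apply/andP; split; lra.
  have [|ez nu] := right_cut t k1 k2 k3 (hIm W0); last by rewrite ez NN_conj nu.
  move: w1 w2; rewrite hRe -(ler_pM2l c0) -[Re W <= _](ler_pM2l c0) => w1 w2.
  by apply/andP; split; lra.
have N1 : 0 < NN z -> forall l : bool, Im W = 0 ->
    (if l then -mu <= Re W <= -1 else 1 <= Re W <= lam) -> False.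
  move=> hN l W0 hW; have [z1 [u [v [t [k1 k2 k3 [n1 n2]]]]]] := main l W0 hW.
  have [h _ _] := triple_Kset t k1 k2 k3 rW.
  have kz : Kset S1 true z by split; [exact: ltW | exact: hz].
  by move/eqP: N0; apply; rewrite (h kz).
case: ltP => hN /=.
  by case=> -[h1 h2]; [exact: (N1 hN true) | exact: (N1 hN false)].
case: (ltP (Re z) x0) => hzx /= -[W0 hW].
  have [z1 [u [v [t [k1 k2 k3 [n1 n2]]]]]] := main true W0 hW.
  have [_ h _] := triple_Kset t k1 k2 k3 rW.
  have kz : Kset S0 true z by split=> //; [exact: hz | exact: ltW].
  by move/eqP: N0; apply; rewrite (h kz).
have [z1 [u [v [t [k1 k2 k3 [n1 n2]]]]]] := main false W0 hW.
have [_ _ h] := triple_Kset t k1 k2 k3 rW.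
have kz : Kset S2 true z by split=> //; exact: hz.
by move/eqP: N0; apply; rewrite (h kz).
Qed.

End Homeomorphism.

(** * The surface *)

Section Surface.
Context {R : realType} (lam mu : R).
Implicit Types (s : sheet) (up : bool) (x y : surf R).

Lemma has_side x : exists s up, on_side x s up.
Proof.
case: x => [s [w|]|[[]|] t|[[]|] t].
- case: (leP 0 (Im w)) => h; [exists s, true|exists s, false]; split=> //; exact: ltW.
- by exists s, true.
- by exists S0, true; left.
- by exists S0, false; left.
- by exists S0, true; left.
- by exists S1, true; left.
- by exists S1, false; left.
- by exists S1, true; left.
Qed.

Lemma cut1_on_cut o (t : R) s up : 1 < mu -> valid lam mu (Cut1 o t) -> on_side (Cut1 o t) s up ->
  t <= -1 /\ on_cut lam mu s (Some t%:C).
Proof.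
move=> m1 v hs.
have ht : - mu <= t <= -1.
  case: o v {hs} => [b0|] /=; first by move=> /andP[h1 h2]; rewrite !ltW.
  by case=> ->; rewrite lexx ?andbT /=; lra.
split; first by case/andP: ht.
have hD : inDelta1 mu (Some t%:C) by [].
by case: o hs {v} => [b0|] /= [];
  [case=> -> _ | case=> -> _; left | move=> -> | move=> ->; left].
Qed.

Lemma cut2_on_cut o (t : R) s up : 1 < lam -> valid lam mu (Cut2 o t) -> on_side (Cut2 o t) s up ->
  1 <= t /\ on_cut lam mu s (Some t%:C).
Proof.
move=> m1 v hs.
have ht : 1 <= t <= lam.
  case: o v {hs} => [b0|] /=; first by move=> /andP[h1 h2]; rewrite !ltW.
  by case=> ->; rewrite lexx ?andbT /=; lra.
split; first by case/andP: ht.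
have hD : inDelta2 lam (Some t%:C) by [].
by case: o hs {v} => [b0|] /= [];
  [case=> -> _; right | case=> -> _ | move=> ->; right | move=> -> ].
Qed.

(** On a cut, the sheet and the half fix the bank, and branch points carry none. Together with
    [gmap_side] this yields surjectivity of [gmap]. *)
Lemma surf_side_eq x y s up : 1 < lam -> 1 < mu -> valid lam mu x -> valid lam mu y ->
  surf_proj x = surf_proj y -> on_side x s up -> on_side y s up -> x = y.
Proof.
move=> l1 m1; case: x => [s1 w1|o1 t1|o1 t1]; case: y => [s2 w2|o2 t2|o2 t2] vx vy hxy sx sy.
- by case: sx sy => <- _ [<- _]; rewrite (hxy : w1 = w2).
- have [_ h] := cut1_on_cut m1 vy sy; case: sx => e _; case: vx.
  by rewrite -e (hxy : w1 = Some t2%:C).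
- have [_ h] := cut2_on_cut l1 vy sy; case: sx => e _; case: vx.
  by rewrite -e (hxy : w1 = Some t2%:C).
- have [_ h] := cut1_on_cut m1 vx sx; case: sy => e _; case: vy.
  by rewrite -e -(hxy : Some t1%:C = w2).
- case: hxy => e; rewrite -{}e in vy sy *; congr Cut1.
  case: o1 o2 vx vy sx sy => [[]|] [[]|] //= vx vy.
  + by case=> [[-> ->]|[-> ->]] [] [].
  + by move=> _ _; case: vy vx => ->; rewrite ltxx ?andbF.
  + by case=> [[-> ->]|[-> ->]] [] [].
  + by move=> _ _; case: vy vx => ->; rewrite ltxx ?andbF.
  + by move=> _ _; case: vx vy => ->; rewrite ltxx ?andbF.
  + by move=> _ _; case: vx vy => ->; rewrite ltxx ?andbF.
- have [h1 _] := cut1_on_cut m1 vx sx; have [h2 _] := cut2_on_cut l1 vy sy.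
  by case: hxy => e; exfalso; lra.
- have [_ h] := cut2_on_cut l1 vx sx; case: sy => e _; case: vy.
  by rewrite -e -(hxy : Some t1%:C = w2).
- have [h1 _] := cut2_on_cut l1 vx sx; have [h2 _] := cut1_on_cut m1 vy sy.
  by case: hxy => e; exfalso; lra.
- case: hxy => e; rewrite -{}e in vy sy *; congr Cut2.
  case: o1 o2 vx vy sx sy => [[]|] [[]|] //= vx vy.
  + by case=> [[-> ->]|[-> ->]] [] [].
  + by move=> _ _; case: vy vx => ->; rewrite ltxx ?andbF.
  + by case=> [[-> ->]|[-> ->]] [] [].
  + by move=> _ _; case: vy vx => ->; rewrite ltxx ?andbF.
  + by move=> _ _; case: vx vy => ->; rewrite ltxx ?andbF.
  + by move=> _ _; case: vx vy => ->; rewrite ltxx ?andbF.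
Qed.

Lemma side_inhalf x s up : on_side x s up -> inhalf up (surf_proj x).
Proof.
case: x => [s' [w|]|o t|o t] //=; first by case.
- by move=> _; rewrite /hplane lexx if_same.
- by move=> _; rewrite /hplane lexx if_same.
Qed.

End Surface.

(** * The inverse and the conformal homeomorphism *)

Section Inverse.
Context {R : realType} (K : config R).
Local Notation lam := (g_lam K). Local Notation mu := (g_mu K).
Implicit Types (s : sheet) (up : bool) (p q : Cbar R) (x y : surf R).
Local Notation Kbar := (Kbar K).
Local Notation GG := (GG K).
Local Notation gmap := (gmap K).

Lemma gmap_inj p q : gmap p = gmap q -> p = q.
Proof.
move=> e; have [s [up h]] := has_side (gmap p).
have h' := h; rewrite e in h'; apply: (@Kbar_inj _ K s up); try exact/gmap_side.
by rewrite -!gmap_proj e.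
Qed.

Lemma gmap_surj x : valid lam mu x -> exists p, gmap p = x.
Proof.
move=> vx; have [s [up h]] := has_side x.
have [p kp ep] := @Kbar_exists _ K s up _ (side_inhalf h); exists p.
apply: (surf_side_eq (g_lam1 K) (g_mu1 K) (gmap_valid K p) vx _ _ h).
  by rewrite gmap_proj.
exact/gmap_side.
Qed.

Definition ginv x : Cbar R := xget None [set p | gmap p = x]%classic.

Lemma gmapK : cancel gmap ginv.
Proof.
move=> p; apply: gmap_inj.
by apply: (@xgetPex _ None [set q | gmap q = gmap p]%classic); exists p.
Qed.

Lemma ginvK x : valid lam mu x -> gmap (ginv x) = x.
Proof. by move=> /gmap_surj[p <-]; rewrite gmapK. Qed.

(** Near [p] only the pieces containing [p] occur, so every half-sheet of a nearby image is also one
    of [gmap p]. *)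
Lemma gmap_cont p : cont_to_surf gmap p.
Proof.
move=> e e0; have h1 : nb (GG p) (fun q => chord (GG p) q < e) by exists e.
have {h1} h1 := GG_scont h1.
have h2 s up : nb p (fun q => Kbar s up q -> Kbar s up p).
  case: (pselect (Kbar s up p)) => h; first exact: nbT.
  by apply: nb_imp (Kbar_closed h) => q hq /hq.
have hb s : nb p (fun q => forall up, Kbar s up q -> Kbar s up p).
  by apply: nb_imp (nbI (h2 s true) (h2 s false)) => q [a1 a2] [].
have [d d0 hd] := nbI h1 (nbI (hb S0) (nbI (hb S1) (hb S2))).
exists d => // q /hd[c1 [k0 [k1 k2]]]; split; first by rewrite !gmap_proj chordC.
have [s [up hs]] := has_side (gmap q); exists s, up; split=> //.
by move: hs => /gmap_side hs; apply/gmap_side; case: s hs; [exact: k0|exact: k1|exact: k2].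
Qed.

(** Along a violating sequence, one of the six half-sheets is shared with [x] on a set of the
    ultrafilter. The limit of the preimages then lies in the same piece as [ginv x] and has the same
    image, so [Kbar_inj] identifies them. *)
Lemma ginv_cont x : valid lam mu x -> cont_from_surf lam mu ginv x.
Proof.
move=> vx e e0; apply: contrapT => hN.
have ex (n : nat) : exists y, [/\ valid lam mu y, surf_nbhd x n.+1%:R^-1 y & ~ (chord (ginv x) (ginv y) < e)].
  apply: contrapT => h; apply: hN; exists n.+1%:R^-1; first by rewrite invr_gt0 ltr0Sn.
  move=> q vq nq; apply: contrapT => h'; apply: h; by exists q.
have [Q hQ] := choice ex.
have [U UU hU] := @nat_ultra R.
pose S s up := [set n | on_side x s up /\ on_side (Q n) s up]%classic.
have [s [up US]] : exists s up, U (S s up).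
  apply: contrapT => h.
  have hC s up : U (~` S s up)%classic.
    by have [h1|//] := in_ultra_setVsetC (S s up) UU; case: h; exists s, up.
  have [n] := filter_ex (filterI (filterI (hC S0 true) (hC S0 false))
    (filterI (filterI (hC S1 true) (hC S1 false)) (filterI (hC S2 true) (hC S2 false)))).
  case=> -[a1 a2] [[a3 a4] [a5 a6]].
  have [_ [_ [s [up hs]]] _] := hQ n.
  by case: s hs; case: up.
have [p hp] := ultra_lim (fun n => ginv (Q n)) UU.
have [n0 [sx _]] := filter_ex US.
have kx : Kbar s up (ginv x) by apply/gmap_side; rewrite ginvK.
have kp : Kbar s up p.
  apply: (ultra_closed UU hp (@Kbar_closed _ K s up)); apply: filterS US => n [_ h].
  by apply/gmap_side; rewrite ginvK //; have [] := hQ n.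
have Gx : GG (ginv x) = surf_proj x by rewrite -gmap_proj ginvK.
have Gp : GG p = surf_proj x.
  apply: (@ultra_unique _ _ U (fun n => surf_proj (Q n))) => // P hP.
    apply: filterS (hp _ (GG_scont hP)) => n h; have [vq _ _] := hQ n.
    by rewrite /= -gmap_proj ginvK in h.
  case: hP => d d0 hd; apply: filterS (hU d d0) => n /= hn; apply: hd.
  by have [_ [h _] _] := hQ n; rewrite chordC; exact: lt_trans h hn.
have e1 : p = ginv x by apply: (Kbar_inj kp kx); rewrite Gp Gx.
have he : nb p (fun q => chord (ginv x) q < e) by rewrite e1; exists e.
have [n hn] := filter_ex (hp _ he); by have [_ _] := hQ n; apply.
Qed.

Lemma gmap_homeo : surf_homeo lam mu gmap ginv.
Proof.
split; [exact: gmap_valid | exact: gmapK | exact: ginvK | exact: gmap_cont | exact: ginv_cont].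
Qed.

Lemma gmap_conformal : conformal_param lam mu gmap ginv.
Proof.
split; first exact: gmap_homeo.
by move=> z; rewrite (_ : (fun z => surf_proj (gmap z)) = GG);
  [exact: GG_holo | apply/funext => p; exact: gmap_proj].
Qed.

End Inverse.

(** * Holomorphy of the inverse on each sheet *)

Section Sheets.
Context {R : realType} (K : config R).
Local Notation k := (g_k K). Local Notation A := (g_A K). Local Notation B := (g_B K).
Local Notation c := (g_c K).
Local Notation lam := (g_lam K). Local Notation mu := (g_mu K).
Implicit Types (z u v w : R[i]) (s : sheet) (up : bool) (p q : Cbar R) (x y : surf R).
Local Notation cnum := (cnum K).
Local Notation NN := (NN K).
Local Notation Kset := (Kset K).
Local Notation Kbar := (Kbar K).
Local Notation GG := (GG K).
Local Notation gmap := (gmap K).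
Local Notation ginv := (ginv K).

(** Implicit differentiation: a factored algebraic identity exhibits [E / D] as a continuous
    difference quotient. *)
Lemma cdiff_implicit (eta D E : R[i] -> R[i]) z : ccont D z -> ccont E z ->
  D z != 0 -> (\forall u \near (z : R[i]^o), (eta u - eta z) * D u = (u - z) * E u) -> cdiff eta z.
Proof.
move=> cD cE D0 h; exists (fun u => E u / D u).
  by apply: (ccontM cE); exact: ccontV.
apply: filterS2 h (ccont_neq0 cD D0) => u e Du.
by apply: (mulIf Du); rewrite e mulrAC divfK // mulrC.
Qed.

(** One root has [0 <= NN] and the other two have [NN <= 0], the latter separated by the line
    [Re = x0]. So a multiple root has [NN = 0]. *)
Lemma simple_root W z : NN z != 0 -> cnum z = W * (z ^+ 2 - 1) ->
  exists u v, [/\ triple K W z u v, z != u & z != v].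
Proof.
move=> N0 rz; pose up := 0 <= Im W.
have [|z1 [u [v [t [k1 k2 k3]]]]] := @triple_side _ K up W.
  by rewrite /hplane /up; case: leP => // /ltW.
have uv : u != v by apply/eqP => e; rewrite e in k2; exact: (Kset02 k2 k3).
have tu := triple_rot t; have tv := triple_rot tu.
have [N1 _] := k1; have [Nu _ _] := k2; have [Nv _ _] := k3.
case: (root_triple t rz) => e; rewrite e in N0.
- exists u, v; rewrite e; split=> //.
    apply/eqP => e'; move: N0; rewrite eq_le N1 e' Nu //.
  by apply/eqP => e'; move: N0; rewrite eq_le N1 e' Nv.
- exists v, z1; rewrite e; split=> //.
  by apply/eqP => e'; move: N0; rewrite eq_le Nu e' N1.
- exists z1, u; rewrite e; split=> //; last by rewrite eq_sym.
  by apply/eqP => e'; move: N0; rewrite eq_le Nv e' N1.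
Qed.

Lemma on_cut_closed s p : ~ on_cut lam mu s p -> nb p (fun q => ~ on_cut lam mu s q).
Proof.
have seg (l r : R) z : ~ (Im z = 0 /\ l <= Re z <= r) ->
    exists2 d : R, 0 < d & forall w, cabs (w - z) < d -> ~ (Im w = 0 /\ l <= Re w <= r).
  move=> h.
  have comp w : `|Re w - Re z| <= cabs (w - z) /\ `|Im w - Im z| <= cabs (w - z).
    by rewrite -!cReN -!cReD -!cImN -!cImD Re_le_cabs Im_le_cabs.
  case: (eqVneq (Im z) 0) => [I0|I0]; last first.
    exists `|Im z|; first by rewrite normr_gt0.
    move=> w hw [w0 _]; have [_] := comp w; rewrite w0 sub0r normrN => h1.
    by have := le_lt_trans h1 hw; rewrite ltxx.
  case: (ltP (Re z) l) => h1.
    exists (l - Re z); first by rewrite subr_gt0.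
    move=> w hw [_ /andP[h2 _]]; have [h3 _] := comp w.
    by have := le_lt_trans h3 hw; have := ler_norm (Re w - Re z); lra.
  have h2 : r < Re z by rewrite ltNge; apply/negP => h2; apply: h; rewrite h1 h2.
  exists (Re z - r); first by rewrite subr_gt0.
  move=> w hw [_ /andP[_ h3]]; have [h4 _] := comp w.
  have := le_lt_trans h4 hw; have := ler_norm (- (Re w - Re z)); rewrite normrN; lra.
have big (l r : R) w : `|l| + `|r| < cabs w -> ~ (Im w = 0 /\ l <= Re w <= r).
  move=> hw [w0 /andP[h1 h2]].
  have : cabs w <= `|Re w| by have := cabs_le_ReIm w; rewrite w0 normr0 addr0.
  have : `|Re w| <= `|l| + `|r|.
    rewrite ler_norml; have := ler_norm r; have := ler_norm (- l); rewrite normrN.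
    have := normr_ge0 l; have := normr_ge0 r; lra.
  lra.
have c1 q : ~ inDelta1 mu q -> nb q (fun r => ~ inDelta1 mu r).
  case: q => [z|] h; first by apply/nb_fin; exact: seg.
  by apply/nb_inf; split=> //; exists (`|- mu| + `|(-1 : R)|) => w; exact: big.
have c2 q : ~ inDelta2 lam q -> nb q (fun r => ~ inDelta2 lam r).
  case: q => [z|] h; first by apply/nb_fin; exact: seg.
  by apply/nb_inf; split=> //; exists (`|1 : R| + `|lam|) => w; exact: big.
case: s => /= h; [exact: c1 | | exact: c2].
have [h1 h2] : ~ inDelta1 mu p /\ ~ inDelta2 lam p by split=> h'; apply: h; [left|right].
by apply: nb_imp (nbI (c1 _ h1) (c2 _ h2)) => q [a1 a2] [].
Qed.

(** A real point and infinity lie in both halves of their sheet, so they share one with any point of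
    it; a non-real point requires the radius [|Im z|]. *)
Lemma sheet_nbhd s p : nb p (fun q => exists s' up, on_side (Reg s p) s' up /\ on_side (Reg s q) s' up).
Proof.
case: p => [z|]; last first.
  apply: nbT => q; have [s' [up h]] := has_side (Reg s q).
  by exists s', up; split=> //; case: h => -> _.
case: (eqVneq (Im z) 0) => [I0|I0].
  apply: nbT => q; have [s' [up h]] := has_side (Reg s q).
  by exists s', up; split=> //; case: h => -> _; split=> //; rewrite I0 lexx if_same.
apply/nb_fin; exists `|Im z|; first by rewrite normr_gt0.
move=> w hw; exists s, (0 < Im z).
have := le_lt_trans (Im_le_cabs (w - z)) hw; rewrite cImD cImN => h.
case: (ltP 0 (Im z)) => hz; split; split=> //.
- exact: ltW.
- by move: h; rewrite (gtr0_norm hz) ltr_norml; lra.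
- have hz' : Im z < 0 by rewrite lt_neqAle I0.
  by move: h; rewrite (ltr0_norm hz') ltr_norml; lra.
Qed.

Lemma ginv_sheet_cont s p P : ~ on_cut lam mu s p -> nb (ginv (Reg s p)) P ->
  nb p (fun q => P (ginv (Reg s q))).
Proof.
move=> hp [e e0 he]; have [d d0 hd] := ginv_cont (hp : valid lam mu (Reg s p)) e0.
have hc : nb p (fun q => chord p q < d) by exists d.
apply: nb_imp (nbI hc (nbI (on_cut_closed hp) (sheet_nbhd s p))) => q [h1 [h2 h3]].
by apply: he; apply: hd => //; split=> //=; rewrite chordC.
Qed.

Lemma GG_ginv x : valid lam mu x -> GG (ginv x) = surf_proj x.
Proof. by move=> vx; rewrite -gmap_proj ginvK. Qed.

Definition zeta_inf s : Cbar R := match s with S0 => Some (-1) | S1 => None | S2 => Some 1 end.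

Lemma inf_valid s : valid lam mu (Reg s None).
Proof. by case: s => //= -[]. Qed.

Lemma ginv_inf s : ginv (Reg s None) = zeta_inf s.
Proof.
have v : valid lam mu (Reg s None) := @inf_valid s.
have kx : Kbar s true (ginv (Reg s None)) by apply/gmap_side; rewrite ginvK.
have [h1 h2] := NN_pole K (or_introl erefl); have [h3 h4] := NN_pole K (or_intror erefl).
apply: (Kbar_inj kx); last first.
  by rewrite GG_ginv //; case: (s) => /=; rewrite ?GG_inf //; apply/esym/GG_pole; [right|left].
have hx := pm1_x0 K; case: (s) => //=.
- by split; [exact: ltW | rewrite /hplane /= oppr0 | lra].
- by split; [exact: ltW | rewrite /hplane /= | lra].
Qed.

Lemma ginv_NN s w z : ~ on_cut lam mu s (Some w) -> ginv (Reg s (Some w)) = Some z -> NN z != 0.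
Proof.
move=> v e; have := ginvK (x := Reg s (Some w)) v; rewrite e /gmap; case: eqP => // _.
by case: ifP.
Qed.

(** The conclusion has the form that [holo_fin_comp] expects. Since continuity is known, each case
    only asks for a factored form of the equation for the preimage: at a simple root, at a finite
    pole, or at infinity. *)
Lemma ginv_holo s p : ~ on_cut lam mu s p ->
  let h := chart (fun q => ginv (Reg s q)) p in let u0 := odflt 0 p in
  if h u0 is Some _ then holo_fin h u0 else holo_fin (fun u => cbar_inv (h u)) u0.
Proof.
move=> hp h u0.
have h0 : h u0 = ginv (Reg s p) by exact: chart_pt.
have hcont P : nb (h u0) P -> \forall u \near (u0 : R[i]^o), P (h u).
  rewrite h0 => /(ginv_sheet_cont hp) /nb_chart; rewrite -/u0.
  by apply: filterS => u; rewrite /h; case: (p).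
have hG : \forall u \near (u0 : R[i]^o), GG (h u) = if p is Some _ then Some u else cbar_inv (Some u).
  have := on_cut_closed hp => /nb_chart; rewrite -/u0.
  by apply: filterS => u; rewrite /h; case: (p) => [w|] /= hu; rewrite GG_ginv.
have hfin z : h u0 = Some z -> [/\ \forall u \near (u0 : R[i]^o), h u = Some (odflt 0 (h u)),
    ccont (fun u => odflt 0 (h u)) u0 & odflt 0 (h u0) = z].
  move=> e; split; last by rewrite e.
  - have /hcont : nb (h u0) (fun q => q <> None) by rewrite e; apply/nb_fin; exists 1.
    by apply: filterS => u; case: (h u).
  - apply/ccontP => d d0.
    have /hcont : nb (h u0) (fun q => cabs (odflt 0 q - odflt 0 (h u0)) < d).
      by rewrite e; apply/nb_fin; exists d.
    by move=> /near_cabs.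
case e : (h u0) => [z|].
  have [h1 h2 h3] := hfin _ e; apply/holo_finP; exists (fun u => odflt 0 (h u)) => //.
  pose ze u := odflt 0 (h u).
  have hze : \forall u \near (u0 : R[i]^o), GG (Some (ze u)) = if p is Some _ then Some u else cbar_inv (Some u).
    by apply: filterS2 hG h1 => u e1 e2; rewrite -e1 [in RHS]e2.
  have cze : ccont ze u0 by [].
  have zez : ze u0 = z by [].
  have vp : GG (Some z) = p by rewrite -e h0 GG_ginv.
  have hg : ginv (Reg s p) = Some z by rewrite -h0.
  change (cdiff ze u0).
  have hp' := hp; case ep : p => [w|]; rewrite ep in hze vp hg hp'.
    have u0E : u0 = w by rewrite /u0 ep.
    have rz : cnum z = c%:C * w * (z ^+ 2 - 1) by apply/GG_fin.
    have [u1 [v1 [t zu zv]]] : exists u v, [/\ triple K (c%:C * w) z u v, z != u & z != v].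
      exact: simple_root (ginv_NN hp' hg) rz.
    (* By [triple_num] at [w], the product of the three differences is
       [c * (u - w) * (ze u ^+ 2 - 1)]. *)
    apply: (@cdiff_implicit _ (fun u => (ze u - u1) * (ze u - v1)) (fun u => c%:C * (ze u ^+ 2 - 1))).
    - exact: (ccontM (ccontB cze (ccont_cst _ _)) (ccontB cze (ccont_cst _ _))).
    - exact: (ccontM (ccont_cst _ _) (ccontB (ccontM cze cze) (ccont_cst _ _))).
    - by rewrite zez mulf_neq0 // subr_eq0.
    apply: filterS hze => u /GG_fin rw; rewrite zez u0E mulrA -(triple_num (ze u) t) rw /=; ring.
  have u0E : u0 = 0 by rewrite /u0 ep.
  have z21 : z ^+ 2 = 1 by move/GG_pole: vp => -[->|->]; rewrite ?expr1n ?sqrrN ?expr1n.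
  (* In the chart at infinity the equation reads [u * cnum (ze u) = c * (ze u ^+ 2 - 1)], and
     [z ^+ 2 = 1] at the centre. *)
  apply: (@cdiff_implicit _ (fun u => c%:C * (ze u + z)) (fun u => cnum (ze u))).
  - exact: (ccontM (ccont_cst _ _) (ccontD cze (ccont_cst _ _))).
  - apply: ccontB; last exact: (ccontM (ccont_cst _ _) (ccontB (ccont_cst _ _) cze)).
    apply: ccontD; last exact: (ccontM (ccont_cst _ _) (ccontD (ccont_cst _ _) cze)).
    exact: (ccontM (ccontD (ccont_cst _ _) cze) (ccontB (ccontM cze cze) (ccont_cst _ _))).
  - rewrite zez mulf_neq0 ?cC_neq0 // -mulr2n mulrn_eq0 /=.
    by apply/eqP => z0; move/eqP: z21; rewrite z0 expr0n eq_sym oner_eq0.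
  apply: filterS hze => u eu; rewrite zez u0E subr0.
  have -> : (ze u - z) * (c%:C * (ze u + z)) = c%:C * (ze u ^+ 2 - z ^+ 2) by ring.
  rewrite z21; case: (eqVneq u 0) eu => [->|u0'] /=; rewrite ?eqxx ?(negPf u0').
    by move=> /GG_pole[] ->; rewrite mul0r ?sqrrN ?expr1n subrr mulr0.
  by move=> /GG_fin ->; rewrite !mulrA [u * _]mulrC mulfK.
have pN : p = None by have := GG_ginv (x := Reg s p) hp; rewrite -h0 e GG_inf.
pose eta u := odflt 0 (cbar_inv (h u)).
have eta0 : eta u0 = 0 by rewrite /eta e.
have ceta : ccont eta u0.
  apply/ccontP => d d0; have /hcont : nb (h u0) (fun q => cabs (odflt 0 (cbar_inv q) - eta u0) < d).
    rewrite e eta0; apply/nb_inf; split; first by rewrite /= subrr cabs0.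
    exists d^-1 => w hw; have w0 : 0 < cabs w by apply: lt_trans hw; rewrite invr_gt0.
    have wn : w != 0 by rewrite -cabs_gt0.
    by rewrite /= (negPf wn) /= subr0 cabsV invf_plt ?posrE.
  by move=> /near_cabs.
have hn : \forall u \near (u0 : R[i]^o), cbar_inv (h u) = Some (eta u).
  have /hcont : nb (h u0) (fun q => q <> Some 0).
    rewrite e; apply/nb_inf; split=> //; exists 0 => w w0 [ew].
    by rewrite ew cabs0 ltxx in w0.
  apply: filterS => u; rewrite /eta; case: (h u) => [w|] //= hw.
  by case: eqP hw => // ->.
apply/holo_finP; exists eta => //.
have cid' := ccont_cst (1 : R[i]) u0.
have ce2 := ccontM ceta ceta.
(* The same equation in the variable [eta = 1 / z], multiplied by [eta ^+ 3]. *)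
apply: (@cdiff_implicit _ (fun u => c%:C * (1 - eta u * eta u))
  (fun u => (k%:C * eta u + 1) * (1 - eta u * eta u) + A%:C * (eta u * eta u * (eta u + 1))
            - B%:C * (eta u * eta u * (eta u - 1)))).
- exact: (ccontM (ccont_cst _ _) (ccontB cid' ce2)).
- apply: ccontB; last exact: (ccontM (ccont_cst _ _) (ccontM ce2 (ccontB ceta cid'))).
  apply: ccontD; last exact: (ccontM (ccont_cst _ _) (ccontM ce2 (ccontD ceta cid'))).
  exact: (ccontM (ccontD (ccontM (ccont_cst _ _) ceta) cid') (ccontB cid' ce2)).
- by rewrite eta0 mul0r subr0 mulr1 cC_neq0.
have u00 : u0 = 0 by rewrite /u0 pN.
rewrite eta0 u00 in hG hn *; apply: filterS2 hG hn => u; rewrite pN !subr0.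
case eh : (h u) => [w|] /= eG [ee]; last first.
  rewrite -ee; move: eG; rewrite GG_inf; case: eqVneq => [-> _|//]; by rewrite !mul0r.
move: ee; case: (eqVneq w 0) => // w0 [ew].
have ew' : w = (eta u)^-1 by rewrite -ew invrK.
have et0 : eta u != 0 by rewrite -ew invr_eq0.
have rw : u * cnum w = c%:C * (w ^+ 2 - 1).
  move: eG; case: (eqVneq u 0) => [->|un].
    by move=> /GG_pole[] ->; rewrite mul0r ?sqrrN ?expr1n subrr mulr0.
  by move=> /GG_fin ->; rewrite !mulrA [u * _]mulrC mulfK.
have -> : eta u * (c%:C * (1 - eta u * eta u)) = eta u ^+ 3 * (c%:C * (w ^+ 2 - 1)).
  by rewrite ew'; field.
by rewrite -rw /cnum ew'; field.
Qed.

End Sheets.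

(** * The maps psi *)

Section Psi.
Context {R : realType} (K : config R).
Local Notation k := (g_k K). Local Notation A := (g_A K). Local Notation B := (g_B K).
Local Notation c := (g_c K).
Local Notation lam := (g_lam K). Local Notation mu := (g_mu K).
Implicit Types (z u v w : R[i]) (s : sheet) (up : bool) (p q : Cbar R) (x y : surf R).
Local Notation cnum := (cnum K).
Local Notation GG := (GG K).
Local Notation gmap := (gmap K).
Local Notation ginv := (ginv K).

Lemma ler_div_ge1 (t d : R) : 0 < t -> 1 <= d -> t / d <= t.
Proof.
move=> t0 d1; have d0 : 0 < d := lt_le_trans ltr01 d1.
by rewrite ler_pdivrMr // ler_peMr // ltW.
Qed.

Lemma homeo_comp (M N : Cbar R -> Cbar R) : cancel M N -> cancel N M ->
  (forall p, scont M p) -> (forall p, scont N p) ->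
  surf_homeo lam mu (fun p => gmap (N p)) (fun x => M (ginv x)).
Proof.
move=> MN NM cM cN; split.
- by move=> p; exact: gmap_valid.
- by move=> p; rewrite gmapK.
- by move=> x vx; rewrite MN ginvK.
- move=> p e e0; exact: (cN p _ (@gmap_cont _ K (N p) e e0)).
- move=> x vx e e0.
  have h : nb (M (ginv x)) (fun q => chord (M (ginv x)) q < e) by exists e.
  have [d d0 hd] := cM _ _ h; have [d' d'0 hd'] := ginv_cont vx d0.
  by exists d' => // y vy /(hd' _ vy) /hd.
Qed.

Lemma comp_holo (M : Cbar R -> Cbar R) s p : (forall q, holo_at M q) -> ~ on_cut lam mu s p ->
  holo_at (fun q => M (ginv (Reg s q))) p.
Proof.
move=> hM hp; apply/holo_atE.
have := @holo_fin_comp _ M (chart (fun q => ginv (Reg s q)) p) (odflt 0 p) (@ginv_holo _ K s p hp) (hM _).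
by case: (p).
Qed.

Lemma coprime_noroot (p q : {poly R[i]}) : (forall z, p.[z] = 0 -> q.[z] <> 0) -> coprimep p q.
Proof.
move=> h; rewrite /coprimep; apply/negPn/negP => /closed_rootP[z].
by rewrite root_gcd /root => /andP[/eqP h1 /eqP h2]; exact: h h1 h2.
Qed.

Lemma size_lin (x y : R[i]) : x != 0 -> size (x *: 'X + y%:P) = 2%N /\ lead_coef (x *: 'X + y%:P) = x.
Proof.
move=> x0; have s1 : (size y%:P < size (x *: 'X : {poly R[i]}))%N.
  by rewrite size_scale // size_polyX; exact: leq_ltn_trans (size_polyC_leq1 _) _.
by rewrite size_addl // lead_coefDl // size_scale // size_polyX lead_coefZ lead_coefX mulr1.
Qed.

Definition psi1p (p : Cbar R) : Cbar R := if p is Some u then Some ((1 + u) / c%:C) else None.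
Definition psi1p_inv (p : Cbar R) : Cbar R := if p is Some v then Some (c%:C * v - 1) else None.

Lemma affine_holo (x y : R[i]) p : x != 0 ->
  holo_at (fun q : Cbar R => if q is Some u then Some (x * u + y) else None) p.
Proof.
move=> x0; have -> : (fun q : Cbar R => if q is Some u then Some (x * u + y) else None) =
    ratC (x *: 'X + y%:P) 1.
  apply/funext => -[u|]; rewrite /ratC; last by rewrite (size_lin y x0).1 size_poly1.
  by rewrite !hornerE oner_eq0 divr1.
by apply: ratC_holo; rewrite coprimep1.
Qed.

Lemma psi1p_holo p : holo_at psi1p p.
Proof.
have -> : psi1p = (fun q : Cbar R => if q is Some u then Some ((c%:C)^-1 * u + (c%:C)^-1) else None).
  by apply/funext => -[u|] //=; congr Some; field; exact: cC_neq0.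
by apply: affine_holo; rewrite invr_eq0 cC_neq0.
Qed.

Lemma psi1p_inv_holo p : holo_at psi1p_inv p.
Proof. by apply: affine_holo; exact: cC_neq0. Qed.

Lemma psi1pK : cancel psi1p psi1p_inv.
Proof. by case=> [u|] //=; congr Some; field; exact: cC_neq0. Qed.

Lemma psi1p_invK : cancel psi1p_inv psi1p.
Proof. by case=> [u|] //=; congr Some; field; exact: cC_neq0. Qed.

Definition psi2p (kap : R[i]) (p : Cbar R) : Cbar R :=
  match p with
  | None => Some (- kap)
  | Some u => if u == 1 then None else Some (kap * ((1 + u) / (1 - u)))
  end.
Definition psi2p_inv (kap : R[i]) (p : Cbar R) : Cbar R :=
  match p with
  | None => Some 1
  | Some v => if v == - kap then None else Some ((v - kap) / (v + kap))
  end.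

Lemma mobius_holo (x y x' y' : R[i]) p : x != 0 -> x' != 0 -> x * y' - y * x' != 0 ->
  holo_at (fun q : Cbar R => match q with
    | None => Some (x / x')
    | Some u => if x' * u + y' == 0 then None else Some ((x * u + y) / (x' * u + y')) end) p.
Proof.
move=> x0 x'0 d; rewrite [X in holo_at X](_ : _ = ratC (x *: 'X + y%:P) (x' *: 'X + y'%:P)).
  apply: ratC_holo; apply: coprime_noroot => z; rewrite !hornerE => h1 h2.
  move/eqP: d; apply; have -> : x * y' - y * x' = x * (x' * z + y') - (x * z + y) * x' by ring.
  by rewrite h1 h2 mulr0 mul0r subrr.
apply/funext => -[u|]; rewrite /ratC; last first.
  by rewrite (size_lin y x0).1 (size_lin y' x'0).1 ltnn eqxx (size_lin y x0).2 (size_lin y' x'0).2.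
by rewrite !hornerE.
Qed.

Lemma psi2p_holo kap p : kap != 0 -> holo_at (psi2p kap) p.
Proof.
move=> k0; rewrite [X in holo_at X](_ : _ = (fun q : Cbar R => match q with
    | None => Some (kap / -1)
    | Some u => if -1 * u + 1 == 0 then None else Some ((kap * u + kap) / (-1 * u + 1)) end)).
  apply: mobius_holo => //; rewrite ?oppr_eq0 ?oner_neq0 //.
  have -> : kap * 1 - kap * -1 = kap * 2 by ring.
  by rewrite mulf_neq0 // pnatr_eq0.
apply/funext => -[u|] /=; last by rewrite invrN invr1 mulrN1.
have -> : -1 * u + 1 = 1 - u by ring.
rewrite subr_eq0 [1 == u]eq_sym; case: eqVneq => // u1; congr Some; field.
by rewrite subr_eq0 eq_sym.
Qed.

Lemma psi2p_inv_holo kap p : kap != 0 -> holo_at (psi2p_inv kap) p.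
Proof.
move=> k0; rewrite [X in holo_at X](_ : _ = (fun q : Cbar R => match q with
    | None => Some (1 / 1)
    | Some u => if 1 * u + kap == 0 then None else Some ((1 * u + - kap) / (1 * u + kap)) end)).
  apply: mobius_holo; rewrite ?oner_neq0 //.
  have -> : 1 * kap - - kap * 1 = kap * 2 by ring.
  by rewrite mulf_neq0 // pnatr_eq0.
by apply/funext => -[u|] /=; rewrite ?divr1 // !mul1r addr_eq0.
Qed.

Lemma psi2pK kap : kap != 0 -> cancel (psi2p kap) (psi2p_inv kap).
Proof.
move=> k0; case=> [u|] /=; last by rewrite eqxx.
case: eqVneq => [->//|u1] /=.
have u1' : 1 - u != 0 by rewrite subr_eq0 eq_sym.
have e1 : kap * ((1 + u) / (1 - u)) + kap = kap * 2 / (1 - u) by field.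
have e2 : kap * ((1 + u) / (1 - u)) - kap = kap * 2 * u / (1 - u) by field.
have k2 : kap * 2 != 0 by rewrite mulf_neq0 // pnatr_eq0.
rewrite -addr_eq0 e1 e2 mulf_eq0 (negPf k2) invr_eq0 (negPf u1') /=.
by congr Some; field; rewrite u1' k0.
Qed.

Lemma psi2p_invK kap : kap != 0 -> cancel (psi2p_inv kap) (psi2p kap).
Proof.
move=> k0; case=> [v|] /=; last by rewrite eqxx.
case: eqVneq => [->//|v1] /=.
have v1' : v + kap != 0 by rewrite addr_eq0.
have k2 : kap * 2 != 0 by rewrite mulf_neq0 // pnatr_eq0.
have e1 : 1 - (v - kap) / (v + kap) = kap * 2 / (v + kap) by field.
have e2 : 1 + (v - kap) / (v + kap) = 2 * v / (v + kap) by field.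
rewrite eq_sym -subr_eq0 e1 e2 mulf_eq0 (negPf k2) invr_eq0 (negPf v1') /=.
by congr Some; field; rewrite v1' k0.
Qed.

(** Large [w] on sheet [s] have preimages near [zeta_inf s], so asymptotics in [w] become bounds on
    functions of [z] near -1, 1 or infinity. *)
Lemma near_inf s (P : R[i] -> Prop) :
  nb (zeta_inf s) (fun q => if q is Some z then P z else True) ->
  exists2 r : R, 1 <= r & forall w, r < cabs w ->
    exists z, [/\ ginv (Reg s (Some w)) = Some z, P z, w != 0 & cnum z = c%:C * w * (z ^+ 2 - 1)].
Proof.
have vs := @inf_valid _ K s.
rewrite -(ginv_inf K) => hP; have h1 := ginv_sheet_cont vs hP; have h2 := on_cut_closed vs.
have [/= _ [r hr]] := proj1 (nb_inf _) (nbI h1 h2).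
exists (Num.max 1 r); first by rewrite le_max lexx.
move=> w; rewrite gt_max => /andP[w1 /hr[hw1 hw2]].
have hG := @GG_ginv _ K (Reg s (Some w)) hw2.
case e : (ginv (Reg s (Some w))) hw1 hG => [z|]; last by rewrite GG_inf.
move=> Pz /GG_fin rz; exists z; split=> //.
by rewrite -cabs_gt0 (lt_trans ltr01).
Qed.

Lemma root_val z w : cnum z = c%:C * w * (z ^+ 2 - 1) -> [/\ 1 - z != 0, 1 + z != 0 &
  w = (k%:C + z - A%:C / (1 - z) + B%:C / (1 + z)) / c%:C].
Proof.
move=> h; have n0 := zz1_neq0 h.
have e : z ^+ 2 - 1 = - ((1 - z) * (1 + z)) by ring.
have /andP[h1 h2] : (1 - z != 0) && (1 + z != 0).
  by move: n0; rewrite e oppr_eq0 mulf_eq0 negb_or.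
split=> //; have -> : w = cnum z / (c%:C * (z ^+ 2 - 1)).
  by rewrite h; field; rewrite n0 cC_neq0.
by rewrite /cnum e; field; rewrite cC_neq0 h1 h2.
Qed.

(* Behaviour at infinity on sheet S0, where [z -> -1] and [w ~ B / (c (1 + z))]. *)
Lemma asymp0 (f : surf R -> Cbar R) (V : R[i] -> R[i]) (C1 : R[i]) (m : R[i] -> R[i]) (N : R) :
  (forall z w, ginv (Reg S0 (Some w)) = Some z -> cabs (1 + z) < 1 -> f (Reg S0 (Some w)) = Some (V z)) ->
  (forall z w, cabs (1 + z) < 1 -> cnum z = c%:C * w * (z ^+ 2 - 1) -> V z * w = C1 + (1 + z) * m z) ->
  (forall z, cabs (1 + z) < 1 -> cabs (m z) <= N) ->
  exists (M r : R), forall w : R[i], r < cabs w ->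
    exists2 v, f (Reg S0 (Some w)) = Some v & cabs (v - C1 / w) <= M / cabs w ^+ 2.
Proof.
move=> hf hV hm.
have hP : nb (zeta_inf S0) (fun q => if q is Some z then cabs (1 + z) < 1 else True : Prop).
  by apply/nb_fin; exists 1 => // w; rewrite opprK addrC.
have [r r1 hr] := near_inf hP.
(* [E + B / c] bounds [(1 + z) * w] near [z = -1], where the factor [1 + z] cancels the pole of
   [w]. *)
pose E := (`|k| + 2 + A) / c.
exists ((E + B / c) * N), r => w /hr[z [ez z1 w0 rz]]; exists (V z); first exact: hf.
have [n1 n2 ew] := root_val rz.
have c0 := g_c0 K; have A0 := g_A0 K; have B0 := g_B0 K.
have cw : 0 < cabs w by rewrite cabs_gt0.
have -> : V z - C1 / w = ((1 + z) * w) * m z / w ^+ 2.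
  have -> : V z = V z * w / w by rewrite mulfK.
  by rewrite (hV _ _ z1 rz); field.
rewrite cabsf_div cabsX ler_wpM2r ?invr_ge0 ?exprn_ge0 ?cabs_ge0 // cabsM.
apply: ler_pM; rewrite ?cabs_ge0 ?hm //.
have -> : (1 + z) * w = (1 + z) * ((k%:C + z - A%:C / (1 - z)) / c%:C) + B%:C / c%:C.
  by rewrite ew; field; rewrite n1 n2 cC_neq0.
apply: le_trans (cabsD _ _) _; rewrite cabsf_div !cabsR !gtr0_norm // lerD2r.
rewrite cabsM -[leRHS]mul1r.
apply: ler_pM; [exact: cabs_ge0 | exact: cabs_ge0 | exact: ltW |].
rewrite cabsf_div cabsR gtr0_norm // ler_pM2r ?invr_gt0 //.
have z2 : cabs z <= 2 by have := cabsB_ge z (-1); rewrite cabsN cabs1 opprK [z + 1]addrC; lra.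
have nz1 : 1 <= cabs (1 - z).
  have -> : 1 - z = 2 - (1 + z) by ring.
  by have := cabsB_ge 2 (1 + z); rewrite cabs_nat; lra.
apply: le_trans (cabsB _ _) _; rewrite cabsf_div cabsR gtr0_norm //.
have h1 := cabsD k%:C z; rewrite cabsR in h1.
have h2 : A / cabs (1 - z) <= A by exact: ler_div_ge1.
lra.
Qed.

Lemma psi1_is_psi : is_psi lam mu S1 (psi1_formula c%:C ginv).
Proof.
have c0 := g_c0 K; have A0 := g_A0 K; have B0 := g_B0 K.
have eM : psi1_formula c%:C ginv = (fun x => psi1p (ginv x)) by apply/funext => x.
rewrite eM; split.
- split; last by move=> s p hp; exact: comp_holo psi1p_holo hp.
  exists (fun p => gmap (psi1p_inv p)); apply: homeo_comp.
  + exact: psi1pK.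
  + exact: psi1p_invK.
  + by move=> p; exact: holo_scont (psi1p_holo p).
  + by move=> p; exact: holo_scont (psi1p_inv_holo p).
- have hP : nb (zeta_inf S1) (fun q => if q is Some z then 2 < cabs z else True : Prop).
    by apply/nb_inf; split=> //; exists 2.
  have [r r1 hr] := near_inf hP; exists ((1 + `|k| + A + B) / c), r => w /hr[z [ez z2 w0 rz]].
  exists ((1 + z) / c%:C); first by rewrite ez.
  have [n1 n2 ->] := root_val rz.
  have -> : (1 + z) / c%:C - (k%:C + z - A%:C / (1 - z) + B%:C / (1 + z)) / c%:C =
     (1 - k%:C + A%:C / (1 - z) - B%:C / (1 + z)) / c%:C by field; rewrite cC_neq0 n1 n2.
  rewrite cabsf_div cabsR gtr0_norm // ler_pM2r ?invr_gt0 //.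
  have m1 : 1 <= cabs (1 - z) by have := cabsB_ge z 1; rewrite cabs1 cabsC; lra.
  have m2 : 1 <= cabs (1 + z).
    by have := cabsB_ge z (-1); rewrite cabsN cabs1 opprK [z + 1]addrC; lra.
  apply: le_trans (cabsB _ _) _; rewrite cabsf_div cabsR gtr0_norm //; apply: lerD.
    apply: le_trans (cabsD _ _) _; rewrite cabsf_div cabsR gtr0_norm //; apply: lerD.
      by apply: le_trans (cabsB _ _) _; rewrite cabs1 cabsR.
    by exact: ler_div_ge1.
  by exact: ler_div_ge1.
(* At [z = -1] the product [(1 + z) * w] tends to [B / c], and psi is [(1 + z) / c]. *)
- exists (B%:C / c%:C ^+ 2).
  apply: (@asymp0 (fun x => psi1p (ginv x)) (fun z => (1 + z) / c%:C) (B%:C / c%:C ^+ 2)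
    (fun z => (k%:C + z - A%:C / (1 - z)) / c%:C ^+ 2) ((`|k| + 2 + A) / c ^+ 2)).
  + by move=> z w ->.
  + by move=> z w _ rz; have [n1 n2 ->] := root_val rz; field; rewrite cC_neq0 n1 n2.
  + move=> z z1; rewrite cabsf_div cabsX cabsR gtr0_norm // ler_pM2r ?invr_gt0 ?exprn_gt0 //.
    have z2 : cabs z <= 2 by have := cabsB_ge z (-1); rewrite cabsN cabs1 opprK [z + 1]addrC; lra.
    have nz1 : 1 <= cabs (1 - z).
      have -> : 1 - z = 2 - (1 + z) by ring.
      by have := cabsB_ge 2 (1 + z); rewrite cabs_nat; lra.
    apply: le_trans (cabsB _ _) _; rewrite cabsf_div cabsR gtr0_norm //.
    have h1 := cabsD k%:C z; rewrite cabsR in h1.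
    have h2 : A / cabs (1 - z) <= A by exact: ler_div_ge1.
    lra.
Qed.

(** The pole [z = 1] is infinity on S2; there [c * w] is [- A / (1 - z)] up to a bounded term, and
    [kap] is chosen to match it. The zero [z = -1] is infinity on S0. *)
Lemma psi2_is_psi : is_psi lam mu S2 (psi2_formula (- A) c%:C ginv).
Proof.
have c0 := g_c0 K; have A0 := g_A0 K; have B0 := g_B0 K.
pose kap : R[i] := (- A)%:C / (2 * c%:C).
have kE : kap = - (A%:C / (2 * c%:C)) by rewrite /kap rmorphN mulNr.
have A0' : A%:C != 0 :> R[i] by rewrite fmorph_eq0 gt_eqF.
have k0 : kap != 0.
  by rewrite kE oppr_eq0 mulf_neq0 // invr_eq0 mulf_neq0 ?pnatr_eq0 ?cC_neq0.
have eM : psi2_formula (- A) c%:C ginv = (fun x => psi2p kap (ginv x)) by apply/funext => x.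
rewrite eM; split.
- split; last by move=> s p hp; apply: comp_holo hp => q; exact: psi2p_holo.
  exists (fun p => gmap (psi2p_inv kap p)); apply: homeo_comp.
  + exact: psi2pK.
  + exact: psi2p_invK.
  + by move=> p; exact: holo_scont (psi2p_holo p k0).
  + by move=> p; exact: holo_scont (psi2p_inv_holo p k0).
- have hP : nb (zeta_inf S2) (fun q => if q is Some z then cabs (z - 1) < 1 else True : Prop).
    by apply/nb_fin; exists 1.
  have [r r1 hr] := near_inf hP; exists ((A + (`|k| + 2 + B)) / c), r => w /hr[z [ez z1 w0 rz]].
  have [n1 n2 ew] := root_val rz.
  have n3 : z != 1 by move: n1; rewrite subr_eq0 eq_sym.
  exists (kap * ((1 + z) / (1 - z))); first by rewrite ez /= (negPf n3).
  have -> : kap * ((1 + z) / (1 - z)) - w =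
     (A%:C / 2 - (k%:C + z + B%:C / (1 + z))) / c%:C.
    by rewrite ew kE; field; rewrite cC_neq0 n1 n2.
  rewrite cabsf_div cabsR gtr0_norm // ler_pM2r ?invr_gt0 //.
  have z2 : cabs z <= 2 by have := cabsB_ge z 1; rewrite cabs1; lra.
  have m2 : 1 <= cabs (1 + z).
    have -> : 1 + z = 2 - (1 - z) by ring.
    by have := cabsB_ge 2 (1 - z); rewrite cabs_nat [cabs (1 - z)]cabsC; lra.
  apply: le_trans (cabsB _ _) _; apply: lerD.
    by rewrite cabsf_div cabsR cabs_nat gtr0_norm // ler_pdivrMr //; lra.
  apply: le_trans (cabsD _ _) _; rewrite cabsf_div cabsR gtr0_norm //; apply: lerD.
    by apply: le_trans (cabsD _ _) _; rewrite cabsR lerD2l.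
  by exact: ler_div_ge1.
(* At [z = -1] the formula behaves like [kap * (1 + z) / 2], and [w] like [B / (c * (1 + z))]. *)
- exists (kap * (B%:C / (2 * c%:C))).
  apply: (@asymp0 (fun x => psi2p kap (ginv x)) (fun z => kap * ((1 + z) / (1 - z)))
    (kap * (B%:C / (2 * c%:C)))
    (fun z => kap * ((k%:C + z - A%:C / (1 - z)) / c%:C + B%:C / (2 * c%:C)) / (1 - z))
    (cabs kap * ((`|k| + 2 + A) / c + B / (2 * c)))).
  + move=> z w ez z1; rewrite ez /=; case: eqVneq z1 => // ->.
    by rewrite -[1 + 1]/(2%:R) cabs_nat => h; exfalso; clear ez eM; move: h; rewrite ltrn1.
  + by move=> z w _ rz; have [n1 n2 ->] := root_val rz; field; rewrite cC_neq0 n1 n2.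
  + move=> z z1.
    have z2 : cabs z <= 2 by have := cabsB_ge z (-1); rewrite cabsN cabs1 opprK [z + 1]addrC; lra.
    have nz1 : 1 <= cabs (1 - z).
      have -> : 1 - z = 2 - (1 + z) by ring.
      by have := cabsB_ge 2 (1 + z); rewrite cabs_nat; lra.
    rewrite cabsf_div ler_pdivrMr ?(lt_le_trans ltr01) // cabsM.
    apply: le_trans (_ : cabs kap * ((`|k| + 2 + A) / c + B / (2 * c)) * 1 <= _); last first.
      by rewrite ler_wpM2l // mulr_ge0 ?cabs_ge0 // addr_ge0 ?divr_ge0 ?addr_ge0 ?mulr_ge0 // ltW.
    rewrite mulr1 ler_wpM2l ?cabs_ge0 //; apply: le_trans (cabsD _ _) _.
    rewrite !cabsf_div cabsM !cabsR cabs_nat (gtr0_norm c0) (gtr0_norm B0) lerD2r ler_pM2r ?invr_gt0 //.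
    apply: le_trans (cabsB _ _) _; rewrite cabsf_div cabsR gtr0_norm //.
    have h1 := cabsD k%:C z; rewrite cabsR in h1.
    have h2 : A / cabs (1 - z) <= A by exact: ler_div_ge1.
    lra.
Qed.

End Psi.

(** * Properties of an arbitrary candidate for psi *)

Section OneSolution.
Context {R : realType} (K : config R) (l : sheet) (f : surf R -> Cbar R).
Local Notation lam := (g_lam K). Local Notation mu := (g_mu K).
Implicit Types (z u v w : R[i]) (s : sheet) (up : bool) (p q : Cbar R) (x y : surf R).
Context (hf : is_psi lam mu l f).

Lemma psi_cont x : valid lam mu x -> cont_from_surf lam mu f x.
Proof. by case: hf => -[[finv [_ _ _ _ h]] _] _ _; exact: h. Qed.

Lemma psi_inj x y : valid lam mu x -> valid lam mu y -> f x = f y -> x = y.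
Proof.
case: hf => -[[finv [_ _ h _ _]] _] _ _ vx vy e.
by rewrite -(h x vx) -(h y vy) e.
Qed.

Lemma psi_sheet_cont s p P : ~ on_cut lam mu s p -> nb (f (Reg s p)) P ->
  nb p (fun q => P (f (Reg s q))).
Proof.
move=> hp [e e0 he]; have [d d0 hd] := @psi_cont (Reg s p) hp e e0.
have hc : nb p (fun q => chord p q < d) by exists d.
apply: nb_imp (nbI hc (nbI (on_cut_closed hp) (sheet_nbhd s p))) => q [h1 [h2 h3]].
by apply: he; apply: hd => //; split=> //=; rewrite chordC.
Qed.

Lemma large_point (r : R) : exists w : R[i], r < cabs w.
Proof. by exists (`|r| + 1)%:C; rewrite cabsR ger0_norm ?addr_ge0 //; have := ler_norm r; lra. Qed.

(** The asymptotics of [is_psi] concern finite [w] only; continuity carries them to the point at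
    infinity itself. *)
Lemma psi_inf : f (Reg l None) = None.
Proof.
case e : (f (Reg l None)) => [v0|//]; exfalso.
have hv : nb (f (Reg l None)) (fun q => if q is Some v then is_true (cabs (v - v0) < 1) else False).
  by rewrite e; apply/nb_fin; exists 1.
have [_ [r1 h1]] := proj1 (nb_inf _) (@psi_sheet_cont l None _ (@inf_valid _ K l) hv).
case: hf => _ [M [r h2]] _.
have [w] := large_point (Num.max (Num.max r1 r) (cabs v0 + 1 + M)).
rewrite !gt_max => /andP[/andP[w1 w2] w3].
have [v ev hvw] := h2 _ w2; have := h1 _ w1; rewrite ev => hv0.
have h4 := cabs_distD v w v0; have h5 := cabsB_ge w v0; rewrite cabsC in hvw.
clear e ev; lra.
Qed.

Lemma psi_inf0 : l <> S0 -> f (Reg S0 None) = Some 0.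
Proof.
move=> l0; case: hf => _ _ [C1 [M [r h]]].
apply: contrapT => /nb_sep[P [h1 h2]].
have [_ [r1 hr1]] := proj1 (nb_inf _) (@psi_sheet_cont S0 None _ (@inf_valid _ K S0) h1).
move: h2 => /nb_fin[d d0 hd].
have [w] := large_point (Num.max (Num.max r1 r) (1 + (cabs C1 + `|M|) / d)).
rewrite !gt_max => /andP[/andP[w1 w2] w3].
have [v ev hv] := h _ w2; have := hr1 _ w1; rewrite ev; apply: hd; rewrite subr0.
have q0 : 0 <= (cabs C1 + `|M|) / d by rewrite divr_ge0 ?addr_ge0 ?cabs_ge0 // ltW.
have cw1 : 1 < cabs w by lra.
have cw : 0 < cabs w by apply: lt_trans cw1.
have hb : cabs C1 / cabs w + `|M| / cabs w < d.
  rewrite -mulrDl ltr_pdivrMr // mulrC -ltr_pdivrMr //; lra.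
apply: le_lt_trans hb; rewrite -(subrK (C1 / w) v) addrC.
apply: le_trans (cabsD _ _) _; rewrite cabsf_div lerD2l; apply: le_trans hv _.
apply: le_trans (_ : `|M| / cabs w ^+ 2 <= _).
  by rewrite ler_wpM2r ?invr_ge0 ?exprn_ge0 ?cabs_ge0 // ler_norm.
rewrite ler_wpM2l // lef_pV2 ?posrE ?exprn_gt0 //.
by rewrite expr2 ler_peMr // ltW.
Qed.

Lemma psi_fin x : valid lam mu x -> x <> Reg l None -> exists v, f x = Some v.
Proof.
move=> vx hx; case e : (f x) => [v|]; first by exists v.
by case: hx; apply: psi_inj => //; [exact: (@inf_valid _ K l) | rewrite e psi_inf].
Qed.

(** The inverse of [f] is continuous at infinity, so large values are taken only near the pole. *)
Lemma psi_large (r : R) : exists M : R, forall x z, valid lam mu x -> f x = Some z -> M < cabs z ->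
  exists2 w, x = Reg l (Some w) & r < cabs w.
Proof.
case: hf => -[[finv [h1 h2 h3 h4 h5]] _] _ _.
have eN : finv None = Reg l None.
  by rewrite -(h3 (Reg l None) (@inf_valid _ K l)) psi_inf.
(* This radius exceeds [r] and leaves out all points of the cuts. *)
have : nb (None : Cbar R) (fun q => if q is Some w then is_true (r + `|r| + lam + mu < cabs w) else True).
  by apply/nb_inf; split=> //; exists (r + `|r| + lam + mu).
case=> e e0 he.
have : nb None (fun q => surf_nbhd (finv None) e (finv q)) by exact: h4.
move=> /nb_inf[_ [M hM]]; exists M => x z vx ex /hM; rewrite -ex h3 // eN => -[].
rewrite chordC => /he hx [s [up [hs]]].
have l1 := g_lam1 K; have m1 := g_mu1 K; have hr := ler_norm r; have hr' := ler_norm (- r).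
rewrite normrN in hr'.
case: hs => -> _; case: x vx ex hx => [s' [w|]|o t|o t] vx ex hx hs.
- by case: hs => -> _; exists w => //; move: hx => /=; lra.
- by case: hs ex => <- _; rewrite psi_inf.
- have [t1 _] := cut1_on_cut m1 vx hs; move: hx => /=; rewrite cabsR => hx; exfalso.
  have tm : - mu <= t.
    by case: o vx {ex hs} => [b0|] /=; [case/andP => /ltW | case=> -> //; lra].
  by rewrite (@ler0_norm _ t) in hx; clear ex vx hs eN; lra.
- have [t1 _] := cut2_on_cut l1 vx hs; move: hx => /=; rewrite cabsR => hx; exfalso.
  have tm : t <= lam.
    by case: o vx {ex hs} => [b0|] /=; [case/andP => _ /ltW | case=> -> //; lra].
  by rewrite (@ger0_norm _ t) in hx; clear ex vx hs eN; lra.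
Qed.

Lemma psi_gmap_cont p : gmap K p <> Reg l None -> forall e : R, 0 < e ->
  nb p (fun q => cabs (odflt 0 (f (gmap K q)) - odflt 0 (f (gmap K p))) < e).
Proof.
move=> hp e e0; have [v ev] := psi_fin (gmap_valid K p) hp.
have : nb (f (gmap K p)) (fun q => cabs (odflt 0 q - v) < e) by rewrite ev; apply/nb_fin; exists e.
case=> d d0 hd; have [d' d'0 hd'] := psi_cont (gmap_valid K p) d0.
apply: nb_imp (@gmap_cont _ K p d' d'0) => q hq; rewrite ev; apply: hd.
by apply: hd' => //; exact: gmap_valid.
Qed.

End OneSolution.

Section SheetPoints.
Context {R : realType} (lam mu : R).
Implicit Types (w : R[i]) (s : sheet) (up : bool).

Definition cutpt1 up (t : R) : surf R := Cut1 (if (t == - mu) || (t == -1) then None else Some up) t.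
Definition cutpt2 up (t : R) : surf R := Cut2 (if (t == 1) || (t == lam) then None else Some up) t.

(* The point over [w] on the closed upper ([up = true]) or lower half of sheet [s]. *)
Definition sheetpt s up w : surf R :=
  let d1 := `[< inDelta1 mu (Some w) >] in let d2 := `[< inDelta2 lam (Some w) >] in
  match s with
  | S0 => if d1 then cutpt1 up (Re w) else Reg S0 (Some w)
  | S1 => if d1 then cutpt1 (~~ up) (Re w) else if d2 then cutpt2 up (Re w) else Reg S1 (Some w)
  | S2 => if d2 then cutpt2 (~~ up) (Re w) else Reg S2 (Some w)
  end.

Lemma cutpt1_valid up w : inDelta1 mu (Some w) -> valid lam mu (cutpt1 up (Re w)).
Proof.
case=> _ /andP[h1 h2]; rewrite /cutpt1; case: eqVneq => [->|n1] /=; first by left.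
by case: eqVneq => [->|n2] /=; [right | rewrite !lt_neqAle h1 h2 n2 eq_sym n1].
Qed.

Lemma cutpt2_valid up w : inDelta2 lam (Some w) -> valid lam mu (cutpt2 up (Re w)).
Proof.
case=> _ /andP[h1 h2]; rewrite /cutpt2; case: eqVneq => [->|n1] /=; first by left.
by case: eqVneq => [->|n2] /=; [right | rewrite !lt_neqAle h1 h2 n2 eq_sym n1].
Qed.

Lemma sheetpt_valid s up w : valid lam mu (sheetpt s up w).
Proof.
rewrite /sheetpt; case: s; case: asboolP => h1.
- exact: cutpt1_valid.
- by [].
- exact: cutpt1_valid.
- by case: asboolP => h2; [exact: cutpt2_valid | case].
- exact: cutpt2_valid.
- by [].
Qed.

Lemma sheetpt_proj s up w : surf_proj (sheetpt s up w) = Some w.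
Proof.
have r1 : inDelta1 mu (Some w) -> (Re w)%:C = w by case=> h _; apply: complex_ext.
have r2 : inDelta2 lam (Some w) -> (Re w)%:C = w by case=> h _; apply: complex_ext.
rewrite /sheetpt; case: s; case: asboolP => h1 //=; try by [rewrite r1 | rewrite r2].
by case: asboolP => h2 //=; rewrite r2.
Qed.

Lemma cutpt1_side up t s up' : (s = S0 /\ up' = up) \/ (s = S1 /\ up' = ~~ up) ->
  on_side (cutpt1 up t) s up'.
Proof. by rewrite /cutpt1; case: ifP => _ //= [[-> _]|[-> _]]; [left|right]. Qed.

Lemma cutpt2_side up t s up' : (s = S1 /\ up' = up) \/ (s = S2 /\ up' = ~~ up) ->
  on_side (cutpt2 up t) s up'.
Proof. by rewrite /cutpt2; case: ifP => _ //= [[-> _]|[-> _]]; [left|right]. Qed.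

Lemma sheetpt_side s up w : hplane up w -> on_side (sheetpt s up w) s up.
Proof.
move=> hw; rewrite /sheetpt; case: s; case: asboolP => h1; try (by split).
- by apply: cutpt1_side; left.
- by apply: cutpt1_side; right; rewrite negbK.
- by case: asboolP => h2; [apply: cutpt2_side; left | split].
- by apply: cutpt2_side; right; rewrite negbK.
Qed.

Lemma sheetpt_reg s up w : Im w != 0 -> sheetpt s up w = Reg s (Some w).
Proof.
move=> w0; have n1 : ~ inDelta1 mu (Some w) by case=> h; rewrite h eqxx in w0.
have n2 : ~ inDelta2 lam (Some w) by case=> h; rewrite h eqxx in w0.
by rewrite /sheetpt (asboolF n1) (asboolF n2); case: s.
Qed.

(** Passing from the upper to the lower half exchanges S0 and S1 on the left cut, S1 and S2 on the
    right cut, and changes nothing elsewhere. Hence the product over the sheets is a function of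
    [w]. *)
Lemma sheetpt_swap (F : surf R -> R[i]) w :
  F (sheetpt S0 true w) * F (sheetpt S1 true w) * F (sheetpt S2 true w) =
  F (sheetpt S0 false w) * F (sheetpt S1 false w) * F (sheetpt S2 false w).
Proof.
rewrite /sheetpt; case: asboolP => h1; case: asboolP => h2 //=.
- by case: h1 h2 => _ /andP[_ h1] [_ /andP[h2 _]]; exfalso; lra.
- by rewrite [F (cutpt1 true _) * _]mulrC.
- by rewrite -mulrA [F (cutpt2 true _) * _]mulrC mulrA.
Qed.

End SheetPoints.

(** * Two candidates for psi agree *)

Section Uniqueness.
Context {R : realType} (K : config R) (l : sheet) (f f' : surf R -> Cbar R).
Local Notation lam := (g_lam K). Local Notation mu := (g_mu K).
Implicit Types (z u v w : R[i]) (s : sheet) (up : bool) (p q : Cbar R) (x y : surf R).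
Context (hl : l <> S0).
Context (hf : is_psi lam mu l f).
Context (hf' : is_psi lam mu l f').
Local Notation pt := (sheetpt lam mu).

(** The function f of the overview. At the common pole the defaults give a value without meaning;
    the statements below exclude that point. *)
Definition gap x : R[i] := odflt 0 (f x) - odflt 0 (f' x).

(** Where one candidate is large, the point is near the common pole and both are w + O(1); elsewhere
    both are bounded. *)
Lemma gap_bounded : exists M : R, forall x, valid lam mu x -> x <> Reg l None -> cabs (gap x) <= M.
Proof.
have [_ [M1 [r1 h1]] _] := hf; have [_ [M2 [r2 h2]] _] := hf'.
have [N1 k1] := psi_large hf (Num.max r1 r2); have [N2 k2] := psi_large hf' (Num.max r1 r2).
exists (Num.max (M1 + M2) (N1 + N2)) => x vx hx; rewrite le_max.
have [v ev] := psi_fin hf vx hx; have [v' ev'] := psi_fin hf' vx hx.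
have near_pole w : x = Reg l (Some w) -> Num.max r1 r2 < cabs w ->
    (cabs (gap x) <= M1 + M2) || (cabs (gap x) <= N1 + N2).
  move=> ex; rewrite gt_max => /andP[w1 w2]; apply/orP; left.
  have [u1 e1 b1] := h1 _ w1; have [u2 e2 b2] := h2 _ w2.
  rewrite /gap ex e1 e2 /=; apply: le_trans (cabs_distD w _ _) _; rewrite [cabs (w - _)]cabsC.
  exact: lerD.
case: (ltP N1 (cabs v)) => hv; first by have [w ex hw] := k1 _ _ vx ev hv; exact: near_pole ex hw.
case: (ltP N2 (cabs v')) => hv'; first by have [w ex hw] := k2 _ _ vx ev' hv'; exact: near_pole ex hw.
apply/orP; right; rewrite /gap ev ev' /=; apply: le_trans (cabsB _ _) _; exact: lerD.
Qed.

Lemma pt_fin s up w : pt s up w <> Reg l None.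
Proof. by move=> e; have := sheetpt_proj lam mu s up w; rewrite e. Qed.

Definition norm_c (a : R[i]) up w := (gap (pt S0 up w) + a) * (gap (pt S1 up w) + a) * (gap (pt S2 up w) + a).

Lemma norm_up a up w : norm_c a up w = norm_c a true w.
Proof. by case: up => //; rewrite /norm_c -(sheetpt_swap lam mu (fun x => gap x + a)). Qed.

(** One-sided continuity: outside the closed half-plane the function is frozen at its value in [w0],
    so that [ccont] and its algebra apply. *)
Lemma gap_half s up w0 : hplane up w0 ->
  ccont (fun w => if `[< hplane up w >] then gap (pt s up w) else gap (pt s up w0)) w0.
Proof.
move=> hw0; set x := pt s up w0.
have vx : valid lam mu x by exact: sheetpt_valid.
have one (h : surf R -> Cbar R) (hh : is_psi lam mu l h) (e : R) : 0 < e -> exists2 d : R, 0 < d &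
    forall w, hplane up w -> cabs (w - w0) < d -> cabs (odflt 0 (h (pt s up w)) - odflt 0 (h x)) < e.
  move=> e0; have [v ev] := psi_fin hh vx (@pt_fin s up w0).
  have : nb (h x) (fun q => cabs (odflt 0 q - v) < e) by rewrite ev; apply/nb_fin; exists e.
  case=> d d0 hd; have [d1 d10 hd1] := psi_cont hh vx d0.
  exists (d1 / 2); first by rewrite divr_gt0.
  move=> w hw hww; rewrite ev; apply: hd; apply: hd1; first exact: sheetpt_valid.
  split; last by exists s, up; split; exact: sheetpt_side.
  rewrite !sheetpt_proj; apply: le_lt_trans (chord_le _ _) _; lra.
apply/ccontP => e e0; rewrite (asboolT hw0) -/x.
have e20 : 0 < e / 2 by rewrite divr_gt0.
have [d1 d10 h1] := one f hf _ e20; have [d2 d20 h2] := one f' hf' _ e20.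
exists (Num.min d1 d2); first by rewrite lt_min d10.
move=> w; rewrite lt_min => /andP[w1 w2]; case: asboolP => hw; last by rewrite subrr cabs0.
rewrite /gap; have -> (a b a' b' : R[i]) : a - b - (a' - b') = (a - a') - (b - b') by ring.
apply: le_lt_trans (cabsB _ _) _; have := h1 _ hw w1; have := h2 _ hw w2; lra.
Qed.

(** The product is continuous on each closed half-plane when taken with that half's points, and
    [norm_up] identifies the two products. *)
Lemma norm_cont a w0 : ccont (norm_c a true) w0.
Proof.
have side up : hplane up w0 -> exists N, [/\ ccont N w0, N w0 = norm_c a true w0 &
    forall w, hplane up w -> N w = norm_c a true w].
  move=> hw0; pose g s w := if `[< hplane up w >] then gap (pt s up w) else gap (pt s up w0).
  exists (fun w => (g S0 w + a) * (g S1 w + a) * (g S2 w + a)).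
  have E w : hplane up w -> (g S0 w + a) * (g S1 w + a) * (g S2 w + a) = norm_c a true w.
    by move=> hw; rewrite /g (asboolT hw) -(norm_up a up).
  split=> //; last exact: E.
  have cg s : ccont (fun w => g s w + a) w0 := ccontD (@gap_half s up w0 hw0) (ccont_cst a w0).
  exact: (ccontM (ccontM (cg S0) (cg S1)) (cg S2)).
have loc up (e : R) : 0 < e -> exists2 d : R, 0 < d &
    forall w, hplane up w -> cabs (w - w0) < d -> cabs (norm_c a true w - norm_c a true w0) < e.
  move=> e0; case: (pselect (hplane up w0)) => [/side[N [cN N0 NE]]|hN].
    have [d d0 hd] := proj1 (ccontP _ _) cN e e0; exists d => // w hw /hd.
    by rewrite N0 NE.
  have I0 : Im w0 != 0 by apply/eqP => h; apply: hN; rewrite /hplane h lexx if_same.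
  exists `|Im w0|; first by rewrite normr_gt0.
  move=> w hw hww; exfalso; apply: hN.
  have := le_lt_trans (Im_le_cabs (w - w0)) hww; rewrite cImD cImN.
  move: hw; rewrite /hplane; case: up => hw; case: (ltP 0 (Im w0)) => h0.
  - by rewrite ltW.
  - have h0' : Im w0 < 0 by rewrite lt_neqAle I0.
    by rewrite (ltr0_norm h0') ltr_norml; lra.
  - by rewrite (gtr0_norm h0) ltr_norml; lra.
  - by [].
apply/ccontP => e e0; have [d1 d10 h1] := loc true e e0; have [d2 d20 h2] := loc false e e0.
exists (Num.min d1 d2); first by rewrite lt_min d10.
move=> w; rewrite lt_min => /andP[w1 w2].
case: (leP 0 (Im w)) => hw; first exact: h1.
by apply: h2 => //; exact: ltW.
Qed.

Lemma norm_diff a w0 : Im w0 != 0 -> cdiff (norm_c a true) w0.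
Proof.
move=> I0.
have reg s : ~ on_cut lam mu s (Some w0).
  have := sheetpt_valid lam mu s true w0; by rewrite sheetpt_reg.
have one (h : surf R -> Cbar R) (hh : is_psi lam mu l h) s :
    cdiff (fun w => odflt 0 (h (Reg s (Some w)))) w0.
  have [[_ hol] _ _] := hh; apply: holo_at_cdiff (hol s (Some w0) (reg s)) _.
  have [|v ->] := @psi_fin _ _ _ _ hh (Reg s (Some w0)) (reg s) => //.
have G s : cdiff (fun w => (odflt 0 (f (Reg s (Some w))) - odflt 0 (f' (Reg s (Some w)))) + a) w0.
  exact: cdiffD (cdiffB (one f hf s) (one f' hf' s)) (cdiff_cst a w0).
apply: cdiff_eqnear (cdiffM (cdiffM (G S0) (G S1)) (G S2)).
apply/near_cabs; exists `|Im w0|; first by rewrite normr_gt0.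
move=> w hw; have hI : Im w != 0.
  apply/eqP => h; have := le_lt_trans (Im_le_cabs (w - w0)) hw.
  by rewrite cImD cImN h sub0r normrN ltxx.
by rewrite /norm_c /gap !sheetpt_reg.
Qed.

Lemma norm_const a w w' : norm_c a true w = norm_c a true w'.
Proof.
have [M hM] := gap_bounded.
have M0 : 0 <= M by apply: le_trans (cabs_ge0 _) (hM _ (sheetpt_valid lam mu S0 true 0) (@pt_fin S0 true 0)).
apply: (@liouville _ (norm_c a true) ((M + cabs a) * (M + cabs a) * (M + cabs a))).
- exact: norm_cont.
- exact: norm_diff.
move=> z; have b s : cabs (gap (pt s true z) + a) <= M + cabs a.
  apply: le_trans (cabsD _ _) _; rewrite lerD2r; apply: hM; first exact: sheetpt_valid.
  exact: pt_fin.
by rewrite /norm_c !cabsM !ler_pM ?mulr_ge0 ?cabs_ge0.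
Qed.

(** With the constant equal to minus the value at [x], the product vanishes over [w], hence over 0,
    where one of the three factors must vanish. *)
Lemma gap_values x w : valid lam mu x -> surf_proj x = Some w ->
  gap x \in [:: gap (pt S0 true 0); gap (pt S1 true 0); gap (pt S2 true 0)].
Proof.
move=> vx ex; have [s [up hs]] := has_side x.
have hw : hplane up w by have := side_inhalf hs; rewrite ex.
have {ex} -> : x = pt s up w.
  apply: (surf_side_eq (g_lam1 K) (g_mu1 K) vx (sheetpt_valid _ _ _ _ _) _ hs).
    by rewrite sheetpt_proj.
  exact: sheetpt_side.
set a := gap _.
have : norm_c (- a) true 0 = 0.
  rewrite (norm_const _ 0 w) -(norm_up _ up) /norm_c /a.
  by case: s {hs vx} @a; rewrite subrr ?mul0r ?mulr0 ?mul0r.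
by move/eqP; rewrite !mulf_eq0 !subr_eq0 !inE ![a == _]eq_sym orbA.
Qed.

Lemma pick_between (y : R) (L : seq R) : 0 < y -> exists2 t, 0 < t < y & t \notin L.
Proof.
elim: L y => [|e L ih] y y0; first by exists (y / 2) => //; lra.
case: (ltP 0 e) => e0; last first.
  have [t ht tL] := ih _ y0; exists t => //; rewrite inE negb_or tL andbT.
  by apply/eqP => te; move: ht; rewrite te; lra.
have [|t ht tL] := ih (Num.min y e); first by rewrite lt_min y0.
move: ht; rewrite lt_min => /andP[t0 /andP[ty te]].
by exists t; [rewrite t0 | rewrite inE negb_or tL andbT lt_eqF].
Qed.

Lemma gap_gmap_cont p : gmap K p <> Reg l None -> forall e : R, 0 < e ->
  nb p (fun q => cabs (gap (gmap K q) - gap (gmap K p)) < e).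
Proof.
move=> hp e e0; have e20 : 0 < e / 2 by rewrite divr_gt0.
apply: nb_imp (nbI (psi_gmap_cont hf hp e20) (psi_gmap_cont hf' hp e20)) => q [h1 h2].
rewrite /gap; have -> (a b a' b' : R[i]) : a - b - (a' - b') = (a - a') - (b - b') by ring.
by apply: le_lt_trans (cabsB _ _) _; lra.
Qed.

(** The point -1 is infinity on S0, where both candidates vanish. Along the segment from -1 to [z]
    the modulus of the gap is continuous with finitely many values, so by the intermediate value
    theorem it stays 0. *)
Lemma gap_nonreal z : Im z != 0 -> gap (gmap K (Some z)) = 0.
Proof.
move=> z0; apply/eqP; rewrite -cabs_eq0; apply/negPn/negP => hz.
have y0 : 0 < cabs (gap (gmap K (Some z))) by rewrite lt_neqAle eq_sym hz cabs_ge0.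
(* For nonzero [t] this point is not real, so it is no pole of [GG] and its image is not the pole of
   the candidates. *)
pose Z (t : R) : R[i] := -1 + t%:C * (z + 1).
have g1 : gmap K (Some (-1)) = Reg S0 None.
  by rewrite -[Some (-1)]/(zeta_inf S0) -(ginv_inf K) ginvK //; exact: (@inf_valid _ K S0).
have ImZ t : Im (Z t) = t * Im z.
  by rewrite /Z cImD cImM cImD /= oppr0 mul0r !addr0 add0r.
have Z0 : Z 0 = -1 by rewrite /Z mul0r addr0.
have fin t : t != 0 -> exists w, GG K (Some (Z t)) = Some w.
  move=> t0; case e : (GG K (Some (Z t))) => [w|]; first by exists w.
  by move/GG_pole: e => /NN_pole -/(_ K)[_]; rewrite ImZ => /eqP; rewrite mulf_eq0 (negPf t0) (negPf z0).
have npole t : gmap K (Some (Z t)) <> Reg l None.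
  case: (eqVneq t 0) => [->|t0]; first by rewrite Z0 g1 => -[e]; case: hl.
  by move=> e; have [w] := fin t t0; rewrite -gmap_proj e.
pose phi t := cabs (gap (gmap K (Some (Z t)))).
have cphi : continuous phi.
  apply: continuous_eps => t e e0.
  have /nb_fin[d d0 hd] := gap_gmap_cont (npole t) e0.
  have z10 : 0 < cabs (z + 1) + 1 by rewrite ltr_wpDl ?cabs_ge0.
  exists (d / (cabs (z + 1) + 1)); first by rewrite divr_gt0.
  move=> t' ht'; have hZ : cabs (Z t' - Z t) < d.
    have -> : Z t' - Z t = (t' - t)%:C * (z + 1) by rewrite /Z rmorphB; ring.
    rewrite cabsM cabsR; rewrite ltr_pdivlMr // in ht'; apply: le_lt_trans ht'.
    by rewrite ler_wpM2l // lerDl.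
  apply: le_lt_trans (hd _ hZ); rewrite /phi ler_norml.
  have h1 := cabsB_ge (gap (gmap K (Some (Z t')))) (gap (gmap K (Some (Z t)))).
  have h2 := cabsB_ge (gap (gmap K (Some (Z t)))) (gap (gmap K (Some (Z t')))).
  by rewrite cabsC in h2; lra.
have phi0 : phi 0 = 0.
  by rewrite /phi Z0 g1 /gap (psi_inf0 hf hl) (psi_inf0 hf' hl) subrr cabs0.
have phi1 : phi 1 = cabs (gap (gmap K (Some z))).
  by rewrite /phi /Z mul1r addrC addrK.
have [y /andP[y1 y2] yL] := pick_between [:: cabs (gap (pt S0 true 0)); cabs (gap (pt S1 true 0));
  cabs (gap (pt S2 true 0))] y0.
have [||t _ et] := @IVT R phi 0 1 y ler01; first exact: continuous_subspaceT.
  by rewrite phi0 phi1 ge_min le_max (ltW y1) (ltW y2) orbT.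
have t0 : t != 0 by apply: contraTneq y1 => t0; rewrite -et t0 phi0 ltxx.
have [w ew] := fin t t0.
have := @gap_values (gmap K (Some (Z t))) w (gmap_valid K _); rewrite gmap_proj => /(_ ew).
move: yL; rewrite -et /phi !inE => /negP yL h; apply: yL.
by case/or3P: h => /eqP ->; rewrite eqxx ?orbT.
Qed.

Lemma gap_zero p : gmap K p <> Reg l None -> gap (gmap K p) = 0.
Proof.
move=> hp; apply/eqP; rewrite -cabs_eq0 eq_le cabs_ge0 andbT.
apply/ler_addgt0Pr => e e0; rewrite add0r.
have hn := gap_gmap_cont hp e0.
have [z z0 hz] : exists2 z, Im z != 0 & cabs (gap (gmap K (Some z)) - gap (gmap K p)) < e.
  case: p hp hn => [z|] hp.
    move=> /nb_fin[d d0 hd]; case: (eqVneq (Im z) 0) => [I0|I0]; last first.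
      by exists z => //; apply: hd; rewrite subrr cabs0.
    exists (z + Complex 0 (d / 2)); first by rewrite cImD I0 add0r /= gt_eqF // divr_gt0.
    apply: hd; rewrite addrAC subrr add0r /cabs /= expr0n add0r sqrtr_sqr gtr0_norm; lra.
  move=> /nb_inf[_ [M hM]]; exists (Complex 0 (`|M| + 1)).
    by rewrite /= gt_eqF // ltr_wpDl.
  apply: hM; rewrite /cabs /= expr0n add0r sqrtr_sqr ger0_norm ?addr_ge0 //.
  by have := ler_norm M; lra.
by rewrite gap_nonreal // sub0r cabsN in hz; exact: ltW.
Qed.

Lemma psi_unique x : valid lam mu x -> f x = f' x.
Proof.
move=> vx; case: (pselect (x = Reg l None)) => [->|hx].
  by rewrite (psi_inf hf) (psi_inf hf').
have [v ev] := psi_fin hf vx hx; have [v' ev'] := psi_fin hf' vx hx.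
have := @gap_zero (ginv K x); rewrite ginvK // /gap ev ev' /= => /(_ hx) /eqP.
by rewrite subr_eq0 => /eqP ->.
Qed.

End Uniqueness.

(** * The algebraic system *)

Section Solution.
Context {R : realType} (lam mu al a : R).
Context (hlam : 1 < lam) (hmu : 1 < mu) (hal : -1 < al) (hal_a : al < a) (ha : a < 1).
Context (hsys : alg_system lam mu al a).

Local Ltac slra := move: hal hal_a ha => ? ? ?; lra.

(** With this [q] the quadratic equation is [x ^+ 2 + (a + al) * x + q - 3 = 0]. Many identities
    below are reductions modulo [sol_qE]. *)
Definition sol_q : R := (a - al) ^+ 2 / (1 - a * al).
Local Notation q := sol_q.
Definition sol_disc : R := (a + al) ^+ 2 - 4 * (q - 3).
Definition sol_be : R := (- (a + al) - Num.sqrt sol_disc) / 2.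
Definition sol_b : R := (- (a + al) + Num.sqrt sol_disc) / 2.
Local Notation be := sol_be. Local Notation b := sol_b.

Lemma sol_1P : 0 < 1 - a * al.
Proof.
have h1 : 0 < (1 - a) * (1 + al) by rewrite mulr_gt0 //; slra.
have h2 : 0 < (1 + a) * (1 - al) by rewrite mulr_gt0 //; slra.
slra.
Qed.

Lemma sol_qE : q * (1 - a * al) = (a - al) ^+ 2.
Proof. by rewrite /q divfK // gt_eqF // sol_1P. Qed.

Lemma sol_q_gt0 : 0 < q.
Proof. by rewrite divr_gt0 ?sol_1P // exprn_gt0 // subr_gt0. Qed.

Lemma sol_3P : 0 < 3 + a * al.
Proof.
have h1 : 0 < (1 + a) * (1 + al) by rewrite mulr_gt0 //; slra.
have h2 : 0 < (1 - a) * (1 - al) by rewrite mulr_gt0 //; slra.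
slra.
Qed.

Lemma sol_discE : sol_disc * (1 - a * al) = (3 + a * al) * (4 - (a + al) ^+ 2).
Proof.
have -> : sol_disc * (1 - a * al) =
  ((a + al) ^+ 2 + 12) * (1 - a * al) - 4 * (q * (1 - a * al)) by rewrite /sol_disc; ring.
by rewrite sol_qE; ring.
Qed.

Lemma sol_disc_gt0 : 0 < sol_disc.
Proof.
rewrite -(pmulr_lgt0 _ sol_1P) sol_discE mulr_gt0 ?sol_3P //.
have -> : 4 - (a + al) ^+ 2 = (2 - (a + al)) * (2 + (a + al)) by ring.
by rewrite mulr_gt0 //; slra.
Qed.

Lemma sol_sum : be + b = - (a + al).
Proof. by rewrite /be /b; field. Qed.

Lemma sol_diff : b - be = Num.sqrt sol_disc.
Proof. by rewrite /be /b; field. Qed.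

Lemma sol_prod : be * b = q - 3.
Proof.
have h : Num.sqrt sol_disc ^+ 2 = sol_disc by rewrite sqr_sqrtr // ltW // sol_disc_gt0.
have -> : be * b = ((a + al) ^+ 2 - Num.sqrt sol_disc ^+ 2) / 4 by rewrite /be /b; field.
by rewrite h /sol_disc; field.
Qed.

Lemma sol_beb : be < b.
Proof. by rewrite -subr_gt0 sol_diff sqrtr_gt0 sol_disc_gt0. Qed.

(** Together with [sol_p1]: the quadratic is negative at 1 and at -1, so its roots enclose both. *)
Lemma sol_m1 : (1 - be) * (1 - b) < 0.
Proof.
have -> : (1 - be) * (1 - b) = 1 - (be + b) + be * b by ring.
rewrite sol_sum sol_prod -(pmulr_llt0 _ sol_1P).
have -> : (1 - - (a + al) + (q - 3)) * (1 - a * al) =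
  (a + al - 2) * (1 - a * al) + q * (1 - a * al) by ring.
rewrite sol_qE.
have -> : (a + al - 2) * (1 - a * al) + (a - al) ^+ 2 = - ((2 + a + al) * (1 - a) * (1 - al)) by ring.
by rewrite oppr_lt0 !mulr_gt0 //; slra.
Qed.

Lemma sol_p1 : (1 + be) * (1 + b) < 0.
Proof.
have -> : (1 + be) * (1 + b) = 1 + (be + b) + be * b by ring.
rewrite sol_sum sol_prod -(pmulr_llt0 _ sol_1P).
have -> : (1 - (a + al) + (q - 3)) * (1 - a * al) =
  - (a + al + 2) * (1 - a * al) + q * (1 - a * al) by ring.
rewrite sol_qE.
have -> : - (a + al + 2) * (1 - a * al) + (a - al) ^+ 2 = - ((2 - a - al) * (1 + a) * (1 + al)) by ring.
by rewrite oppr_lt0 !mulr_gt0 //; slra.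
Qed.

Lemma sol_be1 : be < -1.
Proof.
have h1 := sol_p1; have h2 := sol_beb; rewrite ltNge; apply/negP => h.
have : 0 <= (1 + be) * (1 + b) by rewrite mulr_ge0 //; lra.
lra.
Qed.

Lemma sol_b1 : 1 < b.
Proof.
have h1 := sol_m1; have h2 := sol_beb; rewrite ltNge; apply/negP => h.
have : 0 <= (1 - be) * (1 - b) by rewrite mulr_ge0 //; lra.
lra.
Qed.

Lemma sol_quad x : x = be \/ x = b -> quad_eq al a x.
Proof.
have -> : quad_eq al a x = (x ^+ 2 - (be + b) * x + be * b = 0).
  by rewrite /quad_eq sol_sum sol_prod /q; congr (_ = _); ring.
by case=> ->; ring.
Qed.

(** The value [H a], as [sol_Ha] shows, in a visibly positive form. *)
Definition sol_c : R := q * (a - al) / 4.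
Definition sol_A : R := - A_const be al a b.
Definition sol_B : R := - B_const be al a b.
(** This is [h] plus the constants split off when [z / (1 - z)] and [z / (1 + z)] are written as
    partial fractions; see [sol_Hfun]. *)
Definition sol_k : R := (a + al) * (q - 6) / 4.
Local Notation A := sol_A. Local Notation B := sol_B. Local Notation k := sol_k. Local Notation c := sol_c.

Lemma sol_A0 : 0 < A.
Proof.
have -> : A = 4^-1 * (1 - al) * (1 - a) * - ((1 - be) * (1 - b)) by rewrite /A /A_const; ring.
by rewrite !mulr_gt0 ?oppr_gt0 ?sol_m1 //; slra.
Qed.

Lemma sol_B0 : 0 < B.
Proof.
have -> : B = 4^-1 * (1 + al) * (1 + a) * - ((1 + be) * (1 + b)) by rewrite /B /B_const; ring.
by rewrite !mulr_gt0 ?oppr_gt0 ?sol_p1 //; slra.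
Qed.

Lemma sol_c0 : 0 < c.
Proof. by rewrite /c mulr_gt0 // mulr_gt0 ?sol_q_gt0 // subr_gt0. Qed.

(** [A] and [B] are the values that make these monic quartics agree at 1 and -1, so their difference
    is divisible by [1 - x ^+ 2]. As the four roots add up to 0 the cofactor is constant, and the
    equation for [q] makes it vanish. *)
Lemma sol_quart x : (1 - x ^+ 2) ^+ 2 - A * (1 + x) ^+ 2 - B * (1 - x) ^+ 2 =
  (x - be) * (x - al) * (x - a) * (x - b).
Proof.
apply/eqP; rewrite -subr_eq0; apply/eqP.
have qE : q = be * b + 3 by rewrite sol_prod subrK.
have bE : be = - (a + al) - b by rewrite -sol_sum; ring.
transitivity (2^-1 * (1 - x ^+ 2) * (q * (1 - a * al) - (a - al) ^+ 2)); last first.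
  by rewrite sol_qE subrr mulr0.
by rewrite qE /A /B /A_const /B_const bE; field.
Qed.

(** The value of [c G] at [x] when [x] and [y] are the two roots [be] and [b], as [sol_crit]
    shows. *)
Definition sol_val x y : R := k + x - ((a + al) + y * (1 + a * al)) / 2.

(** This is the meaning of the first equation of the system. The second one fixes the square of the
    difference, whose sign is known ([sol_val_diff]); together they give the critical values
    [lam * c] and [- (mu * c)]. *)
Lemma sol_val_sum : sol_val b be + sol_val be b = (lam - mu) * c.
Proof.
have [h _] := hsys; have h1 : 1 - a * al != 0 by rewrite gt_eqF // sol_1P.
have -> : sol_val b be + sol_val be b = (a + al) * (q - 8) / 2 + (be + b) * (1 - a * al) / 2.
  by rewrite /sol_val /k; field.
apply: (mulIf h1); rewrite sol_sum.
transitivity ((a + al) * (q * (1 - a * al) - (9 - a * al) * (1 - a * al)) / 2).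
  by field.
transitivity ((lam - mu) * (a - al) * (q * (1 - a * al)) / 4); last by rewrite /c; field.
rewrite sol_qE; slra.
Qed.

Lemma sol_val_diff : sol_val b be - sol_val be b = (lam + mu) * c.
Proof.
have [_ h] := hsys; have h1 : (1 - a * al) ^+ 2 != 0 by rewrite expf_neq0 // gt_eqF // sol_1P.
have e : sol_val b be - sol_val be b = Num.sqrt sol_disc * (3 + a * al) / 2.
  by rewrite -sol_diff /sol_val /k; field.
have p0 : 0 <= sol_val b be - sol_val be b by rewrite e !mulr_ge0 ?sqrtr_ge0 ?(ltW sol_3P) ?invr_ge0.
have p1 : 0 <= (lam + mu) * c by rewrite mulr_ge0 ?(ltW sol_c0) //; move: hlam hmu => ? ?; lra.
apply/eqP; rewrite -(@eqrXn2 _ 2) //; apply/eqP; apply: (mulIf h1).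
rewrite e; transitivity ((3 + a * al) ^+ 2 * (1 - a * al) / 4 * (sol_disc * (1 - a * al))).
  by rewrite !exprMn sqr_sqrtr ?(ltW sol_disc_gt0) //; field.
transitivity ((lam + mu) ^+ 2 * (a - al) ^+ 2 * (q * (1 - a * al)) ^+ 2 / 16); last by rewrite /c; field.
rewrite sol_qE sol_discE; transitivity (((lam + mu) ^+ 2 * (a - al) ^+ 6) / 16); last by field.
by rewrite h; field.
Qed.

Lemma sol_crit v x : (v, x) \in [:: (- (mu * c), be); (- c, al); (c, a); (lam * c, b)] ->
  (k + x) * (x ^+ 2 - 1) + A * (1 + x) - B * (1 - x) = v * (x ^+ 2 - 1).
Proof.
have qE : q = be * b + 3 by rewrite sol_prod subrK.
have bE : be = - (a + al) - b by rewrite -sol_sum; ring.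
have key t u : t + u = be + b -> t * u = be * b ->
    (k + t) * (t ^+ 2 - 1) + A * (1 + t) - B * (1 - t) = sol_val t u * (t ^+ 2 - 1).
  move=> e1 e2; rewrite /A /B /A_const /B_const.
  have -> : 4^-1 * (1 - be) * (1 - al) * (1 - a) * (1 - b) =
    4^-1 * (1 - al) * (1 - a) * (1 - (be + b) + be * b) by ring.
  have -> : 4^-1 * (1 + be) * (1 + al) * (1 + a) * (1 + b) =
    4^-1 * (1 + al) * (1 + a) * (1 + (be + b) + be * b) by ring.
  by rewrite -e1 -e2 /sol_val; field.
rewrite !inE => /or4P[] /eqP[-> ->].
- rewrite (key be b) //; congr (_ * _); have := sol_val_sum; have := sol_val_diff; slra.
- by rewrite /k /c /A /B /A_const /B_const qE bE; field.
- by rewrite /k /c /A /B /A_const /B_const qE bE; field.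
- rewrite (key b be) 1?[b + _]addrC 1?[b * _]mulrC //; congr (_ * _); have := sol_val_sum; have := sol_val_diff; slra.
Qed.

Definition sol_config : config R :=
  Config sol_A0 sol_B0 sol_c0 sol_be1 hal hal_a ha sol_b1 hlam hmu sol_quart sol_crit.

Lemma sol_Hfun z : z != 1 -> z != -1 ->
  Hfun (h_const al a) (A_const be al a b) (B_const be al a b) z =
  k%:C + z - A%:C / (1 - z) + B%:C / (1 + z).
Proof.
move=> z1 z2; have n1 : 1 - z != 0 by rewrite subr_eq0 eq_sym.
have n2 : 1 + z != 0 by rewrite addrC addr_eq0.
have kE : k = h_const al a + A - B.
  rewrite /k /h_const -/q /A /B /A_const /B_const.
  have qE : q = be * b + 3 by rewrite sol_prod subrK.
  have bE : be = - (a + al) - b by rewrite -sol_sum; ring.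
  by rewrite qE bE; field.
rewrite kE rmorphB rmorphD /A /B !rmorphN /= /Hfun; field.
by rewrite n1 n2.
Qed.

Lemma sol_Ha : Hfun (h_const al a) (A_const be al a b) (B_const be al a b) a%:C = c%:C.
Proof.
have n1 : a != 1 by rewrite lt_eqF.
have n2 : a != -1 by rewrite gt_eqF //; slra.
have m1 : 1 - a != 0 by rewrite subr_eq0 eq_sym.
have m2 : 1 + a != 0 by rewrite addrC addr_eq0.
rewrite sol_Hfun; last 2 first.
- by rewrite -(rmorph1 (real_complex R)) (inj_eq (@complexI R)).
- by rewrite -(rmorphN1 (real_complex R)) (inj_eq (@complexI R)).
have e : c = k + a - A / (1 - a) + B / (1 + a).
  have h0 : a ^+ 2 - 1 != 0.
    by rewrite (_ : a ^+ 2 - 1 = - ((1 - a) * (1 + a))) ?oppr_eq0 ?mulf_neq0 //; ring.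
  apply: (mulIf h0); rewrite -(@sol_crit c a) ?inE ?eqxx ?orbT //.
  by field; rewrite m1 m2.
by rewrite e !(rmorphD, rmorphN, rmorphM, fmorphV, rmorph1).
Qed.

End Solution.

(* Put [P = a al], [D = (a - al) ^ 2], [q = D / (1 - P)], [r ^ 2 = (3 + P) / q]. Since
   [4 - (a + al) ^ 2 = (1 - P) (4 - q)], the second equation is linear in [q] for fixed [r],
   which expresses [a] and [al] through [r]. *)
Lemma alg_system_param (R : realType) (lam mu m r u v : R) : m ^+ 8 - r ^+ 4 != 0 ->
  lam + mu = 2 * m ^+ 4 ->
  u ^+ 2 = (r ^+ 2 - 1) * (m ^+ 8 - r ^+ 6) ->
  v ^+ 2 = (m ^+ 8 - r ^+ 4) ^+ 2 - (2 * m ^+ 4 * r * (r ^+ 2 - 1)) ^+ 2 ->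
  (lam - mu) * (m ^+ 8 - r ^+ 6) * r * u = v * (m ^+ 8 * (2 * r ^+ 2 - 1) - r ^+ 6 * (2 - r ^+ 2)) ->
  let d := m ^+ 8 - r ^+ 4 in
  let al := (- v - 2 * r * u) / d in let a := (- v + 2 * r * u) / d in
  1 - a * al = 4 * r ^+ 4 * (r ^+ 2 - 1) / d /\ alg_system lam mu al a.
Proof.
move=> d0 hs hu hv h d al a; have dE : m ^+ 8 - r ^+ 4 = d by [].
have sE : a + al = - 2 * v / d by rewrite /a /al; field.
have dlE : a - al = 4 * r * u / d by rewrite /a /al; field.
have PE : 1 - a * al = 4 * r ^+ 4 * (r ^+ 2 - 1) / d.
  have -> : 1 - a * al = (d ^+ 2 - v ^+ 2 + 4 * r ^+ 2 * u ^+ 2) / d ^+ 2 by rewrite /a /al; field.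
  by rewrite hv hu /d; field.
have s2 : 4 - (a + al) ^+ 2 = (4 * m ^+ 4 * r * (r ^+ 2 - 1) / d) ^+ 2.
  have -> : 4 - (a + al) ^+ 2 = (d ^+ 2 - v ^+ 2) * 4 / d ^+ 2 by rewrite sE; field.
  by rewrite hv /d; field.
split=> //; split.
  have -> : 2 * (a + al) * (3 - a * al - a - al) * (3 - a * al + a + al) =
      2 * (a + al) * ((4 - (a + al) ^+ 2) + 4 * (1 - a * al) + (1 - a * al) ^+ 2) by ring.
  rewrite s2 PE sE dlE.
  transitivity (64 * r ^+ 2 * (r ^+ 2 - 1) / d ^+ 3 *
     ((lam - mu) * (m ^+ 8 - r ^+ 6) * r * u -
      v * (m ^+ 8 * (2 * r ^+ 2 - 1) - r ^+ 6 * (2 - r ^+ 2)))); last by rewrite h subrr mulr0.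
  have -> : (4 * r * u / d) ^+ 3 = 64 * r ^+ 3 * u * u ^+ 2 / d ^+ 3 by field.
  by rewrite hu /d; field.
have -> : 4 * (3 + a * al) ^+ 3 * (1 - a * al) * (2 + a + al) * (2 - a - al) =
  4 * (4 - (1 - a * al)) ^+ 3 * (1 - a * al) * (4 - (a + al) ^+ 2) by ring.
rewrite s2 PE dlE hs.
have -> : (4 * r * u / d) ^+ 6 = 4096 * r ^+ 6 * (u ^+ 2) ^+ 3 / d ^+ 6 by field.
by rewrite hu /d; field.
Qed.

(** Positivity of [m ^+ 8 - r ^+ 6] makes [u] a real number. The hypothesis concerns the factor of
    [v ^+ 2] that decides its sign, so it describes the range where [v] is real. *)
Lemma alg_system_range (R : realType) (m r : R) : 1 < m -> m < r ->
  0 <= m ^+ 8 - r ^+ 4 - 2 * m ^+ 4 * r * (r ^+ 2 - 1) -> r ^+ 6 < m ^+ 8.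
Proof.
move=> m1 mr; apply: contraTT; rewrite -leNgt -ltNge => h.
have r1 : 1 < r by apply: lt_trans mr.
have r0 : 0 < r by apply: lt_trans r1.
have M0 : 0 < m ^+ 4 by rewrite exprn_gt0 // (lt_trans ltr01).
have hM : m ^+ 4 <= r ^+ 3.
  by rewrite -(@ler_pXn2r _ 2) ?nnegrE ?(ltW M0) ?exprn_ge0 ?(ltW r0) // -!exprM.
rewrite -[8%N]/(4 * 2)%N exprM; move: (m ^+ 4) M0 hM => M M0 hM.
have h1 : M * M <= M * r ^+ 3 by rewrite ler_pM2l.
have r2 : 1 < r ^+ 2 by rewrite exprn_egt1.
have r4 : 0 < r ^+ 4 by rewrite exprn_gt0.
have [h2|h2] := leP 2 (r ^+ 2).
  have h3 : 0 <= M * r * (r ^+ 2 - 2) by rewrite !mulr_ge0 ?(ltW M0) ?(ltW r0) // subr_ge0.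
  lra.
have h3 : M * (r * (2 - r ^+ 2)) <= r ^+ 3 * (r * (2 - r ^+ 2)).
  by rewrite ler_pM2r // mulr_gt0 // subr_gt0.
have h4 : 0 < r ^+ 4 * (r ^+ 2 - 1) by rewrite mulr_gt0 // subr_gt0.
lra.
Qed.

Lemma alg_system_solvable (R : realType) (lam mu : R) : 1 < lam -> 1 < mu ->
  exists al a : R, [/\ -1 < al, al < a, a < 1 & alg_system lam mu al a].
Proof.
(* Replacing [(al, a)] by [(- a, - al)] exchanges [lam] and [mu]. *)
wlog le : lam mu / mu <= lam.
  move=> H l1 m1; case: (leP mu lam) => [h|/ltW h]; first exact: H.
  have [al [a [h1 h2 h3 [e1 e2]]]] := H _ _ h m1 l1.
  exists (- a), (- al); split; [lra|lra|lra|].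
  split; last first.
    have -> : (- al - - a) = a - al by ring.
    by rewrite [lam + mu]addrC e2; ring.
  transitivity (- (0 : R)); last exact: oppr0.
  by rewrite -e1; ring.
move=> l1 mu1.
(* A fourth root, so that the interval for [r] can start at [m], where [w] and [F] factor. *)
pose m := Num.sqrt (Num.sqrt ((lam + mu) / 2)).
have mE : lam + mu = 2 * m ^+ 4.
  have s0 : 0 <= (lam + mu) / 2 by lra.
  by rewrite -[4%N]/(2 * 2)%N exprM !sqr_sqrtr ?sqrtr_ge0 //; field.
have m1 : 1 < m.
  rewrite ltNge; apply/negP => h; have := @exprn_ile1 _ 4 m (sqrtr_ge0 _) h; lra.
move: m mE m1 => m mE m1.
have m0 : 0 < m by apply: lt_trans m1.
have m21 : 0 < m ^+ 2 - 1 by rewrite subr_gt0 exprn_egt1.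
pose w r := m ^+ 8 - r ^+ 4 - 2 * m ^+ 4 * r * (r ^+ 2 - 1).
pose pw : {poly R} := (m ^+ 8)%:P - 'X^4 - (2 * m ^+ 4) *: ('X * ('X^2 - 1)).
have pwE r : pw.[r] = w r by rewrite /pw /w !hornerE /=; ring.
have wm : 0 < w m.
  have -> : w m = m ^+ 4 * (m ^+ 2 - 1) * (m - 1) ^+ 2 by rewrite /w; ring.
  by rewrite !mulr_gt0 ?exprn_gt0 // subr_gt0.
(* At [r0] the expression for [v ^+ 2] vanishes, which is the case [a + al = 0]; this is the far end
   of the interval for [r]. *)
have [r0 /andP[mr0 _] wr0] : exists2 r0, m <= r0 <= m ^+ 2 & w r0 = 0.
  have [||r0 h] := @poly_ivt _ (- pw) m (m ^+ 2); first by rewrite expr2 ler_pMl // ltW.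
    rewrite !hornerN !pwE oppr_le0 ltW //= (_ : - w _ = 2 * m ^+ 6 * ((m ^+ 2 - 1) * (m ^+ 2 + 1))).
      by rewrite !mulr_ge0 ?(ltW m21) ?addr_ge0 ?exprn_ge0 ?(ltW m0).
    by rewrite /w; ring.
  by rewrite rootN /root pwE => /eqP; exists r0.
pose V r := (m ^+ 8 - r ^+ 4) ^+ 2 - (2 * m ^+ 4 * r * (r ^+ 2 - 1)) ^+ 2.
pose T r := m ^+ 8 * (2 * r ^+ 2 - 1) - r ^+ 6 * (2 - r ^+ 2).
(* The first equation in the parameter [r], squared to remove [u] and [v]. *)
pose F r := (lam - mu) ^+ 2 * ((m ^+ 8 - r ^+ 6) ^+ 3 * r ^+ 2 * (r ^+ 2 - 1)) - V r * T r ^+ 2.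
have VE r : V r = w r * (m ^+ 8 - r ^+ 4 + 2 * m ^+ 4 * r * (r ^+ 2 - 1)) by rewrite /V /w; ring.
have range r : m <= r -> 0 <= w r -> r ^+ 6 < m ^+ 8.
  rewrite le_eqVlt => /orP[/eqP <- _|mr wr]; last exact: alg_system_range mr wr.
  by rewrite ltr_eXn2l.
have [r /andP[mr rr0] Fr] : exists2 r, m <= r <= r0 & F r = 0.
  pose pF : {poly R} := ((lam - mu) ^+ 2) *: (((m ^+ 8)%:P - 'X^6) ^+ 3 * 'X^2 * ('X^2 - 1)) -
    (((m ^+ 8)%:P - 'X^4) ^+ 2 - (2 * m ^+ 4) ^+ 2 *: ('X^2 * ('X^2 - 1) ^+ 2)) *
    (m ^+ 8 *: (2 *: 'X^2 - 1) - 'X^6 * (2%:P - 'X^2)) ^+ 2.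
  have pFE r : pF.[r] = F r by rewrite /pF /F /V /T !hornerE /=; ring.
  have [|r h] := @poly_ivt _ pF m r0 mr0; last by rewrite /root pFE => /eqP; exists r.
  rewrite !pFE; apply/andP; split.
    (* Here [2 * (m ^+ 4 - 1)] is [lam + mu - 2], larger than [lam - mu] because [1 < mu]. The
       strict inequality will exclude [r = m]. *)
    have -> : F m = m ^+ 20 * (m ^+ 2 - 1) ^+ 4 * ((lam - mu) ^+ 2 - (2 * (m ^+ 4 - 1)) ^+ 2).
      by rewrite /F /V /T; ring.
    rewrite mulr_ge0_le0 ?mulr_ge0 ?exprn_ge0 ?(ltW m0) ?(ltW m21) // subr_le0.
    by rewrite ler_pXn2r ?nnegrE ?subr_ge0 //; lra.
  rewrite /F VE wr0 mul0r mul0r subr0.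
  have h := range r0 mr0; rewrite wr0 lexx in h; have h' := h isT.
  have r01 : 0 <= r0 by rewrite (le_trans (ltW m0)).
  by rewrite !mulr_ge0 ?exprn_ge0 ?subr_ge0 ?(ltW h') // exprn_ege1 // (le_trans (ltW m1)).
have {mr} mr : m < r.
  rewrite lt_neqAle mr andbT; apply/eqP => e; move: Fr; rewrite -e => /eqP.
  have -> : F m = m ^+ 20 * (m ^+ 2 - 1) ^+ 4 * ((lam - mu) ^+ 2 - (2 * (m ^+ 4 - 1)) ^+ 2).
    by rewrite /F /V /T; ring.
  rewrite mulf_eq0 gt_eqF ?mulr_gt0 ?exprn_gt0 //= subr_eq0 eqrXn2 //; [|lra|lra].
  by move/eqP; lra.
have r1 : 1 < r by apply: lt_trans mr.
have rp : 0 < r by apply: lt_trans r1.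
have r21 : 0 < r ^+ 2 - 1 by rewrite subr_gt0 exprn_egt1.
have wr : 0 <= w r.
  have e4 : r ^+ 4 <= r0 ^+ 4 by rewrite ler_pXn2r ?nnegrE ?(ltW rp) ?(le_trans (ltW rp)).
  have e2 : r ^+ 2 - 1 <= r0 ^+ 2 - 1 by rewrite lerD2r ler_pXn2r ?nnegrE ?(ltW rp) ?(le_trans (ltW rp)).
  have e3 : r * (r ^+ 2 - 1) <= r0 * (r0 ^+ 2 - 1) by apply: ler_pM; rewrite ?(ltW rp) ?(ltW r21).
  have e5 : 2 * m ^+ 4 * (r * (r ^+ 2 - 1)) <= 2 * m ^+ 4 * (r0 * (r0 ^+ 2 - 1)).
    by rewrite ler_wpM2l // mulr_ge0 // exprn_ge0 // ltW.
  have : w r - w r0 = (r0 ^+ 4 - r ^+ 4) + (2 * m ^+ 4 * (r0 * (r0 ^+ 2 - 1)) - 2 * m ^+ 4 * (r * (r ^+ 2 - 1))).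
    by rewrite /w; ring.
  rewrite wr0; lra.
have r6 := range r (ltW mr) wr.
have r4 : 0 < m ^+ 8 - r ^+ 4.
  by rewrite subr_gt0 (lt_trans _ r6) // ltr_eXn2l.
have r60 : 0 < m ^+ 8 - r ^+ 6 by rewrite subr_gt0.
have Vr : 0 <= V r.
  by rewrite VE mulr_ge0 // addr_ge0 ?(ltW r4) // !mulr_ge0 ?exprn_ge0 ?(ltW rp) ?(ltW m0) ?(ltW r21).
pose U := (r ^+ 2 - 1) * (m ^+ 8 - r ^+ 6).
have U0 : 0 < U by rewrite mulr_gt0.
have Tr : 0 <= T r.
  have t1 : r ^+ 6 * (2 * r ^+ 2 - 1) <= m ^+ 8 * (2 * r ^+ 2 - 1) by rewrite ler_wpM2r ?(ltW r6) //; lra.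
  have t2 : 0 < r ^+ 6 * (r ^+ 2 - 1) by rewrite mulr_gt0 // exprn_gt0.
  by rewrite /T; lra.
pose u := Num.sqrt U; pose v := Num.sqrt (V r).
have uE : u ^+ 2 = U by rewrite sqr_sqrtr // ltW.
have vE : v ^+ 2 = V r by rewrite sqr_sqrtr.
have u0 : 0 < u by rewrite sqrtr_gt0.
have v0 : 0 <= v by rewrite sqrtr_ge0.
have key : (lam - mu) * (m ^+ 8 - r ^+ 6) * r * u = v * T r.
  (* Both sides are nonnegative, thanks to [mu <= lam] and [0 <= T r], so the squared equation
     suffices. *)
  apply/eqP; rewrite -(@eqrXn2 _ 2) //; last 2 first.
  - by rewrite !mulr_ge0 ?(ltW u0) ?(ltW rp) ?(ltW r60) // subr_ge0.
  - by rewrite mulr_ge0.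
  rewrite !exprMn uE vE -subr_eq0; apply/eqP; rewrite -Fr /F /U; ring.
have d0 : m ^+ 8 - r ^+ 4 != 0 by rewrite gt_eqF.
have [PE sys] := alg_system_param d0 mE uE vE key.
set d := m ^+ 8 - r ^+ 4 in PE sys r4 d0; set al := (_ - _) / d in PE sys; set a := (_ + _) / d in PE sys.
have dl : a - al = 4 * r * u / d by rewrite /a /al; field.
have aal : a + al = - 2 * v / d by rewrite /a /al; field.
have s0 : a + al <= 0 by rewrite aal mulNr mulNr oppr_le0 divr_ge0 ?mulr_ge0 ?(ltW r4).
have dl0 : 0 < a - al by rewrite dl divr_gt0 // !mulr_gt0.
(* This follows from [m < r] and amounts to [0 < (1 - a) * (1 + al)] below. *)
have u1 : u < r ^+ 3 * (r ^+ 2 - 1).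
  rewrite -(@ltr_pXn2r _ 2) ?nnegrE ?(ltW u0) ?mulr_ge0 ?exprn_ge0 ?(ltW rp) ?(ltW r21) //.
  have -> : (r ^+ 3 * (r ^+ 2 - 1)) ^+ 2 = (r ^+ 2 - 1) * (r ^+ 8 - r ^+ 6) by ring.
  by rewrite uE ltr_pM2l // ltrD2r ltr_pXn2r ?nnegrE ?(ltW rp) ?(ltW m0).
have u2 : 2 * r * u < d.
  have r34 : r ^+ 3 < m ^+ 4.
    by rewrite -(@ltr_pXn2r _ 2) ?nnegrE ?exprn_ge0 ?(ltW rp) ?(ltW m0) // -!exprM.
  have u3 : u < m ^+ 4 * (r ^+ 2 - 1) by rewrite (lt_trans u1) // ltr_pM2r.
  have u4 : r * u < r * (m ^+ 4 * (r ^+ 2 - 1)) by rewrite ltr_pM2l.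
  by move: wr; rewrite /w -/d; lra.
have p0 : 0 < (1 - a) * (1 + al).
  have -> : (1 - a) * (1 + al) = 1 - a * al - (a - al) by ring.
  rewrite PE dl (_ : _ - _ = 4 * r * (r ^+ 3 * (r ^+ 2 - 1) - u) / d); last by field.
  by rewrite divr_gt0 // !mulr_gt0 // subr_gt0.
(* The factors [1 - a] and [1 + al] of the positive product have sum [2 - (a - al)], so a positive
   sum makes both positive. *)
have dl2 : a - al < 2 by rewrite dl ltr_pdivrMr //; lra.
have a1 : a < 1.
  rewrite ltNge; apply/negP => h; have : 0 <= (a - 1) * (1 + al) by rewrite mulr_ge0; lra.
  lra.
have al1 : -1 < al by have := pmulr_rgt0 (1 + al) (_ : 0 < 1 - a); rewrite p0 subr_gt0; lra.
by exists al, a; split=> //; lra.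
Qed.

(** * Uniqueness of the solution of the system *)

Section Unique.
Context {R : realType}.

Lemma config_unique (K K' : config R) : g_lam K = g_lam K' -> g_mu K = g_mu K' ->
  g_al K = g_al K' /\ g_a K = g_a K'.
Proof.
move=> el em.
have h1 : is_psi (g_lam K) (g_mu K) S1 (psi1_formula (g_c K')%:C (ginv K')).
  by rewrite el em; exact: psi1_is_psi.
have eq x : valid (g_lam K) (g_mu K) x ->
    psi1_formula (g_c K)%:C (ginv K) x = psi1_formula (g_c K')%:C (ginv K') x.
  by move=> vx; apply: (@psi_unique _ K S1 _ _ _ (psi1_is_psi K) h1) => //.
have c0 := cC_neq0 K; have c0' := cC_neq0 K'.
(* At infinity on S2 the preimage is 1 for every configuration, so psi takes the value [2 / c]
   there. *)
have ec : (g_c K)%:C = (g_c K')%:C.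
  have /(congr1 (odflt 0)) := eq (Reg S2 None) (@inf_valid _ K S2).
  rewrite /psi1_formula !ginv_inf; cbn [odflt oapp zeta_inf] => e.
  have two : 1 + 1 != 0 :> R[i] by rewrite -[1 + 1]/(2%:R) pnatr_eq0.
  by apply: GRing.invr_inj; apply: (mulfI two).
have eg x : valid (g_lam K) (g_mu K) x -> ginv K x = ginv K' x.
  move=> /eq; rewrite /psi1_formula -ec.
  case: (ginv K x) (ginv K' x) => [u|] [u'|] // /(congr1 (odflt 0)) e.
  have ci : (g_c K)%:C^-1 != 0 by rewrite invr_neq0.
  by congr Some; apply: (@addrI _ 1); apply: (mulIf ci).
have ga (L : config R) : gmap L (Some (g_a L)%:C) = Cut2 None 1 /\ gmap L (Some (g_al L)%:C) = Cut1 None (-1).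
  have l1 := g_al_a L; have l2 := g_al1 L; have l3 := g_a1 L; have l4 := g_c0 L.
  have val v x : (v, x) \in [:: (- g_c L, g_al L); (g_c L, g_a L)] ->
      GG L (Some x%:C) = Some (v / g_c L)%:C.
    move=> hv; apply/GG_fin; rewrite /cnum.
    have hv' : (v, x) \in [:: (- (g_mu L * g_c L), g_be L); (- g_c L, g_al L); (g_c L, g_a L);
        (g_lam L * g_c L, g_b L)].
      by move: hv; rewrite !inE => /orP[] ->; rewrite ?orbT.
    have /(congr1 (real_complex R)) := g_crit hv'.
    have -> : (g_c L)%:C * (v / g_c L)%:C = v%:C by rewrite -rmorphM /= mulrC divfK // gt_eqF.
    by rewrite !(rmorphD, rmorphN, rmorphM, rmorphXn, rmorph1) /= => <-.
  have /andP[x1 x2] := x0_bounds L.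
  rewrite /gmap !NN_real !subrr !(mulr0, mul0r) eqxx /= x1 ltNge (ltW x2) /=.
  rewrite /bank /= eqxx (val (g_c L)) ?inE ?eqxx ?orbT // (val (- g_c L)) ?inE ?eqxx ?orbT //=.
  by rewrite mulNr divff // gt_eqF.
have v1 : valid (g_lam K) (g_mu K) (Cut2 None 1) by left.
have v2 : valid (g_lam K) (g_mu K) (Cut1 None (-1)) by right.
have [a1 a2] := ga K; have [b1 b2] := ga K'; split.
  by have := eg _ v2; rewrite -{1}a2 -b2 !gmapK => -[->].
by have := eg _ v1; rewrite -{1}a1 -b1 !gmapK => -[->].
Qed.

End Unique.

Unset Implicit Arguments.

Theorem theorem3p1 (R : realType) (lam mu : R) (hlam : 1 < lam) (hmu : 1 < mu) :
  exists alpha a : R,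
  [/\ -1 < alpha /\ alpha < a /\ a < 1,
      alg_system lam mu alpha a,
      (forall alpha' a' : R, -1 < alpha' -> alpha' < a' -> a' < 1 ->
         alg_system lam mu alpha' a' -> alpha' = alpha /\ a' = a)
    & exists beta b : R,
      [/\ beta < -1, 1 < b, quad_eq alpha a beta, quad_eq alpha a b &
      let h := h_const alpha a in
      let A := A_const beta alpha a b in
      let B := B_const beta alpha a b in
      let Ha := Hfun h A B a%:C in
      let G := fun z : R[i] => Hfun h A B z / Ha in
      exists p q : {poly R[i]},
        [/\ coprimep p q,
            maxn (size p) (size q) = 4%N,
            (forall z : R[i], q.[z] != 0 -> G z = p.[z] / q.[z])
          & exists (g : Cbar R -> surf R) (ginv : surf R -> Cbar R),
            [/\ conformal_param lam mu g ginv,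
                (forall z : Cbar R, surf_proj (g z) = ratC p q z),
                (is_psi lam mu S1 (psi1_formula Ha ginv) /\
                 forall psi, is_psi lam mu S1 psi ->
                   forall x, valid lam mu x -> psi x = psi1_formula Ha ginv x)
              & (is_psi lam mu S2 (psi2_formula A Ha ginv) /\
                 forall psi, is_psi lam mu S2 psi ->
                   forall x, valid lam mu x -> psi x = psi2_formula A Ha ginv x)]]]].
Proof.
have [al [a [h1 h2 h3 hs]]] := alg_system_solvable hlam hmu.
pose K := sol_config hlam hmu h1 h2 h3 hs.
exists al, a; split=> //.
  move=> al' a' h1' h2' h3' hs'; pose K' := sol_config hlam hmu h1' h2' h3' hs'.
  exact: (@config_unique _ K' K erefl erefl).
exists (g_be K), (g_b K); split.
- exact: g_be1.
- exact: g_b1.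
- by apply: (sol_quad h1 h2 h3); left.
- by apply: (sol_quad h1 h2 h3); right.
move=> h A B Ha G.
have eA : - g_A K = A by rewrite /= opprK.
have eHa : Ha = (g_c K)%:C := sol_Ha hlam hmu h1 h2 h3 hs.
have hG z : (denp K).[z] != 0 -> G z = (nump K).[z] / (denp K).[z].
  rewrite denp_eval nump_eval mulf_eq0 negb_or => /andP[c0].
  rewrite (_ : z ^+ 2 - 1 = (z - 1) * (z + 1)); last by ring.
  rewrite mulf_eq0 negb_or => /andP[z1 z2].
  rewrite subr_eq0 in z1; rewrite addr_eq0 in z2.
  rewrite /G eHa [Hfun _ _ _ _](sol_Hfun h1 h2 h3 z1 z2) /cnum.
  have n1 : 1 - z != 0 by rewrite subr_eq0 eq_sym.
  have n3 : z - 1 != 0 by rewrite subr_eq0.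
  have n4 : z + 1 != 0 by rewrite addr_eq0.
  by field; rewrite n4 n3 c0 n1.
exists (nump K), (denp K); split=> //.
- exact: coprime_nd.
- by rewrite size_nump size_denp.
exists (gmap K), (ginv K); rewrite eHa -eA; split.
- exact: gmap_conformal.
- exact: gmap_proj.
- split; first exact: (@psi1_is_psi _ K).
  by move=> psi hpsi x vx; exact: (@psi_unique _ K S1 _ _ _ hpsi (psi1_is_psi K)).
- split; first exact: (@psi2_is_psi _ K).
  by move=> psi hpsi x vx; exact: (@psi_unique _ K S2 _ _ _ hpsi (psi2_is_psi K)).
Qed.
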